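(* Let $S=S_1\cdots S_{2N}$, $R=R_1\cdots R_{2N}$, $E=E_1\cdots E_{2N}$ be finite-dimensional quantum systems, where $S$ consists of $n$ qubits and each $S_i$ of $\xi=\frac n{2N}$ qubits. Let $\rho_{SR}=\bigotimes_{i=1}^{2N}\rho_{S_iR_i}$ be a tensor product of quantum states with reduced state $\rho_R$, and let $\mathcal T_{S\to E}=\bigotimes_{i=1}^{2N}\mathcal T_{S_i\to E_i}$ be a tensor product of completely positive maps whose Choi–Jamiołkowski representations $\tau_{S_iE_i}$ are (normalized) quantum states; let $\tau_{SE}=\bigotimes_i\tau_{S_iE_i}$ with reduced state $\tau_E$. Let $U_S$ be drawn from the double-layer blocked Clifford ensemble $\mathfrak C_n^\varepsilon$ with regions $S_1,\dots,S_{2N}$. Then for any $0<\delta<1$, $$\mathbb E_{U\sim\mathfrak C_n^\varepsilon}\big\Vert\mathcal T_{S\to E}(U_S\rho_{SR}U_S^\dagger)-\tau_E\otimes\rho_R\big\Vert_1\le16N\delta+\sqrt{2^{-\sum_{i=1}^{2N}H_2^\delta(S_i|E_i)_{\tau_{S_iE_i}}-\sum_{i=1}^{2N}H_2^\delta(S_i|R_i)_{\rho_{S_iR_i}}}+c'\prod_{i=1}^{2N}\max\big(1,2^{-H_2^\delta(S_i|E_i)_{\tau_{S_iE_i}}-H_2^\delta(S_i|R_i)_{\rho_{S_iR_i}}}\big)},$$ where $$c'=2\left(\Big(1+\tfrac{2^{\xi+1}}{2^{2\xi}+1}\max_i\max\big(2^{-H_2^\delta(S_i|R_i)_{\rho_{S_iR_i}}},2^{H_2^\delta(S_i|R_i)_{\rho_{S_iR_i}}}\big)\Big)^{N-1}-1\right).$$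 Moreover, smoothing only the entropies $H_2(S_i|E_i)$, $$\mathbb E_{U\sim\mathfrak C_n^\varepsilon}\big\Vert\mathcal T_{S\to E}(U_S\rho_{SR}U_S^\dagger)-\tau_E\otimes\rho_R\big\Vert_1\le8N\delta+\sqrt{2^{-\sum_{i=1}^{2N}H_2^\delta(S_i|E_i)_{\tau_{S_iE_i}}-\sum_{i=1}^{2N}H_2(S_i|R_i)_{\rho_{S_iR_i}}}+c\prod_{i=1}^{2N}\max\big(1,2^{-H_2^\delta(S_i|E_i)_{\tau_{S_iE_i}}-H_2(S_i|R_i)_{\rho_{S_iR_i}}}\big)},$$ where $$c=2\left(\Big(1+\tfrac{2^{\xi+1}}{2^{2\xi}+1}\max_i\max\big(2^{-H_2(S_i|R_i)_{\rho_{S_iR_i}}},2^{H_2(S_i|R_i)_{\rho_{S_iR_i}}}\big)\Big)^{N-1}-1\right).$$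
   Context: All logarithms are base 2. $\Vert\cdot\Vert_1$ is the trace norm. $U_S$ and $\mathcal T_{S\to E}$ act as the identity on $R$. Choi–Jamiołkowski representation of $\mathcal T_{A\to B}$: $\tau_{AB}=\mathcal T_{A'\to B}(|\hat\phi\rangle\langle\hat\phi|_{AA'})$, with $A'$ a copy of $A$ and $|\hat\phi\rangle_{AA'}=|A|^{-1/2}\sum_i|i\rangle|i\rangle$. Conditional collision entropy: $H_2(A|B)_\rho=-\log\mathrm{tr}\big[\big((\mathbb I_A\otimes\rho_B)^{-1/4}\rho_{AB}(\mathbb I_A\otimes\rho_B)^{-1/4}\big)^2\big]$ (inverses on the support). Smoothed version: $H_2^\delta(A|B)_\rho=\sup_{\hat\rho_{AB}\in\mathcal B^\delta(\rho_{AB})}H_2(A|B)_{\hat\rho}$, where $\mathcal B^\delta(\rho)$ is the set of quantum states $\rho'$ with purified distance $P(\rho',\rho)\le\delta$, $P(\rho,\sigma)=\sqrt{1-F(\rho,\sigma)^2}$, $F(\rho,\sigma)=\Vert\sqrt\rho\sqrt\sigma\Vert_1$. Double-layer blocked ensemble $\mathfrak C_n^\varepsilon$: $n$ qubits on a line are divided into $2N$ consecutive regions of $\xi=n/2N$ qubits each, where $\xi=\log(n/\varepsilon)$ (with $\varepsilon>0$ such that $\xi,N$ are positive integers). A random element is $U=U_2U_1$ with $U_1=\bigotimes_{i=1}^{N}U_C^{2i-1,2i}$ and $U_2=\bigotimes_{i=1}^{N-1}U_C^{2i,2i+1}$, where each $U_C^{j,j+1}$ is an independent uniformly random element of the Clifford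 group on the $2\xi$ qubits of regions $j$ and $j+1$. *)

(* Defs.v *)
From mathcomp Require Import all_boot all_order all_algebra.
From mathcomp Require Import complex spectral.
From mathcomp Require Import all_classical all_reals all_analysis.
From mathcomp Require Import finmap.

Set Implicit Arguments.
Unset Strict Implicit.
Unset Printing Implicit Defensive.

Import Order.TTheory GRing.Theory Num.Theory.
Local Open Scope ring_scope.
Local Open Scope sesquilinear_scope.
Local Open Scope classical_set_scope.

(* A finite-dimensional system is given by a finite type [I] labelling an
   orthonormal basis; its operators are square matrices of size [#|I|], whose
   coordinates are identified with the labels by [enum_rank]/[enum_val]. A
   composite system has the product of the label types as its labels. *)
Notation op R I := 'M[R[i]]_#|I%type : finType|.

Definition entry (R : realType) (I : finType) (A : op R I) (x y : I) : R[i] :=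
  A (enum_rank x) (enum_rank y).

Definition mkop (R : realType) (I : finType) (F : I -> I -> R[i]) : op R I :=
  \matrix_(a, b) F (enum_val a) (enum_val b).

Definition psd (R : realType) (n : nat) (A : 'M[R[i]]_n) : Prop :=
  forall v : 'cV[R[i]]_n, 0 <= (v^t* *m A *m v) 0 0.

Definition state (R : realType) (I : finType) (A : op R I) : Prop :=
  psd A /\ \tr A = 1.

Definition conjop (R : realType) (n : nat) (U A : 'M[R[i]]_n) : 'M[R[i]]_n :=
  U *m A *m U^t*.

(* Functional calculus; meaningful for normal [A], where [spectralmx A] is
   unitary and diagonalizes [A]. *)
Definition mxfun (R : realType) (n : nat) (f : R[i] -> R[i])
    (A : 'M[R[i]]_n) : 'M[R[i]]_n :=
  invmx (spectralmx A) *m diag_mx (map_mx f (spectral_diag A)) *m spectralmx A.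

Definition mxsqrt (R : realType) (n : nat) (A : 'M[R[i]]_n) : 'M[R[i]]_n :=
  mxfun (fun z => sqrtC z) A.

(* [A^(-1/4)] for a positive semidefinite [A]; since [0^-1 = 0], the inverse is
   taken on the support of [A]. *)
Definition mxrootV4 (R : realType) (n : nat) (A : 'M[R[i]]_n) : 'M[R[i]]_n :=
  mxfun (fun z => (4.-root z)^-1) A.

Definition trace_norm (R : realType) (n : nat) (A : 'M[R[i]]_n) : R :=
  complex.Re (\tr (mxsqrt (A^t* *m A))).

Definition fidelity (R : realType) (n : nat) (A B : 'M[R[i]]_n) : R :=
  trace_norm (mxsqrt A *m mxsqrt B).

Definition purified_distance (R : realType) (n : nat) (A B : 'M[R[i]]_n) : R :=
  Num.sqrt (1 - fidelity A B ^+ 2).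

Definition otens (R : realType) (I J : finType) (A : op R I) (B : op R J) :
    op R (I * J) :=
  mkop (fun x y => entry A x.1 y.1 * entry B x.2 y.2).

Definition ptrace_fst (R : realType) (I J : finType) (X : op R (I * J)) :
    op R J :=
  mkop (fun b b' => \sum_a entry X (a, b) (a, b')).

(* [map_fst f] is [f] tensored with the identity on [K], for linear [f]. *)
Definition map_fst (R : realType) (I J K : finType) (f : op R I -> op R J)
    (X : op R (I * K)) : op R (J * K) :=
  mkop (fun x y =>
    entry (f (mkop (fun a a' => entry X (a, x.2) (a', y.2)))) x.1 y.1).

Definition map_snd (R : realType) (I J K : finType) (f : op R I -> op R J)
    (X : op R (K * I)) : op R (K * J) :=
  mkop (fun x y =>
    entry (f (mkop (fun a a' => entry X (x.1, a) (y.1, a')))) x.2 y.2).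

Definition completely_positive (R : realType) (I J : finType)
    (f : {linear op R I -> op R J}) : Prop :=
  forall (k : nat) (X : op R (I * 'I_k)), psd X -> psd (map_fst f X).

Definition max_entangled (R : realType) (I : finType) :
    'cV[R[i]]_#|(I * I)%type : finType| :=
  \col_a ((sqrtC #|I|%:R)^-1 * ((enum_val a).1 == (enum_val a).2)%:R).

Definition choi (R : realType) (I J : finType) (f : op R I -> op R J) :
    op R (I * J) :=
  map_snd f (max_entangled R I *m (max_entangled R I)^t*).

(* The product of the bipartite [X i] on [A i], [B i], with the factors
   regrouped so that all the [A i] come first. *)
Definition tens_bip (R : realType) (L : finType) (A B : L -> finType)
    (X : forall i, op R (A i * B i)) :
    op R ({dffun forall i, A i} * {dffun forall i, B i}) :=
  mkop (fun x y : {dffun forall i, A i} * {dffun forall i, B i} =>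
    \prod_i entry (X i) (x.1 i, x.2 i) (y.1 i, y.2 i)).

(* The linear map sending each product of matrix units [|a i><a' i|] to the
   product of their images under the [f i]. *)
Definition tens_map (R : realType) (L : finType) (A B : L -> finType)
    (f : forall i, {linear op R (A i) -> op R (B i)})
    (X : op R {dffun forall i, A i}) : op R {dffun forall i, B i} :=
  mkop (fun b b' : {dffun forall i, B i} =>
    \sum_(a : {dffun forall i, A i}) \sum_(a' : {dffun forall i, A i})
      entry X a a' *
    \prod_i entry (f i (delta_mx (enum_rank (a i)) (enum_rank (a' i))))
                  (b i) (b' i)).

Definition log2 (R : realType) (x : R) : R := ln x / ln 2.

(* [B] is conditioned upon. *)
Definition H2 (R : realType) (A B : finType) (rho : op R (A * B)) : R :=
  let S := mxrootV4 (otens (1%:M : op R A) (ptrace_fst rho)) in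
  - log2 (complex.Re (\tr (S *m rho *m S *m (S *m rho *m S)))).

Definition state_ball (R : realType) (I : finType) (d : R) (rho : op R I) :
    set (op R I) :=
  [set s | state s /\ purified_distance s rho <= d].

(* On states [H2] takes values between [- log2 #|A|] and [log2 #|A|], so this is
   the supremum of a bounded set. *)
Definition H2_smooth (R : realType) (A B : finType) (d : R)
    (rho : op R (A * B)) : R :=
  sup [set H2 s | s in state_ball d rho].

Definition pauli1 (R : realType) (p : bool * bool) : op R bool :=
  match p with
  | (false, false) => 1%:M
  | (false, true) => mkop (fun x y : bool => (x == y)%:R * (-1) ^+ x)
  | (true, false) => mkop (fun x y : bool => (x != y)%:R)
  | (true, true) =>
      mkop (fun x y : bool => (x != y)%:R * (if x then 'i else - 'i))
  end.

Definition pauli_string (R : realType) (J : finType) (p : J -> bool * bool) :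
    op R {ffun J -> bool} :=
  mkop (fun x y : {ffun J -> bool} =>
    \prod_j entry (pauli1 R (p j)) (x j) (y j)).

Definition pauli_group (R : realType) (J : finType) :
    set (op R {ffun J -> bool}) :=
  [set P | exists (k : nat) (p : J -> bool * bool),
     P = 'i ^+ k *: pauli_string R p].

Definition clifford (R : realType) (J : finType) :
    set (op R {ffun J -> bool}) :=
  [set U | U \is unitarymx /\
     forall P, pauli_group P -> pauli_group (conjop U P)].

(* Global phases make [clifford] infinite. Every class of Clifford unitaries
   modulo phases contains exactly [2 ^ #|J|] elements of determinant 1, so the
   uniform distribution on the finite group [sclifford] induces the uniform one
   on the Clifford group modulo phases. *)
Definition sclifford (R : realType) (J : finType) :
    set (op R {ffun J -> bool}) :=
  [set U | clifford U /\ \det U = 1].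

(* Mean over the uniform distribution on a finite nonempty set. *)
Definition unif_mean (R : realType) (T : choiceType) (A : set T) (f : T -> R) :
    R :=
  (\sum_(x \in A) f x) / #|` fset_set A|%:R.

Definition region (xi : nat) : finType := {ffun 'I_xi -> bool}.

(* [2 * N] regions of [xi] qubits on a line. *)
Definition line (N xi : nat) : finType :=
  {dffun forall _ : 'I_(2 * N), region xi}.

Definition join (xi : nat) (s t : region xi) : {ffun 'I_xi + 'I_xi -> bool} :=
  [ffun k => match k with inl a => s a | inr b => t b end].

Definition lreg (n : nat) (j : 'I_n.-1) : 'I_n := widen_ord (leq_pred n) j.

Definition rreg (n : nat) (j : 'I_n.-1) : 'I_n :=
  Ordinal (etrans (esym (ltn_predRL j n)) (ltn_ord j)).

(* A gate on regions [j], [j + 1] for each [j]. *)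
Notation gates R N xi :=
  {ffun 'I_(2 * N).-1 -> op R {ffun 'I_xi + 'I_xi -> bool}}.

(* The tensor product of the gates [u j] with [j] in [J], and of the identity on
   the regions which they leave out; the pairs [j], [j + 1] for [j] in [J] are
   meant to be disjoint. *)
Definition layer (R : realType) (N xi : nat) (J : pred 'I_(2 * N).-1)
    (u : gates R N xi) : op R (line N xi) :=
  mkop (fun s s' : line N xi =>
    \prod_(j | J j) entry (u j) (join (s (lreg j)) (s (rreg j)))
                                (join (s' (lreg j)) (s' (rreg j))) *
    \prod_(i | [forall j, J j ==> (i != lreg j) && (i != rreg j)])
      (s i == s' i)%:R).

(* Regions are numbered from 0, so the first layer has the even [j]. *)
Definition circuit (R : realType) (N xi : nat) (u : gates R N xi) :
    op R (line N xi) :=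
  layer (fun j => odd j) u *m layer (fun j => ~~ odd j) u.

(* The uniform distribution on this set makes the gates independent and
   uniform. *)
Definition clifford_gates (R : realType) (N xi : nat) : set (gates R N xi) :=
  [set u | forall j, sclifford (u j)].

(* The mean of [f U] over the circuits [U] of the ensemble. *)
Definition ensemble_mean (R : realType) (N xi : nat)
    (f : op R (line N xi) -> R) : R :=
  unif_mean (@clifford_gates R N xi) (fun u => f (circuit u)).

Definition decoupling_error (R : realType) (N xi : nat)
    (Rf E : 'I_(2 * N) -> finType)
    (rho : forall i, op R (region xi * Rf i))
    (T : forall i, {linear op R (region xi) -> op R (E i)})
    (U : op R (line N xi)) : R :=
  let rhoSR := tens_bip rho in
  let tauSE := tens_bip (fun i => choi (T i)) in
  trace_norm
    (map_fst (tens_map T)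
       (conjop (otens U (1%:M : op R {dffun forall i, Rf i})) rhoSR)
     - otens (ptrace_fst tauSE) (ptrace_fst rhoSR)).

(* The constant [c], as a function of the entropies [h i] of [S_i] given
   [R_i]; the terms of the maximum are positive. *)
Definition decoupling_cst (R : realType) (N xi : nat)
    (h : 'I_(2 * N) -> R) : R :=
  2 * ((1 + 2 ^+ xi.+1 / (2 ^+ (2 * xi) + 1) *
        \big[Num.max/0]_i Num.max (2 `^ (- h i)) (2 `^ h i)) ^+ N.-1 - 1).

(* The square root in the bounds, where [g i] and [h i] are the entropies of
   [S_i] given [E_i] and [R_i]. *)
Definition entropy_bound (R : realType) (N xi : nat)
    (g h : 'I_(2 * N) -> R) : R :=
  Num.sqrt (2 `^ (- (\sum_i g i) - \sum_i h i) +
            decoupling_cst xi h * \prod_i Num.max 1 (2 `^ (- g i - h i))).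

(* Main.v *)
(* By polar decomposition the trace norm of the decoupling error is
   [Re tr (W D)] for a contraction [W]. This expression is multilinear in
   the factors of the Choi state and of the input state, so replacing them one
   at a time by states in the smoothing balls costs, by the Fuchs-van de Graaf
   inequality, a multiple of [delta] for each. For the new
   states, the Cauchy-Schwarz inequality weighted by the fourth roots of the
   marginals reduces the claim to the mean of a Hilbert-Schmidt norm. Expanded
   in Pauli strings, this mean is governed by the Markov kernel which the random
   Cliffords induce on Pauli labels: a Clifford fixes the identity string and
   sends any other string to a uniform non-identity one. It remains to bound a
   sum over the patterns of blocks carrying the identity, which is a transfer
   product along the line; the patterns are controlled by the walls between
   identity and non-identity gates of the first layer, and each wall costs a
   factor [2^(xi+1) / (2^(2 xi) + 1)] times the maximum in the constant. *)
Require Import Defs.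
From mathcomp Require Import all_boot all_order all_algebra.
From mathcomp Require Import complex spectral.
From mathcomp Require Import all_classical all_reals all_analysis.
From mathcomp Require Import finmap ring lra zify.
Set Implicit Arguments.
Unset Strict Implicit.
Unset Printing Implicit Defensive.
Import Order.TTheory GRing.Theory Num.Theory.
Local Open Scope ring_scope.
Local Open Scope sesquilinear_scope.

(** * Positive operators and the trace norm *)

(** The maps [T i] are only completely positive with normalized Choi states, so for an individual
    circuit the output need not have trace 1. What survives is that the mean trace is the product of
    the traces, because every non-identity Pauli term averages to zero. This is why the replacement
    of states is carried out on the mean of [Re tr (W D)], with the contractions [W] frozen, and not
    circuit by circuit. A difference of two close states is a difference of positive operators of
    total trace at most [2 * delta]; each of the [2 * N] factors is replaced in two terms, the
    output and the product of marginals, which gives [8 * N * delta] per smoothed family. The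
    suprema in the smooth entropies are only approached, so a limit closes the argument. Finiteness
    of the gate set is treated by cases: a mean over an infinite set is 0 by convention, and the
    bound is then trivial. *)

Section Adjoint.
Variable C : numClosedFieldType.

Lemma adjE m n (A : 'M[C]_(m, n)) i j : (A^t*) i j = (A j i)^*.
Proof. by rewrite !mxE. Qed.

Lemma adjM m n p (A : 'M[C]_(m, n)) (B : 'M[C]_(n, p)) :
  (A *m B)^t* = B^t* *m A^t*.
Proof. by rewrite trmx_mul map_mxM. Qed.

Lemma adjK m n (A : 'M[C]_(m, n)) : A^t*^t* = A.
Proof. exact: trmxCK. Qed.

Lemma adjD m n (A B : 'M[C]_(m, n)) : (A + B)^t* = A^t* + B^t*.
Proof. by apply/matrixP => i j; rewrite !mxE rmorphD. Qed.

Lemma adjN m n (A : 'M[C]_(m, n)) : (- A)^t* = - A^t*.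
Proof. by apply/matrixP => i j; rewrite !mxE rmorphN. Qed.

Lemma adjB m n (A B : 'M[C]_(m, n)) : (A - B)^t* = A^t* - B^t*.
Proof. by rewrite adjD adjN. Qed.

Lemma adjZ m n a (A : 'M[C]_(m, n)) : (a *: A)^t* = a^* *: A^t*.
Proof. by apply/matrixP => i j; rewrite !mxE rmorphM. Qed.

Lemma adj1 n : (1%:M : 'M[C]_n)^t* = 1%:M.
Proof. by rewrite trmx1 map_mx1. Qed.

Lemma tr_adj n (A : 'M[C]_n) : \tr (A^t*) = (\tr A)^*.
Proof. by rewrite /mxtrace rmorph_sum; apply: eq_bigr => i _; rewrite adjE. Qed.

End Adjoint.

Section Frobenius.
Variable R : realType.
Local Notation C := R[i].

Lemma conjE (z : C) : (z^*)%R = conjc z. Proof. by []. Qed.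

Lemma ReD (x y : C) : complex.Re (x + y) = complex.Re x + complex.Re y.
Proof. by case: x; case: y. Qed.

Lemma ReN (x : C) : complex.Re (- x) = - complex.Re x.
Proof. by case: x. Qed.

Lemma ReB (x y : C) : complex.Re (x - y) = complex.Re x - complex.Re y.
Proof. by rewrite ReD ReN. Qed.

Lemma Re_sum (I : Type) (r : seq I) (P : pred I) (F : I -> C) :
  complex.Re (\sum_(i <- r | P i) F i) = \sum_(i <- r | P i) complex.Re (F i).
Proof. exact: (big_morph _ ReD). Qed.

Lemma Im_sum (I : Type) (r : seq I) (P : pred I) (F : I -> C) :
  complex.Im (\sum_(i <- r | P i) F i) = \sum_(i <- r | P i) complex.Im (F i).
Proof. by apply: (big_morph (fun z : C => complex.Im z)) => // -[a b] [c d]. Qed.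

Lemma ge0_ReE (x : C) : 0 <= x -> x = (complex.Re x)%:C%C.
Proof. by move=> /ger0_Im; case: x => a b /= ->. Qed.

Lemma real_complexM (x y : R) : (x * y)%:C%C = x%:C%C * y%:C%C :> C.
Proof. exact: rmorphM. Qed.

Lemma ReZ (x : R) (y : C) : complex.Re (x%:C%C * y) = x * complex.Re y.
Proof. by case: y => a b /=; rewrite mul0r subr0. Qed.

Lemma complexRe_conj (x : C) : complex.Re (x^*)%R = complex.Re x.
Proof. by rewrite conjE; case: x. Qed.

Definition sqn (z : C) : R := complex.Re z ^+ 2 + complex.Im z ^+ 2.

Lemma sqn_ge0 z : 0 <= sqn z.
Proof. by rewrite addr_ge0 ?sqr_ge0. Qed.

Lemma sqnE z : (sqn z)%:C%C = z * z^*.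
Proof.
rewrite conjE; case: z => a b; rewrite /sqn /=.
apply/eqP; rewrite eq_complex /=; apply/andP; split; apply/eqP; ring.
Qed.

Lemma sqnM x y : sqn (x * y) = sqn x * sqn y.
Proof. by case: x; case: y => a b c d; rewrite /sqn /=; ring. Qed.

Lemma sqn1 : sqn 1 = 1. Proof. by rewrite /sqn /= expr0n expr1n addr0. Qed.

Lemma sqn_eq0 z : sqn z = 0 -> z = 0.
Proof.
rewrite /sqn; case: z => a b /= /eqP; rewrite paddr_eq0 ?sqr_ge0 //.
by rewrite !sqrf_eq0 => /andP[/eqP-> /eqP->].
Qed.

Lemma sqn_prod (I : Type) (r : seq I) (P : pred I) (F : I -> C) :
  sqn (\prod_(i <- r | P i) F i) = \prod_(i <- r | P i) sqn (F i).
Proof. exact: (big_morph sqn sqnM sqn1). Qed.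

(** Lagrange's identity: twice the gap is the sum of all [(f i * g j - f j * g i) ^+ 2]. *)
Lemma sum_CS (I : finType) (f g : I -> R) :
  (\sum_i f i * g i) ^+ 2 <= (\sum_i f i ^+ 2) * (\sum_i g i ^+ 2).
Proof.
rewrite -subr_ge0.
suff: 0 <= 2 * ((\sum_i f i ^+ 2) * (\sum_i g i ^+ 2) - (\sum_i f i * g i) ^+ 2).
  by rewrite pmulr_rge0.
have -> : 2 * ((\sum_i f i ^+ 2) * (\sum_i g i ^+ 2) - (\sum_i f i * g i) ^+ 2)
    = \sum_i \sum_j (f i * g j - f j * g i) ^+ 2.
  set a := \sum_i f i ^+ 2; set b := \sum_i g i ^+ 2; set s := \sum_i f i * g i.
  have -> : 2 * (a * b - s ^+ 2) = a * b + b * a - 2 * (s * s) by ring.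
  rewrite !big_distrlr /= mulr_sumr -sumrN -!big_split /=.
  apply: eq_bigr => i _; rewrite mulr_sumr -sumrN -!big_split /=.
  by apply: eq_bigr => j _; ring.
by apply: sumr_ge0 => i _; apply: sumr_ge0 => j _; apply: sqr_ge0.
Qed.

Lemma sqr_sum_le (I : finType) (g : I -> R) :
  (\sum_i g i) ^+ 2 <= #|I|%:R * \sum_i g i ^+ 2.
Proof.
have := sum_CS (fun=> 1) g; rewrite expr1n sumr_const.
by under eq_bigr do rewrite mul1r.
Qed.

Lemma sqn_sum_le (I : finType) (f : I -> C) :
  sqn (\sum_i f i) <= #|I|%:R * \sum_i sqn (f i).
Proof.
by rewrite /sqn Re_sum Im_sum big_split mulrDr lerD ?sqr_sum_le.
Qed.

Definition fro (m n : nat) (A : 'M[C]_(m, n)) : R := \sum_i \sum_j sqn (A i j).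

Lemma fro_ge0 m n (A : 'M[C]_(m, n)) : 0 <= fro A.
Proof. by apply: sumr_ge0 => i _; apply: sumr_ge0 => j _; apply: sqn_ge0. Qed.

Lemma froE m n (A : 'M[C]_(m, n)) : (fro A)%:C%C = \tr (A *m A^t*).
Proof.
rewrite /fro /mxtrace rmorph_sum; apply: eq_bigr => i _.
by rewrite mxE rmorph_sum; apply: eq_bigr => j _; rewrite adjE -sqnE.
Qed.

Lemma fro_trE m n (A : 'M[C]_(m, n)) : fro A = complex.Re (\tr (A *m A^t*)).
Proof. by rewrite -froE. Qed.

Lemma fro_adj m n (A : 'M[C]_(m, n)) : fro (A^t*) = fro A.
Proof. by rewrite !fro_trE adjK mxtrace_mulC. Qed.

Lemma fro_eq0 m n (A : 'M[C]_(m, n)) : fro A = 0 -> A = 0.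
Proof.
move=> /eqP; rewrite psumr_eq0 => [/allP A0|i _]; last first.
  by apply: sumr_ge0 => j _; apply: sqn_ge0.
apply/matrixP => i j; have /implyP/(_ isT) := A0 i (mem_index_enum _).
rewrite psumr_eq0 => [/allP/(_ j (mem_index_enum _))/implyP/(_ isT)/eqP|k _].
  by move/sqn_eq0; rewrite mxE.
exact: sqn_ge0.
Qed.

(** The real Cauchy-Schwarz inequality: real and imaginary parts become separate coordinates,
    indexed by the boolean, and the sign in [g] is that of the real part of a product. *)
Lemma tr_CS m n (A : 'M[C]_(m, n)) (B : 'M[C]_(n, m)) :
  complex.Re (\tr (A *m B)) ^+ 2 <= fro A * fro B.
Proof.
pose f (p : ('I_m * 'I_n) * bool) :=
  if p.2 then complex.Re (A p.1.1 p.1.2) else complex.Im (A p.1.1 p.1.2).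
pose g (p : ('I_m * 'I_n) * bool) :=
  if p.2 then complex.Re (B p.1.2 p.1.1) else - complex.Im (B p.1.2 p.1.1).
have S (h : ('I_m * 'I_n) * bool -> R) :
    \sum_p h p = \sum_i \sum_j (h ((i, j), true) + h ((i, j), false)).
  rewrite pair_big (eq_bigr (fun p => \sum_b h (p, b))) => [|[i j] _]; last first.
    by rewrite big_bool.
  by rewrite pair_big; apply: eq_bigr => -[].
have -> : complex.Re (\tr (A *m B)) = \sum_p f p * g p.
  rewrite S /mxtrace Re_sum; apply: eq_bigr => i _.
  rewrite mxE Re_sum; apply: eq_bigr => j _; rewrite /f /g /=.
  by case: (A i j) (B j i) => [a b] [c d] /=; rewrite mulrN.
have -> : fro A = \sum_p f p ^+ 2.
  by rewrite S; apply: eq_bigr => i _; apply: eq_bigr => j _.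
have -> : fro B = \sum_p g p ^+ 2.
  rewrite S /fro exchange_big; apply: eq_bigr => i _; apply: eq_bigr => j _.
  by rewrite /sqn /g /= sqrrN.
exact: sum_CS.
Qed.

Lemma tr_le_fro m n (A : 'M[C]_(m, n)) (B : 'M[C]_(n, m)) :
  complex.Re (\tr (A *m B)) <= Num.sqrt (fro A) * Num.sqrt (fro B).
Proof.
rewrite -sqrtrM ?fro_ge0 // (le_trans (ler_norm _)) // -sqrtr_sqr.
by rewrite ler_wsqrtr // tr_CS.
Qed.

Lemma froD m n (A B : 'M[C]_(m, n)) :
  fro (A + B) = fro A + fro B + 2 * complex.Re (\tr (A *m B^t*)).
Proof.
rewrite !fro_trE adjD mulmxDl !mulmxDr !mxtraceD !ReD.
have -> : \tr (B *m A^t*) = (\tr (A *m B^t*))^* by rewrite -tr_adj adjM adjK.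
rewrite complexRe_conj mulr2n mulrDl !mul1r; lra.
Qed.

Lemma froN m n (A : 'M[C]_(m, n)) : fro (- A) = fro A.
Proof. by rewrite !fro_trE adjN mulNmx mulmxN opprK. Qed.

(** Stands for operator norm at most 1, in the form in which it is applied. Both sides occur in the
    weighted Cauchy-Schwarz inequality. *)
Definition contraction (n : nat) (W : 'M[C]_n) : Prop :=
  (forall m (B : 'M[C]_(n, m)), fro (W *m B) <= fro B) /\
  (forall m (B : 'M[C]_(m, n)), fro (B *m W) <= fro B).

(** Pythagoras: [B *m P] and [B *m (1%:M - P)] are orthogonal. *)
Lemma proj_fro_le m n (P : 'M[C]_n) (B : 'M[C]_(m, n)) :
  P^t* = P -> P *m P = P -> fro (B *m P) <= fro B.
Proof.
move=> Ph Pp.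
have -> : fro B = fro (B *m P) + fro (B *m (1%:M - P)).
  have {1}-> : B = B *m P + B *m (1%:M - P) by rewrite -mulmxDr addrC subrK mulmx1.
  rewrite froD [X in _ + 2 * complex.Re (\tr X)](_ : _ = 0).
    by rewrite mxtrace0 /= mulr0 addr0.
  rewrite adjM adjB adj1 Ph mulmxA -(mulmxA B) mulmxBr mulmx1 Pp subrr.
  by rewrite mulmx0 mul0mx.
by rewrite lerDl fro_ge0.
Qed.

(** The hypotheses say that [W] is a partial isometry, and [B *m W] has the same norm as [B] times
    the range projection [W *m W^t*]. *)
Lemma proj_contraction n (W : 'M[C]_n) :
  (W *m W^t*) *m (W *m W^t*) = W *m W^t* ->
  (W^t* *m W) *m (W^t* *m W) = W^t* *m W -> contraction W.
Proof.
have H (V : 'M[C]_n) m (B : 'M[C]_(m, n)) :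
    (V *m V^t*) *m (V *m V^t*) = V *m V^t* -> fro (B *m V) <= fro B.
  move=> hV; have -> : fro (B *m V) = fro (B *m (V *m V^t*)).
    rewrite !fro_trE !adjM !adjK; congr (complex.Re (\tr _)).
    by rewrite -(mulmxA B (V *m _)) (mulmxA (V *m _)) hV !mulmxA.
  by apply: proj_fro_le; rewrite ?adjM ?adjK.
move=> h1 h2; split=> m B; last exact: H.
by rewrite -fro_adj adjM -(fro_adj B); apply: H; rewrite adjK.
Qed.

End Frobenius.

Section FunctionalCalculus.
Variable C : numClosedFieldType.

(** The diagonalizing unitary is an argument: [spectralmx] fixes one eigenbasis, whereas tensor
    products and products of functions come with their own. *)
Definition fcalc n (U : 'M[C]_n) (f : 'I_n -> C) : 'M[C]_n :=
  U^t* *m diag_mx (\row_k f k) *m U.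

Section Unitary.
Variables (n : nat) (U : 'M[C]_n).
Hypothesis Uu : U \is unitarymx.

Lemma unitaryMV : U *m U^t* = 1%:M. Proof. exact/unitarymxP. Qed.

Lemma unitaryVM : U^t* *m U = 1%:M. Proof. exact: mulmx1C unitaryMV. Qed.

Lemma fcalcM f g : fcalc U f *m fcalc U g = fcalc U (fun k => f k * g k).
Proof.
rewrite /fcalc !mulmxA -(mulmxA (U^t* *m diag_mx _) U (U^t*)) unitaryMV mulmx1.
rewrite -(mulmxA (U^t*) (diag_mx _) (diag_mx _)) mulmx_diag; congr (_ *m diag_mx _ *m _).
by apply/rowP => k; rewrite !mxE.
Qed.

Lemma adj_fcalc f : (fcalc U f)^t* = fcalc U (fun k => (f k)^*).
Proof.
rewrite /fcalc adjM adjM adjK mulmxA tr_diag_mx map_diag_mx.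
by congr (_ *m diag_mx _ *m _); apply/rowP => k; rewrite !mxE.
Qed.

Lemma tr_fcalc f : \tr (fcalc U f) = \sum_k f k.
Proof.
rewrite /fcalc -mulmxA mxtrace_mulC -mulmxA unitaryMV mulmx1 mxtrace_diag.
by apply: eq_bigr => k _; rewrite mxE.
Qed.

Lemma fcalc_const c : fcalc U (fun=> c) = c%:M.
Proof.
rewrite /fcalc (_ : \row_k c = const_mx c); last by apply/rowP => k; rewrite !mxE.
by rewrite diag_const_mx mul_mx_scalar -scalemxAl unitaryVM scalemx1.
Qed.

Lemma fcalcV f k : (U *m fcalc U f *m U^t*) k k = f k.
Proof.
rewrite /fcalc !mulmxA unitaryMV mul1mx -mulmxA unitaryMV mulmx1.
by rewrite !mxE eqxx mulr1n.
Qed.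

Lemma fcalc_spec f k l (V : 'M[C]_n) g : V \is unitarymx ->
  fcalc U f = fcalc V g -> (V *m U^t*) k l * f l = g k * (V *m U^t*) k l.
Proof.
move=> Vu e; have VV : V *m V^t* = 1%:M by apply/unitarymxP.
have := congr1 (fun X => V *m X *m U^t*) e; rewrite /fcalc !mulmxA VV mul1mx.
rewrite -[_ *m U *m U^t*]mulmxA unitaryMV mulmx1 => /matrixP/(_ k l).
by rewrite mul_mx_diag -[_ *m V *m _]mulmxA mul_diag_mx !mxE.
Qed.

End Unitary.

(** The change of basis [V *m U^t*] intertwines the two diagonals, so its entries can be nonzero
    only where the eigenvalues agree, and there their images under [h] agree too. *)
Lemma fcalc_eq n (U V : 'M[C]_n) f g (h : C -> C) :
  U \is unitarymx -> V \is unitarymx -> fcalc U f = fcalc V g ->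
  fcalc U (h \o f) = fcalc V (h \o g).
Proof.
move=> Uu Vu e; have UU := unitaryVM Uu; have VV := unitaryVM Vu.
have E : (V *m U^t*) *m diag_mx (\row_k (h \o f) k) =
         diag_mx (\row_k (h \o g) k) *m (V *m U^t*).
  apply/matrixP => k l; rewrite mul_mx_diag mul_diag_mx.
  have := fcalc_spec Uu k l Vu e; move: (V *m U^t*) => W; rewrite !mxE /=.
  have [-> _|nz] := eqVneq (W k l) 0; first by rewrite mulr0 mul0r.
  by rewrite mulrC => /(mulIf nz) ->; rewrite mulrC.
rewrite /fcalc -[LHS]mul1mx -VV -!mulmxA (mulmxA V) (mulmxA (V *m U^t*)) E.
by rewrite -!mulmxA UU mulmx1.
Qed.

(** Since [0^-1 = 0], [g *m s] is the projection onto the support, not the identity. *)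
Lemma fcalc_root4 n (U : 'M[C]_n) f (g := fcalc U (fun k => 4.-root (f k)))
    (s := fcalc U (fun k => (4.-root (f k))^-1)) :
  U \is unitarymx -> (forall k, 0 <= f k) ->
  [/\ s^t* = s, g^t* = g, g *m g *m g *m g = fcalc U f, g *m s = s *m g &
      (g *m s) *m g = g].
Proof.
move=> Uu f0; have r k : 4.-root (f k) \is Num.real.
  by rewrite ger0_real // rootC_ge0.
split.
- rewrite /s adj_fcalc; congr fcalc; apply/funext => k /=.
  by apply/CrealP; rewrite rpredV.
- by rewrite /g adj_fcalc; congr fcalc; apply/funext => k; apply/CrealP.
- rewrite /g !(fcalcM Uu); congr fcalc; apply/funext => k /=.
  by rewrite -[RHS](@rootCK _ 4) // !exprS expr0 mulr1 !mulrA.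
- by rewrite /g /s !(fcalcM Uu); congr fcalc; apply/funext => k /=; rewrite mulrC.
- rewrite /g /s !(fcalcM Uu); congr fcalc; apply/funext => k /=.
  have [->|nz] := eqVneq (f k) 0; first by rewrite rootC0 mulr0.
  by rewrite divff ?mul1r // rootC_eq0.
Qed.

(** [W] is [|X|^-1] times the adjoint of [X], inverted on the support; zero singular values are
    harmless because [0^-1 = 0] turns [W *m W^t*] into the support projection of [X^t* *m X]. *)
Lemma fcalc_polar n (U X : 'M[C]_n) f
    (W := fcalc U (fun k => (sqrtC (f k))^-1) *m X^t*) :
  U \is unitarymx -> (forall k, 0 <= f k) -> X^t* *m X = fcalc U f ->
  [/\ (W *m W^t*) *m (W *m W^t*) = W *m W^t*,
      (W^t* *m W) *m (W^t* *m W) = W^t* *m W & W *m X = fcalc U (sqrtC \o f)].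
Proof.
move=> Uu f0 XX; pose r k := (sqrtC (f k))^-1; pose V := fcalc U r.
have Vh : V^t* = V.
  rewrite /V adj_fcalc; congr fcalc; apply/funext => k; apply/CrealP.
  by rewrite rpredV ger0_real // sqrtC_ge0.
have rf k : r k * f k = sqrtC (f k).
  rewrite /r; have [->|nz] := eqVneq (f k) 0; first by rewrite sqrtC0 mulr0.
  by rewrite -[X in _ * X]sqrtCK expr2 mulKf // sqrtC_eq0.
have rrr k : r k * (r k * f k) * r k = r k.
  rewrite rf /r; have [->|nz] := eqVneq (f k) 0; first by rewrite sqrtC0 invr0 mulr0.
  by rewrite mulVf ?mul1r // sqrtC_eq0.
have WE : W = V *m X^t* by [].
have WX : W *m X = fcalc U (sqrtC \o f).
  by rewrite WE -mulmxA XX /V (fcalcM Uu); congr fcalc; apply/funext => k /=.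
have Wh : W^t* = X *m V by rewrite WE adjM adjK Vh.
have WWV : (W *m W^t*) *m V = V.
  rewrite Wh mulmxA WX /V !(fcalcM Uu); congr fcalc; apply/funext => k /=.
  by rewrite -rf mulrC mulrA.
have WWW : (W *m W^t*) *m W = W by rewrite {3}WE (mulmxA (W *m W^t*)) WWV.
split=> //; first by rewrite (mulmxA _ W) WWW.
by rewrite -mulmxA (mulmxA W) WWW.
Qed.

Lemma fcalc_map n (U : 'M[C]_n) (d : 'rV_n) (h : C -> C) :
  U^t* *m diag_mx (map_mx h d) *m U = fcalc U (h \o (fun k => d 0 k)).
Proof. by congr (_ *m diag_mx _ *m _); apply/rowP => k; rewrite !mxE. Qed.

Lemma fcalc_normal n (U : 'M[C]_n) f : U \is unitarymx -> fcalc U f \is normalmx.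
Proof.
move=> Uu; apply/normalmxP; rewrite adj_fcalc // !fcalcM //; congr fcalc.
by apply/funext => k; rewrite mulrC.
Qed.

Lemma normal_fcalc n (A : 'M[C]_n) : A \is normalmx ->
  A = fcalc (spectralmx A) (fun k => spectral_diag A 0 k).
Proof.
move=> /orthomx_spectralP {1}->; rewrite /fcalc (invmx_unitary (spectral_unitarymx A)).
by congr (_ *m diag_mx _ *m _); apply/rowP => k; rewrite mxE.
Qed.

Lemma herm_spectral n (A : 'M[C]_n) : A^t* = A ->
  exists U, exists2 f, U \is unitarymx & A = fcalc U f.
Proof.
move=> Ah; exists (spectralmx A), (fun k => spectral_diag A 0 k).
  exact: spectral_unitarymx.
by apply/normal_fcalc/normalmxP; rewrite Ah.
Qed.

End FunctionalCalculus.

Section Psd.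
Variable R : realType.
Local Notation C := R[i].

Lemma psd_fcalc n (U : 'M[C]_n) f : (forall k, 0 <= f k) -> psd (fcalc U f).
Proof.
move=> f0 v; rewrite /fcalc !mulmxA -adjM -mulmxA.
set w := U *m v; rewrite -mulmxA mul_diag_mx mxE; apply: sumr_ge0 => k _.
by rewrite adjE !mxE mulrCA mulr_ge0 ?f0 // mulrC mul_conjC_ge0.
Qed.

Lemma mxfun_fcalc n (U : 'M[C]_n) f (h : C -> C) :
  U \is unitarymx -> mxfun h (fcalc U f) = fcalc U (h \o f).
Proof.
move=> Uu; set A := fcalc U f; have Su := spectral_unitarymx A.
have AE := normal_fcalc (fcalc_normal f Uu).
rewrite /mxfun (invmx_unitary Su).
rewrite (fcalc_eq h Uu Su AE).
exact: fcalc_map.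
Qed.

Lemma psd_conj m n (A : 'M[C]_n) (B : 'M[C]_(m, n)) : psd A -> psd (B *m A *m B^t*).
Proof. by move=> Ap v; have := Ap (B^t* *m v); rewrite adjM adjK !mulmxA. Qed.

Lemma psd_diag n (A : 'M[C]_n) k : psd A -> 0 <= A k k.
Proof.
move=> /(_ (delta_mx k 0)).
rewrite (_ : (delta_mx k 0)^t* = delta_mx 0 k :> 'M[C]_(1, n)).
  by rewrite -rowE -colE !mxE.
by apply/matrixP => i j; rewrite !mxE rmorph_nat andbC.
Qed.

Lemma psd_tr n (A : 'M[C]_n) : psd A -> 0 <= \tr A.
Proof. by move=> Ap; apply: sumr_ge0 => k _; apply: psd_diag. Qed.

Lemma psdMadj m n (B : 'M[C]_(m, n)) : psd (B *m B^t*).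
Proof.
move=> v; have -> : v^t* *m (B *m B^t*) *m v = (B^t* *m v)^t* *m (B^t* *m v).
  by rewrite adjM adjK !mulmxA.
by rewrite mxE sumr_ge0 // => i _; rewrite adjE mulrC mul_conjC_ge0.
Qed.

(** Nonnegativity makes the quadratic form real, so the skew part has zero diagonal in every
    orthonormal basis; in the eigenbasis of the Hermitian [B] this says that all eigenvalues of [B]
    vanish. *)
Lemma psd_herm n (A : 'M[C]_n) : psd A -> A^t* = A.
Proof.
move=> Ap; pose B := 'i *: (A^t* - A).
have Bh : B^t* = B.
  by rewrite adjZ conjCi adjB adjK scaleNr -scalerN opprB.
have [U [f Uu BE]] := herm_spectral Bh.
suff B0 : B = 0.
  apply/eqP; rewrite -subr_eq0; apply/eqP/(scalerI (neq0Ci C)).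
  by rewrite scaler0.
rewrite BE (_ : f = fun=> 0) ?fcalc_const ?raddf0 //; apply/funext => k.
rewrite -(fcalcV Uu f k) -BE /B -scalemxAr -scalemxAl mulmxBr mulmxBl.
have /psd_diag D := psd_conj U Ap; have {D}/CrealP D := ger0_real (D k).
have -> : U *m A^t* *m U^t* = (U *m A *m U^t*)^t* by rewrite !adjM adjK mulmxA.
by move: (U *m A *m U^t*) D => X D; rewrite !mxE D subrr mulr0.
Qed.

Lemma psd_spectral n (A : 'M[C]_n) : psd A ->
  exists (U : 'M[C]_n) (f : 'I_n -> C),
  [/\ U \is unitarymx, forall k, 0 <= f k & A = fcalc U f].
Proof.
move=> Ap; have [U [f Uu AE]] := herm_spectral (psd_herm Ap).
exists U, f; split=> // k; rewrite -(fcalcV Uu f k) -AE.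
exact/psd_diag/psd_conj.
Qed.

Lemma psd_factor n (A : 'M[C]_n) : psd A -> exists B : 'M[C]_n, A = B *m B^t*.
Proof.
move=> /psd_spectral[U [f [Uu f0 ->]]]; exists (fcalc U (sqrtC \o f)).
rewrite adj_fcalc (fcalcM Uu); congr fcalc; apply/funext => k /=.
by rewrite (CrealP (ger0_real _)) ?sqrtC_ge0 // -expr2 sqrtCK.
Qed.

Lemma mxsqrt_psd n (A : 'M[C]_n) : psd A ->
  [/\ psd (mxsqrt A), (mxsqrt A)^t* = mxsqrt A & mxsqrt A *m mxsqrt A = A].
Proof.
move=> /psd_spectral[U [f [Uu f0 ->]]]; rewrite /mxsqrt (mxfun_fcalc _ _ Uu).
have p : psd (fcalc U (sqrtC \o f)) by apply: psd_fcalc => k; rewrite sqrtC_ge0.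
split=> //; first exact: psd_herm.
rewrite (fcalcM Uu); congr fcalc; apply/funext => k /=.
by rewrite -expr2 sqrtCK.
Qed.

Lemma mxsqrt_sqr n (A : 'M[C]_n) : psd A -> mxsqrt (A *m A) = A.
Proof.
move=> /psd_spectral[U [f [Uu f0 ->]]]; rewrite (fcalcM Uu) /mxsqrt (mxfun_fcalc _ _ Uu).
by congr fcalc; apply/funext => k /=; rewrite -expr2 sqrCK.
Qed.

Lemma mxrootV4_psd n (A : 'M[C]_n) : psd A ->
  let s := mxrootV4 A in exists g : 'M[C]_n,
  [/\ s^t* = s, g^t* = g, g *m g *m g *m g = A, g *m s = s *m g &
      (g *m s) *m g = g].
Proof.
move=> /psd_spectral[U [f [Uu f0 ->]]]; rewrite /mxrootV4 (mxfun_fcalc _ _ Uu).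
exists (fcalc U (fun k => 4.-root (f k))); exact: fcalc_root4.
Qed.

(* [W] is the adjoint of the polar part of [X]. *)
Lemma trace_norm_polar n (X : 'M[C]_n) : exists W : 'M[C]_n,
  [/\ (W *m W^t*) *m (W *m W^t*) = W *m W^t*,
      (W^t* *m W) *m (W^t* *m W) = W^t* *m W &
      trace_norm X = complex.Re (\tr (W *m X))].
Proof.
have := psdMadj (X^t*); rewrite adjK => /psd_spectral[U [f [Uu f0 XX]]].
have [h1 h2 h3] := fcalc_polar Uu f0 XX.
exists (fcalc U (fun k => (sqrtC (f k))^-1) *m X^t*); split=> //.
by rewrite h3 /trace_norm /mxsqrt XX (mxfun_fcalc _ _ Uu).
Qed.

Lemma trace_norm_contraction n (X : 'M[C]_n) :
  exists2 W, contraction W & trace_norm X = complex.Re (\tr (W *m X)).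
Proof.
by have [W [h1 h2 h3]] := trace_norm_polar X; exists W => //; apply: proj_contraction.
Qed.

End Psd.

Section TraceIdentities.
Variable C : numClosedFieldType.

Lemma tr_sandwich n (W G X : 'M[C]_n) :
  \tr (W *m (G *m X *m G)) = \tr ((G *m W *m G) *m X).
Proof. by rewrite !mulmxA mxtrace_mulC !mulmxA. Qed.

Lemma tr_sandwich_adj n (W G : 'M[C]_n) : G^t* = G ->
  \tr ((G *m W *m G) *m (G *m W *m G)^t*) =
  \tr ((G *m G *m W) *m (W *m (G *m G))^t*).
Proof.
move=> Gh; rewrite !adjM Gh.
have -> : G *m W *m G *m (G *m (W^t* *m G)) = (G *m W *m G *m (G *m W^t*)) *m G.
  by rewrite !mulmxA.
by rewrite mxtrace_mulC !mulmxA.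
Qed.

Lemma tr_cross n (A B V : 'M[C]_n) : A^t* = A -> B^t* = B ->
  \tr (A *m (B *m V)^t*) = (\tr (V *m (A *m B)))^*.
Proof.
by move=> Ah Bh; rewrite -tr_adj !adjM Ah Bh !mulmxA mxtrace_mulC !mulmxA mxtrace_mulC !mulmxA.
Qed.

Lemma diff_sandwich m n (A B : 'M[C]_(m, n)) :
  2%:R *: (A *m A^t* - B *m B^t*) =
  (A - B) *m (A + B)^t* + (A + B) *m (A - B)^t*.
Proof.
rewrite adjD adjB !mulmxBl !mulmxDl !mulmxBr !mulmxDr.
move: (A *m A^t*) (B *m B^t*) (A *m B^t*) (B *m A^t*) => x y z t.
by rewrite scaler_nat mulr2n; apply/matrixP => i j; rewrite !mxE; ring.
Qed.

Lemma row_mx_adj m n p (A A' : 'M[C]_(m, n)) (B B' : 'M[C]_(m, p)) :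
  row_mx A B *m (row_mx A' B')^t* = A *m A'^t* + B *m B'^t*.
Proof. by rewrite tr_row_mx map_col_mx mul_row_col. Qed.

(** Pads the partial isometry [V]: the second block carries what the projection [L] loses, so that
    the two blocks together still purify [B *m B]. *)
Lemma proj_split n (B V : 'M[C]_n) (L := V *m V^t*) : B^t* = B -> L *m L = L ->
  (B *m V) *m (B *m V)^t* + (B *m (1%:M - L)) *m (B *m (1%:M - L))^t* = B *m B.
Proof.
move=> Bh LL; have Lh : L^t* = L by rewrite /L adjM adjK.
have M : (1%:M - L) *m (1%:M - L) = 1%:M - L.
  by rewrite mulmxBl mul1mx mulmxBr mulmx1 LL subrr subr0.
rewrite !adjM Bh adjB adj1 Lh !mulmxA -(mulmxA B V) -/L -(mulmxA B (1%:M - L)) M.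
by rewrite mulmxBr mulmx1 mulmxBl addrC subrK.
Qed.

Lemma fcalc_herm_real n (U : 'M[C]_n) f : U \is unitarymx ->
  (fcalc U f)^t* = fcalc U f -> forall k, f k \is Num.real.
Proof.
move=> Uu Hh k; apply/CrealP; have <- := fcalcV Uu f k.
by move: (fcalc U f) Hh => X Xh; rewrite -adjE !adjM adjK Xh mulmxA.
Qed.

Lemma fcalc_jordan n (U : 'M[C]_n) f (P := fcalc U (fun k => (`|f k| + f k) / 2))
    (Q := fcalc U (fun k => (`|f k| - f k) / 2)) :
  U \is unitarymx -> (forall k, f k \is Num.real) ->
  exists S : 'M[C]_n, [/\ S^t* = S, (S *m S) *m (S *m S) = S *m S,
    fcalc U f = P - Q & \tr P + \tr Q = \tr (S *m fcalc U f)].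
Proof.
move=> Uu fr; pose s k := f k / `|f k|.
have sr k : (s k)^* = s k by apply/CrealP; rewrite rpredM ?rpredV ?normr_real.
have ss k : s k * s k * (s k * s k) = s k * s k.
  rewrite /s; have [->|nz] := eqVneq (f k) 0; first by rewrite !mul0r.
  suff -> : f k / `|f k| * (f k / `|f k|) = 1 by rewrite mulr1.
  by rewrite -expr2 expr_div_n real_normK // divff // expf_neq0.
have sf k : s k * f k = `|f k|.
  rewrite /s; have [->|nz] := eqVneq (f k) 0; first by rewrite mulr0 normr0.
  by rewrite mulrAC -expr2 -real_normK // expr2 mulfK ?normr_eq0.
exists (fcalc U s); split.
- by rewrite adj_fcalc; congr fcalc; apply/funext => k; apply: sr.
- by rewrite !(fcalcM Uu); congr fcalc; apply/funext => k; apply: ss.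
- rewrite /P /Q /fcalc -mulmxBl -mulmxBr; congr (_ *m _ *m _).
  rewrite -raddfB /=; congr diag_mx; apply/rowP => k; rewrite !mxE.
  by field.
- rewrite (fcalcM Uu) !(tr_fcalc Uu) -big_split; apply: eq_bigr => k _ /=.
  by rewrite sf; field.
Qed.

End TraceIdentities.

Section TraceNorm.
Variable R : realType.
Local Notation C := R[i].

Lemma contraction_psd n (W P : 'M[C]_n) :
  contraction W -> psd P -> complex.Re (\tr (W *m P)) <= complex.Re (\tr P).
Proof.
move=> [Wc _] /psd_factor[B ->]; rewrite -fro_trE mulmxA.
apply: (le_trans (tr_le_fro _ _)); rewrite fro_adj.
rewrite -[leRHS]sqr_sqrtr ?fro_ge0 // expr2 ler_wpM2r ?sqrtr_ge0 //.
by rewrite ler_wsqrtr.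
Qed.

(** Cyclicity rewrites the squared norm of [G *m W *m G] as the overlap of [G *m G *m W] and
    [W *m (G *m G)]; a second Cauchy-Schwarz step then removes [W] from both. *)
Lemma contraction_weighted n (W G X : 'M[C]_n) :
  contraction W -> G^t* = G ->
  complex.Re (\tr (W *m (G *m X *m G))) <= Num.sqrt (fro (G *m G)) * Num.sqrt (fro X).
Proof.
move=> [Wl Wr] Gh.
rewrite tr_sandwich; apply: (le_trans (tr_le_fro (G *m W *m G) X)).
apply: ler_wpM2r; rewrite ?sqrtr_ge0 // ler_wsqrtr //.
rewrite fro_trE (tr_sandwich_adj _ Gh).
apply: (le_trans (tr_le_fro _ _)); rewrite fro_adj.
rewrite -[leRHS]sqr_sqrtr ?fro_ge0 // expr2.
by apply: ler_pM; rewrite ?sqrtr_ge0 // ler_wsqrtr.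
Qed.

Lemma herm_jordan n (H : 'M[C]_n) : H^t* = H -> exists S P Q : 'M[C]_n,
  [/\ contraction S, psd P, psd Q, H = P - Q & \tr P + \tr Q = \tr (S *m H)].
Proof.
move=> Hh; have [U [f Uu HE]] := herm_spectral Hh.
have fr : forall k, f k \is Num.real.
  by apply: fcalc_herm_real Uu _; rewrite -HE.
have [S [e1 e2 e3 e4]] := fcalc_jordan Uu fr.
exists S, (fcalc U (fun k => (`|f k| + f k) / 2)),
  (fcalc U (fun k => (`|f k| - f k) / 2)).
split; rewrite ?HE //.
- by apply: proj_contraction; rewrite e1 e2.
- apply: psd_fcalc => k; rewrite divr_ge0 // -lerBlDr sub0r -normrN.
  by apply: real_ler_norm; rewrite rpredN.
- by apply: psd_fcalc => k; rewrite divr_ge0 // subr_ge0 real_ler_norm.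
Qed.

(** Uhlmann's argument with Hilbert-Schmidt vectors: [A'] and [C'] are purifications of [a] and [b],
    written as matrices with twice as many columns, whose overlap is the fidelity. The distance is
    given through the Jordan pieces [P], [Q] because smoothing uses their positivity. *)
Lemma fuchs_van_de_graaf n (a b : 'M[C]_n) :
  psd a -> \tr a = 1 -> psd b -> \tr b = 1 -> exists P Q : 'M[C]_n,
  [/\ psd P, psd Q, a - b = P - Q &
      complex.Re (\tr P) + complex.Re (\tr Q) <= 2 * purified_distance a b].
Proof.
move=> ap a1 bp b1; have [Ap Ah AA] := mxsqrt_psd ap.
have [Bp Bh BB] := mxsqrt_psd bp.
rewrite /purified_distance /fidelity.
move: (mxsqrt a) (mxsqrt b) Ap Ah AA Bp Bh BB => A B Ap Ah AA Bp Bh BB.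
have [V [V1 V2 ->]] := trace_norm_polar (A *m B).
set F := complex.Re _; pose L : 'M[C]_n := V *m V^t*.
pose A' : 'M[C]_(n, n + n) := row_mx A 0.
pose C' : 'M[C]_(n, n + n) := row_mx (B *m V) (B *m (1%:M - L)).
have aE : a = A' *m A'^t* by rewrite row_mx_adj mul0mx addr0 Ah.
have bE : b = C' *m C'^t* by rewrite row_mx_adj (proj_split Bh V1).
have AC : complex.Re (\tr (A' *m C'^t*)) = F.
  by rewrite row_mx_adj mul0mx addr0 (tr_cross _ Ah Bh) complexRe_conj.
have fA : fro A' = 1 by rewrite fro_trE -aE a1.
have fC : fro C' = 1 by rewrite fro_trE -bE b1.
have fD : fro (A' + C') = 2 + 2 * F by rewrite froD AC fA fC; ring.
have fB : fro (A' - C') = 2 - 2 * F.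
  by rewrite froD froN adjN mulmxN raddfN /= ReN AC fA fC; ring.
have Hh : (a - b)^t* = a - b by rewrite adjB !psd_herm.
have [S [P [Q [[Sl Sr] Pp Qp HE tE]]]] := herm_jordan Hh.
exists P, Q; split=> //; rewrite -ReD tE.
have F1 : 0 <= 2 - 2 * F by rewrite -fB fro_ge0.
have F2 : 0 <= 2 + 2 * F by rewrite -fD fro_ge0.
(* The norms of [A' - C'] and [A' + C'] multiply to the purified distance, up to the factor 2. *)
have FF : Num.sqrt (2 - 2 * F) * Num.sqrt (2 + 2 * F) = 2 * Num.sqrt (1 - F ^+ 2).
  rewrite -sqrtrM // (_ : _ * _ = 2 ^+ 2 * (1 - F ^+ 2)); last by ring.
  by rewrite sqrtrM ?sqr_ge0 // sqrtr_sqr ger0_norm.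
have E : 2%:R *: (a - b) = (A' - C') *m (A' + C')^t* + (A' + C') *m (A' - C')^t*.
  by rewrite {1}aE {1}bE diff_sandwich.
have G (X Y : 'M[C]_(n, n + n)) x y : fro X = x -> fro Y = y ->
    complex.Re (\tr (S *m (X *m Y^t*))) <= Num.sqrt x * Num.sqrt y.
  move=> <- <-; rewrite mulmxA; apply: (le_trans (tr_le_fro _ _)).
  by rewrite fro_adj ler_wpM2r ?sqrtr_ge0 // ler_wsqrtr.
have := lerD (G _ _ _ _ fB fD) (G _ _ _ _ fD fB).
rewrite -ReD -mxtraceD -mulmxDr -E -scalemxAr mxtraceZ.
have two : 2%:R = (2%:R)%:C%C :> C by rewrite rmorph_nat.
rewrite [X in _ <= _ + X]mulrC FF two ReZ; lra.
Qed.

Lemma purified_distancexx n (a : 'M[C]_n) :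
  psd a -> \tr a = 1 -> purified_distance a a = 0.
Proof.
move=> ap a1; have [_ _ aa] := mxsqrt_psd ap.
rewrite /purified_distance /fidelity aa /trace_norm (psd_herm ap) mxsqrt_sqr // a1.
by rewrite /= expr1n subrr sqrtr0.
Qed.

End TraceNorm.

(** The label types vary with the region, hence dependent functions. Factorizations over the regions
    of traces, norms and matrix products rest on this. *)
Lemma big_dffun_distr (S : comPzSemiRingType) (L : finType) (T : L -> finType)
    (F : forall i, T i -> S) :
  \sum_(f : {dffun forall i, T i}) \prod_i F i (f i) = \prod_i \sum_x F i x.
Proof.
rewrite (reindex (@dffun_of_fprod L T)); last exact/onW_bij/dffun_of_fprod_bij.
transitivity (\sum_(t : fprod T) \prod_(i in L) [ffun x => F i x] (t i)).
  by apply: eq_bigr => f _; apply: eq_bigr => i _; rewrite /dffun_of_fprod !ffunE.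
rewrite big_fprod.
rewrite -(bigA_distr_big_dep _ (fun i j => untag 0 [ffun x => F i x] j)).
apply: eq_bigr => i _.
transitivity (\sum_(x : T i) [ffun x => F i x] x); last first.
  by apply: eq_bigr => x _; rewrite ffunE.
have -> := @big_tag S 0 +%R L T (fun i x => [ffun x => F i x] x) i.
by apply: eq_big => // j.
Qed.

(** * Operators on labelled and composite systems, entry by entry *)

Section Operators.
Variable R : realType.
Local Notation C := R[i].
Implicit Types I J K : finType.

Lemma entry_mkop I (F : I -> I -> C) x y : entry (mkop F) x y = F x y.
Proof. by rewrite /entry /mkop mxE !enum_rankK. Qed.

Lemma op_ext I (A B : op R I) : (forall x y, entry A x y = entry B x y) -> A = B.
Proof.
move=> AB; apply/matrixP => i j.
by have := AB (enum_val i) (enum_val j); rewrite /entry !enum_valK.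
Qed.

Lemma big_pairE (S : nmodType) I J (F : I * J -> S) :
  \sum_p F p = \sum_a \sum_b F (a, b).
Proof. by rewrite pair_big; apply: eq_bigr => -[]. Qed.

Lemma big_enum_ord (S : nmodType) I (F : 'I_#|I| -> S) :
  \sum_k F k = \sum_x F (enum_rank x).
Proof. by rewrite (reindex (@enum_rank I)) //; apply/onW_bij/enum_rank_bij. Qed.

Lemma entryM I (A B : op R I) x y :
  entry (A *m B) x y = \sum_z entry A x z * entry B z y.
Proof. by rewrite /entry mxE big_enum_ord. Qed.

Lemma tr_entry I (A : op R I) : \tr A = \sum_x entry A x x.
Proof. by rewrite /mxtrace big_enum_ord. Qed.

Lemma entry_adj I (A : op R I) x y : entry (A^t*) x y = ((entry A y x)^*)%R.
Proof. by rewrite /entry !mxE. Qed.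

Lemma fro_entry I (A : op R I) : fro A = \sum_x \sum_y sqn (entry A x y).
Proof. by rewrite /fro big_enum_ord; apply: eq_bigr => x _; rewrite big_enum_ord. Qed.

Lemma entryD I (A B : op R I) x y : entry (A + B) x y = entry A x y + entry B x y.
Proof. by rewrite /entry mxE. Qed.

Lemma entryN I (A : op R I) x y : entry (- A) x y = - entry A x y.
Proof. by rewrite /entry mxE. Qed.

Lemma entryZ I (A : op R I) a x y : entry (a *: A) x y = a * entry A x y.
Proof. by rewrite /entry mxE. Qed.

Lemma entry1 I x y : entry (1%:M : op R I) x y = (x == y)%:R.
Proof. by rewrite /entry mxE (inj_eq enum_rank_inj). Qed.

Lemma entry_sum I (T : Type) (r : seq T) (P : pred T) (F : T -> op R I) x y :
  entry (\sum_(i <- r | P i) F i) x y = \sum_(i <- r | P i) entry (F i) x y.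
Proof. by rewrite /entry summxE. Qed.

(** A Gram form whose index type [K] is free: positivity of tensor products, partial traces and
    outputs of maps becomes a regrouping of indices. *)
Lemma psd_entry I K (B : I -> K -> C) (A : op R I) :
  (forall x y, entry A x y = \sum_k B x k * ((B y k)^*)%R) -> psd A.
Proof.
move=> AE; pose M : 'M[C]_(#|I|, #|K|) := \matrix_(i, k) B (enum_val i) (enum_val k).
suff -> : A = M *m M^t* by exact: psdMadj.
apply: op_ext => x y; rewrite AE /entry mxE big_enum_ord; apply: eq_bigr => k _.
by rewrite !mxE !enum_rankK.
Qed.

Lemma psd_entry_factor I (A : op R I) : psd A ->
  exists B : I -> I -> C, forall x y, entry A x y = \sum_k B x k * ((B y k)^*)%R.
Proof.
move=> /psd_factor[B ->]; exists (entry (B : op R I)) => x y.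
by rewrite entryM; apply: eq_bigr => k _; rewrite entry_adj.
Qed.

Lemma entry_otens I J (A : op R I) (B : op R J) x y :
  entry (otens A B) x y = entry A x.1 y.1 * entry B x.2 y.2.
Proof. exact: entry_mkop. Qed.

Lemma otensM I J (A A' : op R I) (B B' : op R J) :
  otens A B *m otens A' B' = otens (A *m A') (B *m B').
Proof.
apply: op_ext => x y; rewrite entryM entry_otens !entryM big_distrlr /= pair_big /=.
by apply: eq_bigr => z _; rewrite !entry_otens mulrACA.
Qed.

Lemma adj_otens I J (A : op R I) (B : op R J) : (otens A B)^t* = otens (A^t*) (B^t*).
Proof.
by apply: op_ext => x y; rewrite entry_adj !entry_otens !entry_adj rmorphM.
Qed.

Lemma otens1 I J : otens (1%:M : op R I) (1%:M : op R J) = 1%:M.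
Proof.
by apply: op_ext => -[a b] [c d]; rewrite entry_otens !entry1 /= -natrM mulnb.
Qed.

Lemma tr_otens I J (A : op R I) (B : op R J) : \tr (otens A B) = \tr A * \tr B.
Proof.
rewrite !tr_entry big_distrlr /= pair_big; apply: eq_bigr => x _.
by rewrite entry_otens.
Qed.

Lemma fro_otens I J (A : op R I) (B : op R J) : fro (otens A B) = fro A * fro B.
Proof.
apply: complexI; rewrite real_complexM !froE adj_otens otensM; exact: tr_otens.
Qed.

Lemma psd_otens I J (A : op R I) (B : op R J) : psd A -> psd B -> psd (otens A B).
Proof.
move=> /psd_entry_factor[F AE] /psd_entry_factor[G BE].
apply: (@psd_entry _ _ (fun x k => F x.1 k.1 * G x.2 k.2)) => x y.
rewrite entry_otens AE BE big_distrlr /= pair_big; apply: eq_bigr => k _ /=.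
by rewrite rmorphM mulrACA.
Qed.

Lemma entry_ptrace I J (X : op R (I * J)) b b' :
  entry (ptrace_fst X) b b' = \sum_a entry X (a, b) (a, b').
Proof. exact: entry_mkop. Qed.

Lemma psd_ptrace I J (X : op R (I * J)) : psd X -> psd (ptrace_fst X).
Proof.
move=> /psd_entry_factor[F XE].
apply: (@psd_entry _ _ (fun b (k : I * (I * J)) => F (k.1, b) k.2)) => x y.
by rewrite entry_ptrace; under eq_bigr do rewrite XE; rewrite pair_big.
Qed.

Lemma tr_ptrace I J (X : op R (I * J)) : \tr (ptrace_fst X) = \tr X.
Proof.
rewrite !tr_entry; under eq_bigr do rewrite entry_ptrace.
rewrite exchange_big /= pair_big.
have E (p : I * J) : entry X (p.1, p.2) (p.1, p.2) = entry X p p by case: p.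
by apply: eq_bigr => p _; apply: E.
Qed.

Lemma ptrace_otens1 I J (X : op R (I * J)) (B D : op R J) :
  ptrace_fst (otens 1%:M B *m X *m otens 1%:M D) = B *m ptrace_fst X *m D.
Proof.
have E (b : J) (F : I -> J -> C) x : \sum_z (x == z.1)%:R * F z.1 z.2 =
    \sum_y F x y.
  rewrite -(pair_big predT predT (fun a c => (x == a)%:R * F a c)) /=.
  rewrite (bigD1 x) //= addrC big1 ?add0r => [|a /negPf ne].
    by apply: eq_bigr => c _; rewrite eqxx mul1r.
  by apply: big1 => c _; rewrite eq_sym ne mul0r.
have El a b y : entry (otens 1%:M B *m X) (a, b) y =
    \sum_c entry B b c * entry X (a, c) y.
  rewrite entryM -(E b (fun a c => entry B b c * entry X (a, c) y)).
  by apply: eq_bigr => -[a' c] _; rewrite entry_otens entry1 mulrA.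
have Er (Y : op R (I * J)) a b x : entry (Y *m otens 1%:M D) x (a, b) =
    \sum_c entry Y x (a, c) * entry D c b.
  rewrite entryM -(E b (fun a c => entry Y x (a, c) * entry D c b)).
  by apply: eq_bigr => -[a' c] _; rewrite entry_otens entry1 /= mulrCA eq_sym.
apply: op_ext => x y; rewrite entry_ptrace !entryM.
under eq_bigr do rewrite Er; rewrite exchange_big; apply: eq_bigr => c _ /=.
under eq_bigr do rewrite El; rewrite -mulr_suml entryM; congr (_ * _).
rewrite exchange_big; apply: eq_bigr => e _.
by rewrite entry_ptrace mulr_sumr.
Qed.

Lemma otens1_fcalc I J (U : op R J) (f : 'I_#|J| -> C) :
  otens (1%:M : op R I) (fcalc U f) =
  fcalc (otens (1%:M : op R I) U)
        (fun k => f (enum_rank (enum_val k : (I * J)%type).2)).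
Proof.
have D K (g : 'I_#|K| -> C) x y :
    entry (diag_mx (\row_k g k) : op R K) x y = g (enum_rank x) * (x == y)%:R.
  by rewrite /entry !mxE (inj_eq enum_rank_inj) mulr_natr.
rewrite /fcalc adj_otens adj1.
set d := diag_mx (\row_k f k); set e := diag_mx _.
have -> : e = otens 1%:M d.
  apply: op_ext => -[a b] [a' b']; rewrite entry_otens entry1 /e /d !D enum_rankK.
  by rewrite xpair_eqE -mulnb natrM mulrCA.
by rewrite !otensM !mul1mx.
Qed.

Lemma otens1_unitary I J (U : op R J) :
  U \is unitarymx -> otens (1%:M : op R I) U \is unitarymx.
Proof.
by move=> /unitarymxP h; apply/unitarymxP; rewrite adj_otens otensM h adj1 mul1mx otens1.
Qed.

(** A diagonalization of [B] tensored with the identity diagonalizes the tensor product, and [mxfun]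
    may be computed in any diagonalization. *)
Lemma mxrootV4_otens1 I J (B : op R J) : psd B ->
  mxrootV4 (otens (1%:M : op R I) B) = otens 1%:M (mxrootV4 B).
Proof.
move=> /psd_spectral[U [f [Uu f0 ->]]].
rewrite otens1_fcalc /mxrootV4 (mxfun_fcalc _ _ (otens1_unitary _ Uu)).
by rewrite (mxfun_fcalc _ _ Uu) otens1_fcalc.
Qed.

End Operators.

Lemma root4_cancel (C : numClosedFieldType) n (g s : 'M[C]_n) :
  g *m s = s *m g -> g *m s *m g = g -> s *m (g *m g *m g *m g) *m s = g *m g.
Proof.
move=> gs gsg; have gsg' : g *m (s *m g) = g by rewrite mulmxA.
rewrite !mulmxA -gs gsg -(mulmxA (g *m g) g s) gs -(mulmxA g g) gsg'.
by [].
Qed.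

(** * Conditional collision entropy *)

Section Conditional.
Variable R : realType.
Local Notation C := R[i].

Lemma psd_tr_mul n (A B : 'M[C]_n) : psd A -> psd B -> 0 <= complex.Re (\tr (A *m B)).
Proof.
move=> /psd_factor[F ->] /psd_factor[G ->].
have -> : \tr (F *m F^t* *m (G *m G^t*)) = \tr ((F^t* *m G) *m (F^t* *m G)^t*).
  by rewrite adjM adjK -!(mulmxA F) mxtrace_mulC -!mulmxA.
by rewrite -fro_trE fro_ge0.
Qed.

Lemma mxtrace_sum n (I : Type) (r : seq I) (P : pred I) (F : I -> 'M[C]_n) :
  \tr (\sum_(i <- r | P i) F i) = \sum_(i <- r | P i) \tr (F i).
Proof. exact: raddf_sum. Qed.

(** The cross terms [tr (X a *m X b)] are nonnegative. *)
Lemma fro_sum_psd n (I : finType) (X : I -> 'M[C]_n) :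
  (forall a, psd (X a)) -> \sum_a fro (X a) <= fro (\sum_a X a).
Proof.
move=> Xp; rewrite fro_trE (psd_herm _); last first.
  by move=> v; rewrite mulmx_sumr mulmx_suml summxE sumr_ge0 // => a _; apply: Xp.
rewrite mulmx_suml mxtrace_sum Re_sum; apply: ler_sum => a _.
rewrite mulmx_sumr mxtrace_sum Re_sum (bigD1 a) //= fro_trE psd_herm // lerDl.
by apply: sumr_ge0 => b _; apply: psd_tr_mul.
Qed.

(** Cauchy-Schwarz for the sum over [a]. In terms of entropy it says [H2 <= log2 #|I|]; it also
    keeps the argument of the logarithm positive. *)
Lemma fro_ptrace_le (I J : finType) (X : op R (I * J)) :
  fro (ptrace_fst X) <= #|I|%:R * fro X.
Proof.
apply: (@le_trans _ _ (#|I|%:R * \sum_b \sum_b' \sum_a sqn (entry X (a, b) (a, b')))).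
  rewrite fro_entry mulr_sumr; apply: ler_sum => b _; rewrite mulr_sumr.
  by apply: ler_sum => b' _; rewrite entry_ptrace sqn_sum_le.
rewrite ler_wpM2l // fro_entry.
have -> : \sum_b \sum_b' \sum_a sqn (entry X (a, b) (a, b')) =
    \sum_a \sum_b \sum_b' sqn (entry X (a, b) (a, b')).
  transitivity (\sum_b \sum_a \sum_b' sqn (entry X (a, b) (a, b'))).
    by apply: eq_bigr => b _; apply: exchange_big.
  exact: exchange_big.
rewrite [leRHS]big_pairE; apply: ler_sum => a _; apply: ler_sum => b _.
rewrite big_pairE [leRHS](bigD1 a) //= lerDl; apply: sumr_ge0 => a' _; apply: sumr_ge0 => b' _.
exact: sqn_ge0.
Qed.

(** In terms of entropy, [H2 >= - log2 #|I|]. The blocks of [X] are Gram products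
    [M a *m (M a')^t*], whose off-diagonal norms are controlled by the diagonal ones; squaring the
    sum of the square roots costs the factor [#|I|]. *)
Lemma fro_le_ptrace (I J : finType) (X : op R (I * J)) :
  psd X -> fro X <= #|I|%:R * fro (ptrace_fst X).
Proof.
move=> /psd_entry_factor[K XE].
pose M a : 'M[C]_(#|J|, #|(I * J)%type : finType|) :=
  \matrix_(j, k) K (a, enum_val j) (enum_val k).
have ME a a' b b' : entry (M a *m (M a')^t* : op R J) b b' = entry X (a, b) (a', b').
  rewrite /entry mxE big_enum_ord -/(entry X (a, b) (a', b')) XE.
  by apply: eq_bigr => k _; rewrite !mxE !enum_rankK.
have XS : fro X = \sum_a \sum_a' fro (M a *m (M a')^t*).
  rewrite fro_entry big_pairE; apply: eq_bigr => a _.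
  under eq_bigr => b _ do rewrite big_pairE.
  rewrite exchange_big; apply: eq_bigr => a' _.
  rewrite fro_entry; apply: eq_bigr => b _; apply: eq_bigr => b' _.
  by rewrite ME.
have XP : ptrace_fst X = \sum_a M a *m (M a)^t*.
  by apply: op_ext => b b'; rewrite entry_ptrace entry_sum; apply: eq_bigr => a _; rewrite ME.
pose m a := fro (M a *m (M a)^t*).
have mE a : fro ((M a)^t* *m M a) = m a.
  by rewrite /m !fro_trE !adjM !adjK -!mulmxA mxtrace_mulC -!mulmxA.
have le a a' : fro (M a *m (M a')^t*) <= Num.sqrt (m a) * Num.sqrt (m a').
  have -> : fro (M a *m (M a')^t*) =
      complex.Re (\tr (((M a)^t* *m M a) *m ((M a')^t* *m M a'))).
    by rewrite fro_trE adjM adjK -[in RHS]mulmxA [in RHS]mxtrace_mulC -!mulmxA.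
  by apply: (le_trans (tr_le_fro _ _)); rewrite !mE.
rewrite XS; apply: (@le_trans _ _ ((\sum_a Num.sqrt (m a)) ^+ 2)).
  by rewrite expr2 big_distrlr /=; apply: ler_sum => a _; apply: ler_sum => a' _.
apply: (le_trans (sqr_sum_le _)); rewrite ler_wpM2l //.
rewrite XP; apply: le_trans (fro_sum_psd _); last by move=> a; apply: psdMadj.
by apply: ler_sum => a _; rewrite sqr_sqrtr ?fro_ge0.
Qed.

Lemma powR_log2 (x : R) : 0 < x -> 2 `^ (log2 x) = x.
Proof.
move=> x0; rewrite /powR pnatr_eq0 /= /log2 divfK ?lnK ?posrE //.
by rewrite gt_eqF // ln_gt0 // ltr1n.
Qed.

(* [g] is the fourth root of the reduced state. *)
Lemma state_conditional (I J : finType) (rho : op R (I * J)) : state rho ->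
  exists (rt : op R (I * J)) (g : op R J),
  [/\ rho = otens 1%:M g *m rt *m otens 1%:M g, psd rt,
      g^t* = g /\ fro (g *m g) = 1, ptrace_fst rt = g *m g &
      fro rt = 2 `^ (- H2 rho)].
Proof.
move=> [rp r1]; have rBp := psd_ptrace rp.
have [g [sh gh g4 gs gsg]] := mxrootV4_psd rBp.
move sE : (mxrootV4 _) sh gs gsg => s sh gs gsg.
pose S : op R (I * J) := otens 1%:M s.
have Sh : S^t* = S by rewrite /S adj_otens adj1 sh.
pose rt := S *m rho *m S.
have tp : psd rt by rewrite /rt -{2}Sh; apply: psd_conj.
have Pt : ptrace_fst rt = g *m g.
  by rewrite /rt /S ptrace_otens1 -g4 root4_cancel.
have gg : fro (g *m g) = 1.
  by rewrite fro_trE adjM gh mulmxA g4 tr_ptrace r1.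
(* [rho] lives on the support of its marginal: [Q] projects onto the complement, and the trace of
   [Q *m rho *m Q] can be computed on the marginal, where it vanishes. *)
have supp : otens (1%:M : op R I) (g *m s) *m rho = rho.
  pose Q : op R (I * J) := otens 1%:M (1%:M - g *m s).
  suff Q0 : Q *m rho = 0.
    rewrite -[RHS]mul1mx -otens1 -(subrK (g *m s) 1%:M).
    have -> : otens (1%:M : op R I) (1%:M - g *m s + g *m s) =
        Q + otens 1%:M (g *m s).
      by apply: op_ext => x y; rewrite entryD !entry_otens entryD mulrDr.
    by rewrite mulmxDl Q0 add0r.
  have Qh : Q^t* = Q by rewrite /Q adj_otens adj1 adjB adj1 adjM gh sh gs.
  have [K KE] := psd_factor rp.
  have QK : fro (Q *m K) = 0.
    rewrite fro_trE adjM !mulmxA -(mulmxA Q) -KE Qh -tr_ptrace /Q ptrace_otens1 -g4.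
    by rewrite !mulmxA mulmxBl mul1mx gsg subrr !mul0mx mxtrace0.
  by rewrite KE mulmxA (fro_eq0 QK) mul0mx.
(* A zero norm would contradict the normalization [gg] of the marginal; positivity is needed to undo
   the logarithm. *)
have ft : 0 < fro rt.
  have := fro_ptrace_le rt; rewrite Pt gg => le1.
  rewrite lt_neqAle fro_ge0 andbT eq_sym; apply/eqP => f0; move: le1.
  by rewrite f0 mulr0 ler10.
exists rt, g; split=> //.
  rewrite /rt /S !mulmxA otensM mulmx1 supp -mulmxA otensM mulmx1.
  rewrite -[LHS](psd_herm rp) -{1}supp adjM adj_otens adj1 (psd_herm rp) adjM gh sh.
  by [].
rewrite /H2 mxrootV4_otens1 // sE -/S -/rt opprK powR_log2.
  by rewrite fro_trE (psd_herm tp) /rt !mulmxA.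
by move: ft; rewrite fro_trE (psd_herm tp) /rt !mulmxA.
Qed.

End Conditional.

(** * Pauli strings and the Clifford group *)

Section PauliTable.
Variables (C : comNzRingType) (i : C).
Hypothesis ii : i * i = -1.

Definition pauli_entry (p : bool * bool) (x y : bool) : C :=
  match p with
  | (false, false) => (x == y)%:R
  | (false, true) => (x == y)%:R * (-1) ^+ x
  | (true, false) => (x != y)%:R
  | (true, true) => (x != y)%:R * (if x then i else - i)
  end.

Definition pauli_add (p q : bool * bool) := (p.1 (+) q.1, p.2 (+) q.2).

(* [X Y = i Z], [Y Z = i X], [Z X = i Y], with [i ^ 3] for the reverse products. *)
Definition pauli_phase (p q : bool * bool) : nat :=
  match p, q with
  | (true, false), (true, true) | (true, true), (false, true)
  | (false, true), (true, false) => 1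
  | (true, true), (true, false) | (false, true), (true, true)
  | (true, false), (false, true) => 3
  | _, _ => 0
  end.

(** The symplectic form on Pauli labels, true exactly when the two matrices anticommute. *)
Definition pauli_sympl (p q : bool * bool) : bool := (p.1 && q.2) (+) (p.2 && q.1).

Lemma pauli_entryM p q x y :
  \sum_z pauli_entry p x z * pauli_entry q z y =
  i ^+ pauli_phase p q * pauli_entry (pauli_add p q) x y.
Proof.
have i3 : i * (i * i) = - i by rewrite ii mulrN1.
rewrite big_bool; case: p q x y => [[] []] [[] []] [] [];
  rewrite /= ?exprS ?expr0 ?mulr1 ?mul1r ?mulr0 ?mul0r ?addr0 ?add0r;
  rewrite ?mulrN ?mulNr ?mulrN1 ?mulN1r ?opprK ?mulr1 ?mul1r ?i3 ?ii ?opprK ?mulr1 //;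
  by rewrite ?mulNr ?ii ?mulr0 ?oppr0 ?opprK ?addr0.
Qed.

Lemma pauli_entry_comm p q x y :
  \sum_z pauli_entry p x z * pauli_entry q z y =
  (-1) ^+ pauli_sympl p q * \sum_z pauli_entry q x z * pauli_entry p z y.
Proof.
have i3 : i * (i * i) = - i by rewrite ii mulrN1.
rewrite !pauli_entryM; case: p q x y => [[] []] [[] []] [] [];
  rewrite /= ?exprS ?expr0 ?mulr1 ?mul1r ?mulr0 ?mul0r ?addr0 ?add0r;
  rewrite ?mulrN ?mulNr ?mulrN1 ?mulN1r ?opprK ?mulr1 ?mul1r ?i3 ?ii ?opprK ?mulr1 //;
  by rewrite ?mulNr ?ii ?mulr0 ?oppr0 ?opprK ?addr0.
Qed.

Lemma pauli_entry_complete a b c d :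
  \sum_p pauli_entry p a b * pauli_entry p d c = 2 * (a == c)%:R * (b == d)%:R.
Proof.
rewrite (eq_bigr (fun p => pauli_entry (p.1, p.2) a b * pauli_entry (p.1, p.2) d c));
  last by case.
rewrite -(pair_bigA _ (fun u v => pauli_entry (u, v) a b * pauli_entry (u, v) d c)).
rewrite !big_bool; case: a b c d => [] [] [] [];
  rewrite /= ?expr0 ?expr1 ?mulr1 ?mul1r ?mulr0 ?mul0r ?addr0 ?add0r;
  by rewrite ?mulrN ?mulNr ?ii ?opprK ?mulr1 ?mulr0 ?oppr0 ?subrr ?addNr.
Qed.

Lemma pauli_entry_tr p : \sum_x pauli_entry p x x = 2 * (p == (false, false))%:R.
Proof.
rewrite big_bool; case: p => [[] []];
  by rewrite /= ?expr0 ?expr1 ?mulr1 ?mul1r ?mulr0 ?mul0r ?addr0 ?addNr.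
Qed.

End PauliTable.

Lemma ffun_neq (I : finType) (T : eqType) (f g : {ffun I -> T}) :
  f != g -> exists j, f j != g j.
Proof.
move=> /eqP ne; apply/existsP; rewrite -negb_forall; apply/forallP => e.
by apply: ne; apply/ffunP => j; apply/eqP.
Qed.

Section Pauli.
Variables (R : realType) (J : finType).
Local Notation C := R[i].
Local Notation label := {ffun J -> bool * bool}.
Local Notation pauli p := (pauli_string R (p : label)).
Implicit Types p q r : label.

Definition padd p q : label := [ffun j => pauli_add (p j) (q j)].
Definition pphase p q : nat := \sum_j pauli_phase (p j) (q j).
(** The number of anticommuting sites; only its parity matters. *)
Definition psympl p q : nat := \sum_j pauli_sympl (p j) (q j).
Definition pid : label := [ffun=> (false, false)].

Lemma entry_pauli1 (b : bool * bool) x y :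
  entry (pauli1 R b) x y = pauli_entry ('i : C) b x y.
Proof. by case: b => [[] []]; rewrite /pauli1 ?entry_mkop ?entry1. Qed.

Lemma ii : 'i * 'i = -1 :> C.
Proof. by rewrite -expr2 sqrCi. Qed.

Lemma entry_pauli p x y :
  entry (pauli p) x y = \prod_j pauli_entry ('i : C) (p j) (x j) (y j).
Proof. by rewrite entry_mkop; apply: eq_bigr => j _; rewrite entry_pauli1. Qed.

Lemma entry_pauliM p q x y : entry (pauli p *m pauli q) x y =
  \prod_j \sum_z pauli_entry ('i : C) (p j) (x j) z * pauli_entry 'i (q j) z (y j).
Proof.
rewrite entryM bigA_distr_bigA /=; apply: eq_bigr => z _.
by rewrite !entry_pauli -big_split.
Qed.

Lemma pauliM p q : pauli p *m pauli q = 'i ^+ pphase p q *: pauli (padd p q).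
Proof.
apply: op_ext => x y; rewrite entry_pauliM entryZ entry_pauli.
rewrite /pphase; under eq_bigr do rewrite (pauli_entryM ii).
rewrite big_split /=; congr (_ * _); last by apply: eq_bigr => j _; rewrite ffunE.
by rewrite (big_morph _ (exprD ('i : C)) (expr0 _)).
Qed.

Lemma pauli_comm p q : pauli p *m pauli q = (-1) ^+ psympl p q *: (pauli q *m pauli p).
Proof.
apply: op_ext => x y; rewrite entryZ !entry_pauliM.
under eq_bigr do rewrite (pauli_entry_comm ii).
rewrite big_split /=; congr (_ * _).
by rewrite /psympl (big_morph _ (exprD (-1 : C)) (expr0 _)).
Qed.

Lemma pauli_herm p : (pauli p)^t* = pauli p.
Proof.
apply: op_ext => x y; rewrite entry_adj !entry_pauli rmorph_prod.
apply: eq_bigr => j _ /=; case: (p j) (x j) (y j) => [[] []] [] [] /=;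
  rewrite ?expr0 ?expr1 ?mulr1 ?mul1r ?mul0r;
  by rewrite ?rmorphN ?rmorph0 ?rmorph1 /= ?conjCi ?opprK.
Qed.

Lemma pauli_id : pauli pid = 1%:M.
Proof.
apply: op_ext => x y; rewrite entry_pauli entry1; under eq_bigr do rewrite ffunE /=.
have [->|/ffun_neq[j xy]] := eqVneq x y; first by rewrite big1 // => j _; rewrite eqxx.
by rewrite (bigD1 j) //= (negPf xy) mul0r.
Qed.

Lemma pauli_sqr p : pauli p *m pauli p = 1%:M.
Proof.
rewrite pauliM -pauli_id; have -> : pphase p p = 0%N.
  by rewrite /pphase big1 // => j _; case: (p j) => [[] []].
rewrite expr0 scale1r; congr pauli_string; apply/funext => j; rewrite !ffunE /pauli_add.
by rewrite !addbb.
Qed.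

Lemma pauli_unitary p : pauli p \is unitarymx.
Proof. by apply/unitarymxP; rewrite pauli_herm pauli_sqr. Qed.

Lemma tr_pauli p : \tr (pauli p) = #|{ffun J -> bool}|%:R * (p == pid)%:R.
Proof.
rewrite tr_entry; under eq_bigr do rewrite entry_pauli.
rewrite -(bigA_distr_bigA (fun j x => pauli_entry ('i : C) (p j) x x)) /=.
under eq_bigr do rewrite pauli_entry_tr.
rewrite big_split /= prodr_const card_ffun card_bool natrX; congr (_ * _).
have [->|/ffun_neq[j]] := eqVneq p pid; first by rewrite big1 // => j _; rewrite ffunE eqxx.
by rewrite ffunE => pj; rewrite (bigD1 j) //= (negPf pj) mul0r.
Qed.

Lemma pauli_complete (a b c d : {ffun J -> bool}) :
  \sum_p entry (pauli p) a b * ((entry (pauli p) c d)^*)%R =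
  #|{ffun J -> bool}|%:R * (a == c)%:R * (b == d)%:R.
Proof.
under eq_bigr do rewrite -entry_adj pauli_herm !entry_pauli -big_split /=.
rewrite -(bigA_distr_bigA (fun j s => pauli_entry ('i : C) s (a j) (b j) *
  pauli_entry 'i s (d j) (c j))) /=.
under eq_bigr do rewrite (pauli_entry_complete ii).
rewrite !big_split /= prodr_const card_ffun card_bool natrX.
have E (x y : {ffun J -> bool}) : \prod_j ((x j == y j)%:R : C) = (x == y)%:R.
  have := entry_pauli pid x y; rewrite pauli_id entry1 => ->.
  by apply: eq_bigr => j _; rewrite ffunE.
by rewrite !E.
Qed.

End Pauli.

Section Anticommuting.
Variables (A : pzRingType) (P Q : A).
Hypotheses (P1 : P * P = 1) (Q1 : Q * Q = 1) (QP : Q * P = - (P * Q)).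

Lemma anticomm_sqr : (P + Q) * (P + Q) = 1 *+ 2.
Proof. by rewrite mulrDl !mulrDr P1 Q1 QP addrA addrK. Qed.

Lemma anticomm_diff : (P - Q) * (P + Q) = (P * Q) *+ 2.
Proof.
rewrite mulrBl !mulrDr P1 Q1 QP opprD opprK (addrC 1) addrACA subrr addr0.
by [].
Qed.

Lemma anticomm_swap : (P + Q) * P * (P + Q) = Q *+ 2.
Proof.
rewrite [(P + Q) * P]mulrDl P1 mulrDl mul1r.
have -> : Q * P * (P + Q) = Q - P.
  by rewrite mulrDr -mulrA P1 mulr1 QP mulNr -mulrA Q1 mulr1.
by rewrite [P + Q]addrC addrACA subrr addr0.
Qed.

End Anticommuting.

Section Conjop.
Variables (R : realType) (n : nat).
Local Notation C := R[i].
Implicit Types U V X Y : 'M[C]_n.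

Lemma conjopM U V X : conjop (U *m V) X = conjop U (conjop V X).
Proof. by rewrite /conjop adjM !mulmxA. Qed.

Lemma conjopZ U a X : conjop U (a *: X) = a *: conjop U X.
Proof. by rewrite /conjop -scalemxAr -scalemxAl. Qed.

Lemma conjop_phase U a X : a * a^* = 1 -> conjop (a *: U) X = conjop U X.
Proof.
by move=> a1; rewrite /conjop adjZ -!scalemxAl -scalemxAr scalerA a1 scale1r.
Qed.

Lemma conjop1 U : U \is unitarymx -> conjop U 1%:M = 1%:M.
Proof. by move=> /unitarymxP UU; rewrite /conjop mulmx1. Qed.

Lemma conjopK U X : U \is unitarymx -> conjop (U^t*) (conjop U X) = X.
Proof.
move=> /unitarymxP/mulmx1C UU.
by rewrite -conjopM UU /conjop mul1mx adj1 mulmx1.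
Qed.

Lemma conjop1l X : conjop 1%:M X = X.
Proof. by rewrite /conjop mul1mx adj1 mulmx1. Qed.

(** Scaling multiplies the determinant by the [n]-th power of the scalar, so a root of the inverse
    determinant serves; the empty matrix already has determinant 1. *)
Lemma unit_phase U : U \is unitarymx -> exists a : C, a * a^* = 1 /\ \det (a *: U) = 1.
Proof.
case: n U => [|m] U Uu.
  by exists 1; rewrite rmorph1 mulr1 det_mx00.
have d1 : \det U * (\det U)^* = 1.
  by have /unitarymxP/(congr1 determinant) := Uu; rewrite det_mulmx det_map_mx det_tr det1.
have d0 : \det U != 0 by apply/eqP => d0; move/eqP: d1; rewrite d0 mul0r eq_sym oner_eq0.
exists (m.+1.-root (\det U)^-1); split; last by rewrite detZ rootCK // mulVf.
have dn : `|\det U| = 1.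
  apply/eqP; rewrite -(@pexpr_eq1 _ _ 2) // normCK; exact/eqP.
have : `|m.+1.-root (\det U)^-1| ^+ m.+1 = 1 by rewrite -normrX rootCK // normfV dn invr1.
by move/eqP; rewrite pexpr_eq1 // => /eqP e; rewrite -normCK e expr1n.
Qed.

End Conjop.

Section Clifford.
Variables (R : realType) (J : finType).
Local Notation C := R[i].
Local Notation label := {ffun J -> bool * bool}.
Local Notation pauli p := (pauli_string R (p : label)).
Local Notation pid := (pid J).
Implicit Types (p q r : label) (U V X Y P : op R {ffun J -> bool}).

(** Multiplication by [pauli p] followed by the trace separates distinct labels. *)
Lemma pauli_label_eq p q (a b : C) : a *: pauli p = b *: pauli q -> a != 0 -> p = q.
Proof.
move=> e a0; apply/eqP; apply: contraNT a0 => ne.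
have D0 : (#|{ffun J -> bool}|%:R : C) != 0.
  by rewrite pnatr_eq0 -lt0n; apply/card_gt0P; exists [ffun=> true].
have := congr1 (fun X => \tr (X *m pauli p)) e; rewrite -!scalemxAl !mxtraceZ pauli_sqr.
rewrite pauliM mxtraceZ tr_pauli mxtrace1 (_ : padd q p == pid = false).
  by rewrite !mulr0 => /eqP; rewrite mulf_eq0 (negPf D0) orbF.
apply/negP => /eqP qp; case/eqP: ne; apply/ffunP => j.
move/ffunP: qp => /(_ j); rewrite !ffunE /pauli_add => -[].
by case: (p j) (q j) => [[] []] [[] []].
Qed.

Lemma pauli_groupE p k : pauli_group ('i ^+ k *: pauli p).
Proof. by exists k, p. Qed.

Lemma pauli_groupP X : pauli_group X -> exists k p, X = 'i ^+ k *: pauli p.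
Proof.
move=> [k [p ->]]; exists k, [ffun j => p j]; congr (_ *: pauli_string R _).
by apply/funext => j; rewrite ffunE.
Qed.

Lemma pauli_groupZ X k : pauli_group X -> pauli_group ('i ^+ k *: X).
Proof. by move=> /pauli_groupP[l [p ->]]; rewrite scalerA -exprD; apply: pauli_groupE. Qed.

Lemma pauli_groupN X : pauli_group X -> pauli_group (- X).
Proof. by move=> /(pauli_groupZ 2); rewrite sqrCi scaleN1r. Qed.

Lemma pauli_groupM X Y : pauli_group X -> pauli_group Y -> pauli_group (X *m Y).
Proof.
move=> /pauli_groupP[k [p ->]] /pauli_groupP[l [q ->]].
rewrite -scalemxAl -scalemxAr pauliM.
by do 2!apply: pauli_groupZ; apply: pauli_groupE.
Qed.

Lemma pauli_group_pauli p : pauli_group (pauli p).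
Proof. by have := pauli_groupE p 0; rewrite expr0 scale1r. Qed.

Lemma clifford_act U p : clifford U ->
  exists q, exists k, conjop U (pauli p) = 'i ^+ k *: pauli q.
Proof.
by move=> [_ /(_ _ (pauli_group_pauli p))/pauli_groupP[k [q e]]]; exists q, k.
Qed.

(* The permutation of Pauli strings, up to phases, induced by a Clifford unitary. *)
Definition pact U p : label :=
  odflt p [pick q | `[< exists k, conjop U (pauli p) = 'i ^+ k *: pauli q >]].

Lemma pactP U p : clifford U -> exists k, conjop U (pauli p) = 'i ^+ k *: pauli (pact U p).
Proof.
move=> /clifford_act-/(_ p)[q qP]; rewrite /pact; case: pickP => [r /asboolP //|].
by move=> /(_ q)/asboolP; case.
Qed.

Lemma expCi_neq0 k : 'i ^+ k != 0 :> C.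
Proof. by rewrite expf_neq0 // neq0Ci. Qed.

Lemma expCi_conj k : 'i ^+ k * ('i ^+ k)^* = 1 :> C.
Proof. by rewrite rmorphXn -exprMn /= conjCi mulrN -expr2 sqrCi opprK expr1n. Qed.

Lemma pact_eq U p q a : clifford U ->
  conjop U (pauli p) = a *: pauli q -> pact U p = q.
Proof. by move=> /pactP-/(_ p)[k ->] e; apply: pauli_label_eq e (expCi_neq0 k). Qed.

Lemma pact_inj U : clifford U -> injective (pact U).
Proof.
move=> Uc p q e; have [Uu _] := Uc.
have [k pE] := pactP p Uc; have [l qE] := pactP q Uc.
apply: (@pauli_label_eq p q ('i ^+ l) ('i ^+ k)); last exact: expCi_neq0.
rewrite -(conjopK ('i ^+ l *: _) Uu) -(conjopK ('i ^+ k *: _) Uu) !conjopZ.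
by rewrite pE qE e !conjopZ !scalerA mulrC.
Qed.

Lemma pact_pid U : clifford U -> pact U pid = pid.
Proof.
move=> Uc; apply: (@pact_eq _ _ _ 1) => //.
by rewrite pauli_id scale1r conjop1 //; case: Uc.
Qed.

Lemma pact_neq_pid U p : clifford U -> (pact U p == pid) = (p == pid).
Proof. by move=> Uc; rewrite -{1}(pact_pid Uc) (inj_eq (pact_inj Uc)). Qed.

Lemma cliffordM U V : clifford U -> clifford V -> clifford (U *m V).
Proof.
move=> [Uu Ug] [Vu Vg]; split=> [|P Pg]; first exact: mul_unitarymx.
by rewrite conjopM; apply/Ug/Vg.
Qed.

Lemma clifford1 : clifford (1%:M : op R {ffun J -> bool}).
Proof.
split=> [|P Pg]; last by rewrite conjop1l.
by apply/unitarymxP; rewrite adj1 mulmx1.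
Qed.

(** The definition only says that Pauli operators go to Pauli operators. The induced map on labels
    is injective on a finite set, hence onto, so every string is, up to phase, the image of a
    string. *)
Lemma clifford_adj U : clifford U -> clifford (U^t*).
Proof.
move=> Uc; have [Uu Ug] := Uc; split=> [|P]; first by rewrite trmxC_unitary.
move=> /pauli_groupP[k [p ->]]; rewrite conjopZ; apply: pauli_groupZ.
have [q <-] : exists q, pact U q = p.
  by have [g _ gK] := injF_bij (pact_inj Uc); exists (g p).
have [l e] := pactP q Uc.
have -> : pauli (pact U q) = ('i ^+ l)^* *: conjop U (pauli q).
  by rewrite e scalerA mulrC expCi_conj scale1r.
have -> : ('i ^+ l)^* = 'i ^+ (3 * l) :> C.
  by rewrite rmorphXn /= conjCi exprM exprS sqrCi mulrN1.
by rewrite conjopZ conjopK //; apply: pauli_groupE.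
Qed.

Lemma clifford_phase U a : a * a^* = 1 -> clifford U -> clifford (a *: U).
Proof.
move=> a1 [Uu Ug]; split=> [|P Pg]; last by rewrite conjop_phase //; apply: Ug.
apply/unitarymxP; rewrite adjZ -scalemxAl -scalemxAr scalerA a1 scale1r.
exact/unitarymxP.
Qed.

Lemma scliffordM U V : sclifford U -> sclifford V -> sclifford (U *m V).
Proof.
move=> [Uc Ud] [Vc Vd]; split; first exact: cliffordM.
by rewrite det_mulmx Ud Vd mulr1.
Qed.

Lemma sclifford1 : sclifford (1%:M : op R {ffun J -> bool}).
Proof. by split; [apply: clifford1 | rewrite det1]. Qed.

Lemma sclifford_adj U : sclifford U -> sclifford (U^t*).
Proof.
move=> [Uc Ud]; split; first exact: clifford_adj.
by rewrite det_map_mx det_tr Ud rmorph1.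
Qed.

Lemma sclifford_conjop U : clifford U ->
  exists2 V, sclifford V & forall X, conjop V X = conjop U X.
Proof.
move=> Uc; have [Uu _] := Uc; have [a [a1 ad]] := unit_phase Uu.
exists (a *: U); first by split; [apply: clifford_phase | apply: ad].
by move=> X; apply: conjop_phase.
Qed.

Lemma conjop_pauli r p : conjop (pauli r) (pauli p) = (-1) ^+ psympl r p *: pauli p.
Proof.
rewrite /conjop pauli_herm pauli_comm -scalemxAl -mulmxA pauli_sqr.
by rewrite mulmx1.
Qed.

Lemma pauli_clifford r : clifford (pauli r).
Proof.
split=> [|P /pauli_groupP[k [p ->]]]; first exact: pauli_unitary.
rewrite conjopZ conjop_pauli; apply: pauli_groupZ.
by rewrite -signr_odd; case: odd; rewrite ?expr0 ?expr1 ?scale1r ?scaleN1r;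
  [apply: pauli_groupN|]; apply: pauli_group_pauli.
Qed.

(** For anticommuting strings this generalizes the Hadamard gate [(X + Z) / sqrt 2]: a Clifford
    involution exchanging the two. *)
Definition pauli_swap p q := (sqrtC 2)^-1 *: (pauli p + pauli q).

Lemma psympl_sym p q : psympl p q = psympl q p.
Proof.
by apply: eq_bigr => j _; case: (p j) (q j) => [[] []] [[] []].
Qed.

Section Swap.
Variables p q : label.
Hypothesis pq : odd (psympl p q).

Let qpE : pauli q *m pauli p = - (pauli p *m pauli q).
Proof. by rewrite pauli_comm psympl_sym -signr_odd pq expr1 scaleN1r. Qed.

Let conj_swap X : conjop (pauli_swap p q) X =
  2^-1 *: ((pauli p + pauli q) *m X *m (pauli p + pauli q)).
Proof.
have h : (sqrtC 2)^-1 * ((sqrtC 2)^-1)^* = 2^-1 :> C.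
  have -> : ((sqrtC 2)^-1)^* = (sqrtC 2)^-1 :> C.
    by apply/CrealP; rewrite rpredV ger0_real // sqrtC_ge0.
  by rewrite -invfM -expr2 sqrtCK.
by rewrite /conjop /pauli_swap adjZ adjD !pauli_herm -!scalemxAl -scalemxAr scalerA h.
Qed.

Let half2 X : 2^-1 *: (X *+ 2) = X.
Proof. by rewrite -[X *+ 2]scaler_nat scalerA mulVf ?scale1r // pnatr_eq0. Qed.

Lemma pauli_swapE : conjop (pauli_swap p q) (pauli p) = pauli q.
Proof.
rewrite conj_swap.
have -> : (pauli p + pauli q) *m pauli p *m (pauli p + pauli q) = pauli q *+ 2.
  exact: (anticomm_swap (pauli_sqr R p) (pauli_sqr R q) qpE).
exact: half2.
Qed.

Let swap_sqr X : X *m (pauli p + pauli q) *m (pauli p + pauli q) = X *+ 2.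
Proof.
have UU : (pauli p + pauli q) *m (pauli p + pauli q) = 1%:M *+ 2.
  exact: (anticomm_sqr (pauli_sqr R p) (pauli_sqr R q) qpE).
by rewrite -mulmxA UU mulr2n mulmxDr mulmx1.
Qed.

Let swap_diff X : X *m (pauli p - pauli q) *m (pauli p + pauli q) =
  (X *m (pauli p *m pauli q)) *+ 2.
Proof.
have UD : (pauli p - pauli q) *m (pauli p + pauli q) = (pauli p *m pauli q) *+ 2.
  exact: (anticomm_diff (pauli_sqr R p) (pauli_sqr R q) qpE).
by rewrite -mulmxA UD mulr2n mulmxDr.
Qed.

(** A string [r] commuting with both [p] and [q], or anticommuting with both, is fixed up to sign;
    otherwise it goes to the product of [r], [p] and [q], up to sign. *)
Lemma pauli_swap_clifford : clifford (pauli_swap p q).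
Proof.
split.
  apply/unitarymxP; have := conj_swap 1%:M; rewrite /conjop mulmx1 => ->.
  by rewrite -[_ *m (_ + _)]mul1mx mulmxA mulmxA mulmx1 swap_sqr half2.
move=> P /pauli_groupP[k [r ->]]; rewrite conjopZ; apply: pauli_groupZ.
rewrite conj_swap mulmxDl !(pauli_comm _ _ r).
rewrite -(signr_odd _ (psympl p r)) -(signr_odd _ (psympl q r)).
have gr := pauli_group_pauli r.
have grpq : pauli_group (pauli r *m (pauli p *m pauli q)).
  by do 2!apply: pauli_groupM => //; apply: pauli_group_pauli.
case: (odd (psympl p r)); case: (odd (psympl q r));
  rewrite ?expr0 ?expr1 ?scale1r ?scaleN1r.
- by rewrite -opprD -mulmxDr mulNmx swap_sqr scalerN half2; apply: pauli_groupN.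
- rewrite -[pauli r *m pauli q]opprK -opprD -mulmxBr mulNmx swap_diff scalerN half2.
  exact: pauli_groupN.
- by rewrite -mulmxBr swap_diff half2.
- by rewrite -mulmxDr swap_sqr half2.
Qed.

End Swap.

Lemma psympl_single p q u :
  (forall j, j != u -> ~~ pauli_sympl (p j) (q j)) -> psympl p q = pauli_sympl (p u) (q u).
Proof.
move=> z; rewrite /psympl (bigD1 u) //= big1 ?addn0 // => j ju.
by rewrite (negPf (z j ju)).
Qed.

(** On a site where both are nontrivial, some Pauli matrix anticommutes with both local factors;
    failing that, one factor is placed on a site of each string, where the other string is
    trivial. *)
Lemma anticommuting_pauli p q : p != pid -> q != pid ->
  exists r, odd (psympl p r) /\ odd (psympl r q).
Proof.
have s0 b : pauli_sympl b (false, false) = false by case: b => [[] []].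
have s0' b : pauli_sympl (false, false) b = false by case: b => [[] []].
have both b c : b != (false, false) -> c != (false, false) ->
    exists w, pauli_sympl b w /\ pauli_sympl w c.
  case: b c => [[] []] [[] []] // _ _;
    first [by exists (true, true) | by exists (true, false) | by exists (false, true)].
have one u : p u != (false, false) -> q u != (false, false) ->
    exists r, odd (psympl p r) /\ odd (psympl r q).
  move=> pu qu; have [w [h1 h2]] := both _ _ pu qu.
  exists [ffun j => if j == u then w else (false, false)].
  by split; rewrite (@psympl_single _ _ u) ?ffunE ?eqxx ?h1 ?h2 // => j /negPf ju;
    rewrite ffunE ju ?s0 ?s0'.
move=> /ffun_neq[u]; rewrite ffunE => pu /ffun_neq[v]; rewrite ffunE => qv.
have [qu|qu] := eqVneq (q u) (false, false); last exact: (one u).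
have [pv|pv] := eqVneq (p v) (false, false); last exact: (one v).
have uv : (u == v) = false by apply/eqP => uv; move: pu; rewrite uv pv.
have [w [hw _]] := both _ _ pu pu; have [z [_ hz]] := both _ _ qv qv.
exists [ffun j => if j == u then w else if j == v then z else (false, false)].
split.
  rewrite (@psympl_single _ _ u) ?ffunE ?eqxx ?hw // => j /negPf ju.
  by rewrite ffunE ju; case: eqP => [->|_]; rewrite ?pv ?s0 ?s0'.
rewrite (@psympl_single _ _ v) ?ffunE ?eqxx 1?eq_sym ?uv ?hz // => j /negPf jv.
by rewrite ffunE jv; case: eqP => [->|_]; rewrite ?qu ?s0 ?s0'.
Qed.

(** By bilinearity of the symplectic form it suffices to anticommute with the product of the two
    strings, which is nontrivial. *)
Lemma pauli_sign p q : p != q -> exists r, odd (psympl r p + psympl r q).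
Proof.
move=> pq.
have ne : padd p q != pid.
  apply: contraNneq pq => /ffunP e; apply/eqP/ffunP => j; have := e j.
  by rewrite !ffunE; case: (p j) (q j) => [[] []] [[] []].
have [r [_ h]] := anticommuting_pauli ne ne; exists r; move: h.
rewrite /psympl -big_split /= !(big_morph odd oddD (erefl _)).
rewrite (eq_bigr (fun j => odd (pauli_sympl (r j) (p j) + pauli_sympl (r j) (q j)))) //.
move=> j _; by rewrite ffunE; case: (r j) (p j) (q j) => [[] []] [[] []] [[] []].
Qed.

(** [p] and [q] may commute, while [pauli_swap] exchanges anticommuting strings; hence the detour
    through an [r] anticommuting with both. *)
Lemma clifford_transitive p q : p != pid -> q != pid ->
  exists2 V, sclifford V & pact V p = q.
Proof.
move=> p0 q0; have [r [pr rq]] := anticommuting_pauli p0 q0.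
pose U := pauli_swap r q *m pauli_swap p r.
have Uc : clifford U by apply: cliffordM; apply: pauli_swap_clifford.
have [V Vs VU] := sclifford_conjop Uc; exists V => //.
apply: (@pact_eq _ _ _ 1); first by case: Vs.
by rewrite VU conjopM !pauli_swapE // scale1r.
Qed.

Lemma pact_comp U V p : clifford U -> clifford V -> pact (U *m V) p = pact U (pact V p).
Proof.
move=> Uc Vc; have [k e] := pactP p Vc; have [l e'] := pactP (pact V p) Uc.
by apply: pact_eq (cliffordM Uc Vc) _; rewrite conjopM e conjopZ e' scalerA.
Qed.

End Clifford.

Lemma dffun_ext (L : finType) (T : L -> Type) (f g : {dffun forall i, T i}) :
  (forall i, f i = g i) -> f = g.
Proof. by move=> e; apply/(@ffunP L T f g). Qed.

(** * Layers of gates *)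

Section Blocks.
Variables (L D : finType) (l r : D -> L).
Hypotheses (l_inj : injective l) (r_inj : injective r) (lr : forall d e, l d != r e).

Definition uncovered (i : L) : bool := [forall d, (i != l d) && (i != r d)].

Lemma big_blocks (S : comPzSemiRingType) (h : L -> S) :
  \prod_i h i = (\prod_d (h (l d) * h (r d))) * \prod_(i | uncovered i) h i.
Proof.
rewrite (bigID uncovered) /= mulrC; congr (_ * _); rewrite big_split /=.
have -> : \prod_d h (l d) = \prod_(i in l @: [set: D]) h i.
  by rewrite big_imset /=; [apply: eq_bigl => d; rewrite inE | move=> d e _ _ /l_inj].
have -> : \prod_d h (r d) = \prod_(i in r @: [set: D]) h i.
  by rewrite big_imset /=; [apply: eq_bigl => d; rewrite inE | move=> d e _ _ /r_inj].
rewrite -bigU /=; last first.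
  apply/pred0P => i /=; apply/negP => /andP[].
  by move=> /imsetP[d _ ->] /imsetP[e _ /eqP]; rewrite (negPf (lr d e)).
apply: eq_bigl => i; rewrite inE negb_forall; apply/existsP/orP.
  move=> [d]; rewrite negb_and !negbK => /orP[]/eqP->; [left | right]; exact: imset_f.
by case=> /imsetP[d _ ->]; exists d; rewrite eqxx ?andbF.
Qed.

Definition glue (X : Type) (f g : D -> X) (h : L -> X) (i : L) : X :=
  if [pick d | l d == i] is Some d then f d
  else if [pick d | r d == i] is Some d then g d else h i.

Lemma glue_l X (f g : D -> X) h d : glue f g h (l d) = f d.
Proof.
rewrite /glue; case: pickP => [e /eqP/l_inj-> //|/(_ d)].
by rewrite eqxx.
Qed.

Lemma glue_r X (f g : D -> X) h d : glue f g h (r d) = g d.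
Proof.
rewrite /glue; case: pickP => [e|_]; first by rewrite (negPf (lr e d)).
by case: pickP => [e /eqP/r_inj-> //|/(_ d)]; rewrite eqxx.
Qed.

Lemma glue_unc X (f g : D -> X) h i : uncovered i -> glue f g h i = h i.
Proof.
move=> /forallP u; rewrite /glue; case: pickP => [e /eqP e1|_].
  by have := u e; rewrite e1 eqxx.
by case: pickP => [e /eqP e1|//]; have := u e; rewrite e1 eqxx andbF.
Qed.

Lemma block_cases (i : L) : [\/ exists d, i = l d, exists d, i = r d | uncovered i].
Proof.
have [u|] := boolP (uncovered i); first exact: Or33.
rewrite negb_forall => /existsP[d]; rewrite negb_and !negbK.
by move=> /orP[]/eqP->; [apply: Or31 | apply: Or32]; exists d.
Qed.

(** A factor [F d x y] couples two regions and so is not a product over regions. Summing over a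
    guess [a] of the left value, enforced by an indicator, turns it into one. *)
Lemma sum_blocks (S : comPzSemiRingType) (X : finType) (F : D -> X -> X -> S)
    (G : L -> X -> S) :
  \sum_(s : {dffun forall _ : L, X})
    ((\prod_d F d (s (l d)) (s (r d))) * \prod_(i | uncovered i) G i (s i)) =
  (\prod_d \sum_x \sum_y F d x y) * \prod_(i | uncovered i) \sum_x G i x.
Proof.
pose h (f : {ffun D -> X}) :=
  glue (fun d x => (x == f d)%:R) (fun d x => F d (f d) x) G.
have one d (x y : X) : F d x y = \sum_a (x == a)%:R * F d a y.
  rewrite (bigD1 x) //= eqxx mul1r big1 ?addr0 // => a /negPf ax.
  by rewrite eq_sym ax mul0r.
transitivity (\sum_(s : {dffun forall _ : L, X}) \sum_(f : {ffun D -> X})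
    \prod_i h f i (s i)).
  apply: eq_bigr => s _; under eq_bigr do rewrite one.
  rewrite bigA_distr_bigA /= mulr_suml; apply: eq_bigr => f _.
  rewrite big_blocks; congr (_ * _).
    by apply: eq_bigr => d _; rewrite /h glue_l glue_r.
  by apply: eq_bigr => i ui; rewrite /h glue_unc.
rewrite exchange_big /= bigA_distr_bigA mulr_suml; apply: eq_bigr => f _ /=.
rewrite (big_dffun_distr (fun i => h f i)) big_blocks; congr (_ * _).
  apply: eq_bigr => d _; rewrite /h glue_l glue_r (bigD1 (f d)) //= eqxx.
  rewrite big1 ?addr0 ?mul1r // => x /negPf -> //.
by apply: eq_bigr => i ui; rewrite /h glue_unc.
Qed.

End Blocks.

Section BlockOperators.
Variables (R : realType) (xi : nat) (L D : finType) (l r : D -> L).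
Hypotheses (l_inj : injective l) (r_inj : injective r) (lr : forall d e, l d != r e).
Local Notation C := R[i].
Local Notation unc := (uncovered l r).
Local Notation glue := (glue l r).
Local Notation chain X := {dffun forall _ : L, X}.
Local Notation gate := (op R {ffun 'I_xi + 'I_xi -> bool}).
Local Notation label := {ffun 'I_xi -> bool * bool}.
Local Notation label2 := {ffun 'I_xi + 'I_xi -> bool * bool}.

Definition splitl {T} (f : {ffun 'I_xi + 'I_xi -> T}) : {ffun 'I_xi -> T} :=
  [ffun k => f (inl k)].
Definition splitr {T} (f : {ffun 'I_xi + 'I_xi -> T}) : {ffun 'I_xi -> T} :=
  [ffun k => f (inr k)].
Definition pjoin (p q : label) : label2 :=
  [ffun k => match k with inl a => p a | inr b => q b end].

Lemma pjoinK f : pjoin (splitl f) (splitr f) = f.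
Proof. by apply/ffunP => -[k|k]; rewrite !ffunE. Qed.

Lemma splitl_join p q : splitl (pjoin p q) = p.
Proof. by apply/ffunP => k; rewrite !ffunE. Qed.

Lemma splitr_join p q : splitr (pjoin p q) = q.
Proof. by apply/ffunP => k; rewrite !ffunE. Qed.

Lemma sum_join (S : nmodType) (F : {ffun 'I_xi + 'I_xi -> bool} -> S) :
  \sum_s \sum_t F (join s t) = \sum_f F f.
Proof.
rewrite pair_bigA (reindex (fun p : region xi * region xi => join p.1 p.2)) //=.
exists (fun f => (splitl f, splitr f)) => [[s t] _|f _] /=; last first.
  by apply/ffunP => -[k|k]; rewrite !ffunE.
by congr pair; apply/ffunP => k; rewrite !ffunE.
Qed.

Lemma sum_pjoin (S : nmodType) (F : label2 -> S) :
  \sum_p \sum_q F (pjoin p q) = \sum_f F f.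
Proof.
rewrite pair_bigA (reindex (fun p : label * label => pjoin p.1 p.2)) //=.
exists (fun f => (splitl f, splitr f)) => [[s t] _|f _] /=; last exact: pjoinK.
by rewrite splitl_join splitr_join.
Qed.

Lemma entry_pauli_join p q s s' t t' :
  entry (pauli_string R (pjoin p q)) (join s t) (join s' t') =
  entry (pauli_string R p) s s' * entry (pauli_string R q) t t'.
Proof.
rewrite !entry_pauli big_sumType /=.
by congr (_ * _); apply: eq_bigr => k _; rewrite !ffunE.
Qed.

(** Regions outside all pairs carry arbitrary operators [a i], so that Pauli strings are themselves
    of this form and conjugation reduces to [blockopM]. *)
Definition blockop (u : D -> gate) (a : L -> op R (region xi)) :
    op R (chain (region xi)) :=
  mkop (fun s s' : chain (region xi) =>
    (\prod_d entry (u d) (join (s (l d)) (s (r d))) (join (s' (l d)) (s' (r d)))) *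
    \prod_(i | unc i) entry (a i) (s i) (s' i)).

Lemma blockopM u v a b :
  blockop u a *m blockop v b = blockop (fun d => u d *m v d) (fun i => a i *m b i).
Proof.
apply: op_ext => s s'; rewrite entryM entry_mkop.
pose F d x y := entry (u d) (join (s (l d)) (s (r d))) (join x y) *
  entry (v d) (join x y) (join (s' (l d)) (s' (r d))).
pose G i x := entry (a i) (s i) x * entry (b i) x (s' i).
transitivity (\sum_(t : chain (region xi))
    ((\prod_d F d (t (l d)) (t (r d))) * \prod_(i | unc i) G i (t i))).
  by apply: eq_bigr => t _; rewrite !entry_mkop !big_split /= mulrACA.
rewrite (sum_blocks l_inj r_inj lr); congr (_ * _).
  by apply: eq_bigr => d _; rewrite entryM -sum_join.
by apply: eq_bigr => i _; rewrite entryM.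
Qed.

Lemma adj_blockop u a :
  (blockop u a)^t* = blockop (fun d => (u d)^t*) (fun i => (a i)^t*).
Proof.
apply: op_ext => s s'; rewrite entry_adj !entry_mkop rmorphM !rmorph_prod.
by congr (_ * _); apply: eq_bigr => i _; rewrite entry_adj.
Qed.

Definition lpauli (P : chain label) : op R (chain (region xi)) :=
  mkop (fun s s' : chain (region xi) =>
    \prod_i entry (pauli_string R (P i)) (s i) (s' i)).

Lemma lpauli_blockop P : lpauli P =
  blockop (fun d => pauli_string R (pjoin (P (l d)) (P (r d))))
          (fun i => pauli_string R (P i)).
Proof.
apply: op_ext => s s'; rewrite !entry_mkop (big_blocks l_inj r_inj lr); congr (_ * _).
by apply: eq_bigr => d _; rewrite entry_pauli_join.
Qed.

Definition blockact (u : D -> gate) (P : chain label) : chain label :=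
  let q d := pact (u d) (pjoin (P (l d)) (P (r d))) in
  [ffun i => glue (splitl \o q) (splitr \o q) P i].

Lemma blockact_join u P d :
  pjoin (blockact u P (l d)) (blockact u P (r d)) =
  pact (u d) (pjoin (P (l d)) (P (r d))).
Proof. by rewrite !ffunE glue_l // glue_r //= pjoinK. Qed.

Lemma blockact_unc u P i : unc i -> blockact u P i = P i.
Proof. by move=> ui; rewrite ffunE glue_unc. Qed.

Lemma conjop_blockop u P : (forall d, clifford (u d)) ->
  exists2 c : C, c * c^* = 1 &
    conjop (blockop u (fun=> 1%:M)) (lpauli P) = c *: lpauli (blockact u P).
Proof.
move=> uc.
have /choice[k kP] d : exists k, conjop (u d) (pauli_string R (pjoin (P (l d)) (P (r d)))) =
    'i ^+ k *: pauli_string R (pjoin (blockact u P (l d)) (blockact u P (r d))).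
  by rewrite blockact_join; apply: pactP.
exists (\prod_d 'i ^+ k d).
  by rewrite rmorph_prod -big_split /= big1 // => d _; apply: expCi_conj.
rewrite /conjop adj_blockop (lpauli_blockop P) !blockopM (lpauli_blockop (blockact u P)).
apply: op_ext => s s'; rewrite entryZ !entry_mkop mulrA -big_split /=; congr (_ * _).
  by apply: eq_bigr => d _; rewrite -entryZ -kP.
by apply: eq_bigr => i ui; rewrite mul1mx adj1 mulmx1 blockact_unc.
Qed.

Lemma blockact_ext (P Q : chain label) :
  (forall d, pjoin (P (l d)) (P (r d)) = pjoin (Q (l d)) (Q (r d))) ->
  (forall i, unc i -> P i = Q i) -> P = Q.
Proof.
move=> h1 h2; apply: (@dffun_ext _ (fun=> label)) => i; case: (block_cases l r i) => [[d ->]|[d ->]|/h2 //].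
  by rewrite -(splitl_join (P (l d)) (P (r d))) h1 splitl_join.
by rewrite -(splitr_join (P (l d)) (P (r d))) h1 splitr_join.
Qed.

Lemma blockact_comp u v P : (forall d, clifford (u d)) -> (forall d, clifford (v d)) ->
  blockact (fun d => u d *m v d) P = blockact u (blockact v P).
Proof.
move=> uc vc; apply: blockact_ext => [d|i ui]; last by rewrite !blockact_unc.
by rewrite !blockact_join pact_comp.
Qed.

Lemma blockact_inj u : (forall d, clifford (u d)) -> injective (blockact u).
Proof.
move=> uc P Q e; apply: blockact_ext => [d|i ui].
  by apply: (pact_inj (uc d)); rewrite -!blockact_join e.
by rewrite -(blockact_unc u P ui) e blockact_unc.
Qed.

Definition bid : label2 := pid ('I_xi + 'I_xi)%type.

Definition gate_kernel (f g : label2) : R :=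
  if f == bid then (g == bid)%:R else (g != bid)%:R / (#|label2|.-1)%:R.

Definition kernel (P Q : chain label) : R :=
  (\prod_d gate_kernel (pjoin (P (l d)) (P (r d))) (pjoin (Q (l d)) (Q (r d)))) *
  \prod_(i | unc i) (P i == Q i)%:R.

Lemma sum_gate_kernel (G : label2 -> R) f : \sum_g gate_kernel f g * G g =
  if f == bid then G bid else (\sum_(g | g != bid) G g) / (#|label2|.-1)%:R.
Proof.
rewrite /gate_kernel; case: eqP => _.
  rewrite (bigD1 bid) //= eqxx mul1r big1 ?addr0 // => g /negPf->.
  by rewrite mul0r.
rewrite (bigD1 bid) //= eqxx !mul0r add0r mulr_suml; apply: eq_bigr => g ->.
by rewrite mul1r mulrC.
Qed.

Lemma card_label2_gt1 : (0 < xi)%N -> (0 < #|label2|.-1)%N.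
Proof.
move=> x0; rewrite card_ffun card_prod !card_bool card_sum !card_ord -subn1 subn_gt0.
by apply: (@leq_ltn_trans (xi + xi)); rewrite ?addn_gt0 ?x0 // ltn_expl.
Qed.

Lemma sum_kernel P (F : D -> label -> label -> R) (G : L -> label -> R) :
  \sum_(Q : chain label) kernel P Q *
    ((\prod_d F d (Q (l d)) (Q (r d))) * \prod_(i | unc i) G i (Q i)) =
  (\prod_d \sum_g gate_kernel (pjoin (P (l d)) (P (r d))) g * F d (splitl g) (splitr g)) *
  \prod_(i | unc i) G i (P i).
Proof.
pose F' d x y := gate_kernel (pjoin (P (l d)) (P (r d))) (pjoin x y) * F d x y.
pose G' i x := (P i == x)%:R * G i x.
transitivity (\sum_(Q : chain label)
    ((\prod_d F' d (Q (l d)) (Q (r d))) * \prod_(i | unc i) G' i (Q i))).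
  by apply: eq_bigr => Q _; rewrite /kernel !big_split /= mulrACA.
rewrite (sum_blocks l_inj r_inj lr); congr (_ * _).
  apply: eq_bigr => d _; rewrite -sum_pjoin.
  by apply: eq_bigr => p _; apply: eq_bigr => q _; rewrite splitl_join splitr_join.
apply: eq_bigr => i _; rewrite (bigD1 (P i)) //= /G' eqxx mul1r big1 ?addr0 // => x.
by rewrite eq_sym => /negPf->; rewrite mul0r.
Qed.

Lemma sum_kernel1 P : (0 < xi)%N -> \sum_Q kernel P Q = 1.
Proof.
move=> x0; transitivity (\sum_(Q : chain label) kernel P Q *
    ((\prod_(d : D) 1) * \prod_(i | unc i) 1)).
  by apply: eq_bigr => Q _; rewrite !big1_eq !mulr1.
rewrite (sum_kernel P (fun=> fun=> fun=> 1) (fun=> fun=> 1)) big1_eq mulr1.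
apply: big1 => d _; rewrite sum_gate_kernel; case: eqP => // _.
rewrite (eq_bigl (mem [set~ bid])) => [|g]; last by rewrite !inE.
by rewrite sumr_const cardsC1 divff // pnatr_eq0 -lt0n card_label2_gt1.
Qed.

(** Clifford gates fix the identity label and permute the others, and the kernel only sees which
    blocks are trivial. *)
Lemma kernel_act u P Q : (forall d, clifford (u d)) ->
  kernel P (blockact u Q) = kernel P Q.
Proof.
move=> uc; rewrite /kernel; congr (_ * _).
  by apply: eq_bigr => d _; rewrite blockact_join /gate_kernel pact_neq_pid.
by apply: eq_bigr => i ui; rewrite blockact_unc.
Qed.

(** Strings joined by the kernel lie in one orbit of the gates; this is what lets an average over
    gates be traded for the kernel. *)
Lemma kernel_transitive P Q : kernel P Q != 0 ->
  exists2 v : D -> gate, (forall d, sclifford (v d)) & blockact v P = Q.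
Proof.
rewrite /kernel mulf_eq0 negb_or => /andP[/prodf_neq0 h1 /prodf_neq0 h2].
have /choice[v vP] d : exists V : gate, sclifford V /\
    pact V (pjoin (P (l d)) (P (r d))) = pjoin (Q (l d)) (Q (r d)).
  have := h1 d isT; rewrite /gate_kernel.
  move: (pjoin (P (l d)) (P (r d))) (pjoin (Q (l d)) (Q (r d))) => p q.
  have [->|p0] := eqVneq p bid; have [->|q0] := eqVneq q bid; rewrite ?mul0r ?eqxx // => _.
    by exists 1%:M; split; [apply: sclifford1 | apply/pact_pid/clifford1].
  by have [V Vs VE] := clifford_transitive R p0 q0; exists V.
exists v => [d|]; first by case: (vP d).
apply: blockact_ext => [d|i ui]; first by rewrite blockact_join; case: (vP d).
by rewrite blockact_unc //; have := h2 i ui; case: (eqVneq (P i) (Q i)) => //; rewrite eqxx.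
Qed.

End BlockOperators.

(** * Averages over the Clifford gates *)

Section Mean.
Variables (R : realType) (T : choiceType) (A : set T).
Implicit Types f g : T -> R.

(** [fset_set] of an infinite set is empty, and division by 0 gives 0. *)
Lemma unif_mean_infinite f : ~ finite_set A -> unif_mean A f = 0.
Proof.
move=> Ai; rewrite /unif_mean /fset_set; case: pselect => // _.
by rewrite cardfs0 invr0 mulr0.
Qed.

Hypotheses (Af : finite_set A) (A0 : exists x, A x).

Lemma unif_meanE f :
  unif_mean A f = (\sum_(x <- fset_set A) f x) / #|` fset_set A|%:R.
Proof. by rewrite /unif_mean fsbig_finite. Qed.

Lemma card_fset_set_gt0 : (0 : R) < #|` fset_set A|%:R.
Proof.
rewrite ltr0n cardfs_gt0; apply/fset0Pn; case: A0 => x Ax.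
by exists x; rewrite in_fset_set //; apply/mem_set.
Qed.

Lemma unif_mean_const (c : R) : unif_mean A (fun=> c) = c.
Proof.
rewrite unif_meanE big_const_seq count_predT iter_addr addr0 -[c *+ _]mulr_natr mulfK //.
by rewrite gt_eqF // card_fset_set_gt0.
Qed.

Lemma eq_unif_mean f g : (forall x, A x -> f x = g x) -> unif_mean A f = unif_mean A g.
Proof.
move=> fg; rewrite !unif_meanE; congr (_ / _); rewrite !big_seq.
by apply: eq_bigr => x; rewrite in_fset_set // => /set_mem/fg.
Qed.

Lemma unif_mean_sum (I : Type) (s : seq I) (P : pred I) (F : I -> T -> R) :
  unif_mean A (fun x => \sum_(i <- s | P i) F i x) = \sum_(i <- s | P i) unif_mean A (F i).
Proof.
rewrite unif_meanE exchange_big mulr_suml; apply: eq_bigr => i _.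
by rewrite unif_meanE.
Qed.

Lemma unif_meanD f g : unif_mean A (fun x => f x + g x) = unif_mean A f + unif_mean A g.
Proof. by rewrite !unif_meanE big_split mulrDl. Qed.

Lemma unif_meanZ c f : unif_mean A (fun x => c * f x) = c * unif_mean A f.
Proof. by rewrite !unif_meanE -mulr_sumr mulrA. Qed.

Lemma unif_meanN f : unif_mean A (fun x => - f x) = - unif_mean A f.
Proof. by rewrite -mulN1r -unif_meanZ; apply: eq_unif_mean => x _; rewrite mulN1r. Qed.

Lemma le_unif_mean f g : (forall x, A x -> f x <= g x) -> unif_mean A f <= unif_mean A g.
Proof.
move=> fg; rewrite !unif_meanE ler_wpM2r ?invr_ge0 // !big_seq.
by apply: ler_sum => x; rewrite in_fset_set // => /set_mem/fg.
Qed.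

(** The difference is the variance. *)
Lemma unif_mean_sqr f : unif_mean A f ^+ 2 <= unif_mean A (fun x => f x ^+ 2).
Proof.
rewrite -subr_ge0; set m := unif_mean A f.
have -> : unif_mean A (fun x => f x ^+ 2) - m ^+ 2 = unif_mean A (fun x => (f x - m) ^+ 2).
  transitivity (unif_mean A (fun x => f x ^+ 2 + ((- 2 * m) * f x + m ^+ 2))).
    by rewrite unif_meanD unif_meanD unif_meanZ unif_mean_const -/m; ring.
  by apply: eq_unif_mean => x _; ring.
rewrite -[leLHS](unif_mean_const 0); apply: le_unif_mean => x _; exact: sqr_ge0.
Qed.

Lemma unif_mean_bij (h k : T -> T) f :
  (forall x, A x -> A (h x)) -> (forall x, A x -> A (k x)) ->
  (forall x, A x -> k (h x) = x) -> (forall x, A x -> h (k x) = x) ->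
  unif_mean A (f \o h) = unif_mean A f.
Proof.
move=> hA kA hk kh; rewrite /unif_mean; congr (_ / _).
rewrite [RHS](@reindex_fsbig _ _ _ _ _ h A) //; split=> [x|x y|y] //=.
- by move=> /hA.
- by move=> /set_mem Ax /set_mem Ay e; rewrite -(hk x) // e hk.
- by move=> Ay; exists (k y); [apply: kA | apply: kh].
Qed.

End Mean.

Section Ensemble.
Variables (R : realType) (N xi : nat).
Hypothesis xi_gt0 : (0 < xi)%N.
Local Notation C := R[i].
Local Notation L := 'I_(2 * N).
Local Notation gate := (op R {ffun 'I_xi + 'I_xi -> bool}).
Local Notation label := {ffun 'I_xi -> bool * bool}.
Local Notation chain := {dffun forall _ : L, label}.
Local Notation Omega := (@clifford_gates R N xi).
Local Notation mean := (unif_mean Omega).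
Implicit Types (u v w : gates R N xi) (P Q : chain).

Definition gmul u v : gates R N xi := [ffun j => u j *m v j].

Lemma clifford_gatesM u v : Omega u -> Omega v -> Omega (gmul u v).
Proof. by move=> uO vO j; rewrite ffunE; apply: scliffordM. Qed.

Lemma clifford_gates_neq0 : exists u, Omega u.
Proof. by exists [ffun=> 1%:M] => j; rewrite ffunE; apply: sclifford1. Qed.

Lemma sclifford_unitary (J : finType) (U : op R {ffun J -> bool}) :
  sclifford U -> U *m U^t* = 1%:M.
Proof. by case=> -[/unitarymxP]. Qed.

Lemma mean_gmul v (f : gates R N xi -> R) : Omega v -> mean (fun u => f (gmul u v)) = mean f.
Proof.
move=> vO; pose k u := gmul u [ffun j => (v j)^t*].
apply: (@unif_mean_bij _ _ _ (fun u => gmul u v) k f) => u uO.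
- exact: clifford_gatesM.
- by apply: clifford_gatesM => // j; rewrite ffunE; apply: sclifford_adj.
- by apply/ffunP => j; rewrite !ffunE -mulmxA (sclifford_unitary (vO j)) mulmx1.
- by apply/ffunP => j; rewrite !ffunE -mulmxA (mulmx1C (sclifford_unitary (vO j))) mulmx1.
Qed.

Section Layer.
Variables (D : finType) (e : D -> 'I_(2 * N).-1) (J : pred 'I_(2 * N).-1).
Hypotheses (e_inj : injective e) (eJ : forall j, reflect (exists d, j = e d) (J j)).
Let l d := lreg (e d).
Let r d := rreg (e d).
Hypothesis lr : forall d d', l d != r d'.

Lemma lreg_inj : injective (@lreg (2 * N)).
Proof. by move=> i j /(congr1 val) /= h; apply: val_inj. Qed.

Lemma rreg_inj : injective (@rreg (2 * N)).
Proof. by move=> i j /(congr1 val) /= [h]; apply: val_inj. Qed.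

Lemma layer_l_inj : injective l. Proof. by move=> d d' /lreg_inj/e_inj. Qed.
Lemma layer_r_inj : injective r. Proof. by move=> d d' /rreg_inj/e_inj. Qed.

Lemma layerE u : layer J u = blockop l r (fun d => u (e d)) (fun=> 1%:M).
Proof.
apply: op_ext => s s'; rewrite !entry_mkop; congr (_ * _).
  pose G j := entry (u j) (join (s (lreg j)) (s (rreg j)))
    (join (s' (lreg j)) (s' (rreg j))).
  transitivity (\prod_(j in e @: [set: D]) G j).
    apply: eq_bigl => j; apply/eJ/imsetP => [[d ->]|[d _ ->]]; last by exists d.
    by exists d => //; rewrite finset.in_setT.
  by rewrite big_imset /=; [apply: eq_bigl => d; rewrite inE | move=> d d' _ _ /e_inj].
apply: eq_big => [i|i _]; last by rewrite entry1.
apply/forallP/forallP => [h d|h j]; last by apply/implyP => /eJ[d ->]; apply: h.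
by apply: (implyP (h (e d))); apply/eJ; exists d.
Qed.

Definition extend_gates (v : D -> gate) : gates R N xi :=
  [ffun j => if [pick d | e d == j] is Some d then v d else 1%:M].

Lemma extend_gatesE (v : D -> gate) d : extend_gates v (e d) = v d.
Proof.
by rewrite ffunE; case: pickP => [d' /eqP/e_inj-> //|/(_ d)]; rewrite eqxx.
Qed.

Lemma extend_gates_out (v : D -> gate) j : ~~ J j -> extend_gates v j = 1%:M.
Proof.
move=> Jj; rewrite ffunE; case: pickP => // d /eqP ej; case/negP: Jj.
by apply/eJ; exists d.
Qed.

Lemma extend_gates_clifford (v : D -> gate) :
  (forall d, sclifford (v d)) -> Omega (extend_gates v).
Proof.
move=> vs j; rewrite ffunE; case: pickP => // _; exact: sclifford1.
Qed.

Definition gateact u P : chain := blockact l r (fun d => u (e d)) P.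
Local Notation K := (kernel R l r).

Lemma gateactM u v P : Omega u -> Omega v -> gateact (gmul u v) P = gateact u (gateact v P).
Proof.
move=> uO vO.
have uc d : clifford (u (e d)) by case: (uO (e d)).
have vc d : clifford (v (e d)) by case: (vO (e d)).
have E : (fun d => gmul u v (e d)) = (fun d => u (e d) *m v (e d)).
  by apply/funext => d; rewrite ffunE.
by rewrite /gateact E (blockact_comp layer_l_inj layer_r_inj lr P uc vc).
Qed.

Hypothesis Omega_fin : finite_set Omega.

(* Averaging over the gates [e d] only replaces the permuted string by a string
   drawn uniformly among those with the same trivial blocks. *)
Lemma mean_layer (Psi : gates R N xi -> chain -> R) P :
  (forall u v Q, Omega u -> Omega v -> (forall j, ~~ J j -> v j = 1%:M) ->
    Psi (gmul u v) Q = Psi u Q) ->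
  mean (fun u => Psi u (gateact u P)) = \sum_Q K P Q * mean (fun u => Psi u Q).
Proof.
move=> inv; have lI := layer_l_inj; have rI := layer_r_inj.
rewrite -[LHS]mul1r -(sum_kernel1 R lI rI lr P xi_gt0) mulr_suml.
(* [P] may be replaced by any [Q] that the kernel charges: right translation by the gates relating
   the two preserves the mean and does not affect [Psi]. *)
transitivity (\sum_Q K P Q * mean (fun u => Psi u (gateact u Q))).
  apply: eq_bigr => Q _; have [->|nz] := eqVneq (K P Q) 0; first by rewrite !mul0r.
  congr (_ * _); have [v vs <-] := kernel_transitive lI rI lr nz.
  pose w := extend_gates v; have wO : Omega w by apply: extend_gates_clifford.
  rewrite -(mean_gmul (fun u => Psi u (gateact u P)) wO).
  apply: (eq_unif_mean Omega_fin) => u uO.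
  rewrite (gateactM P uO wO) (inv _ _ _ uO wO); last first.
    by move=> j; apply: extend_gates_out.
  have E : (fun d => w (e d)) = v by apply/funext => d; rewrite /w extend_gatesE.
  by rewrite [gateact w P]/gateact E.
under eq_bigr do rewrite -(unif_meanZ Omega_fin); rewrite -(unif_mean_sum Omega_fin).
under [RHS]eq_bigr do rewrite -(unif_meanZ Omega_fin).
rewrite -(unif_mean_sum Omega_fin); apply: (eq_unif_mean Omega_fin) => u uO.
have uc d : clifford (u (e d)) by case: (uO (e d)).
(* For fixed gates the action permutes the strings and leaves the kernel weights unchanged, so it is
   absorbed by reindexing. *)
rewrite [RHS](reindex_inj (blockact_inj lI rI lr uc)) /=.
by apply: eq_bigr => Q _; rewrite kernel_act.
Qed.

End Layer.

End Ensemble.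

Section GateIndex.
Variable N : nat.

Lemma even_gate_proof (i : 'I_N) : (2 * i < (2 * N).-1)%N.
Proof. by case: i => i /=; lia. Qed.

Lemma odd_gate_proof (i : 'I_N.-1) : ((2 * i).+1 < (2 * N).-1)%N.
Proof. by case: i => i /=; lia. Qed.

Definition even_gate (i : 'I_N) : 'I_(2 * N).-1 := Ordinal (even_gate_proof i).
Definition odd_gate (i : 'I_N.-1) : 'I_(2 * N).-1 := Ordinal (odd_gate_proof i).

Lemma even_gate_inj : injective even_gate.
Proof. by move=> i j /(congr1 val) /= h; apply: val_inj => /=; lia. Qed.

Lemma odd_gate_inj : injective odd_gate.
Proof. by move=> i j /(congr1 val) /= h; apply: val_inj => /=; lia. Qed.

Lemma even_gateP (j : 'I_(2 * N).-1) : reflect (exists d, j = even_gate d) (~~ odd j).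
Proof.
apply: (iffP idP) => [oj|[d ->] /=]; last by lia.
have h : (j./2 < N)%N by case: j oj => j /= jN oj; lia.
by exists (Ordinal h); apply: val_inj => /=; lia.
Qed.

Lemma odd_gateP (j : 'I_(2 * N).-1) : reflect (exists d, j = odd_gate d) (odd j).
Proof.
apply: (iffP idP) => [oj|[d ->] /=]; last by lia.
have h : (j./2 < N.-1)%N by case: j oj => j /= jN oj; lia.
by exists (Ordinal h); apply: val_inj => /=; lia.
Qed.

Lemma even_gate_lr d d' : lreg (even_gate d) != rreg (even_gate d').
Proof. by apply/eqP => /(congr1 val) /=; lia. Qed.

Lemma odd_gate_lr d d' : lreg (odd_gate d) != rreg (odd_gate d').
Proof. by apply/eqP => /(congr1 val) /=; lia. Qed.

End GateIndex.

Section Circuit.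
Variables (R : realType) (N xi : nat).
Hypothesis xi_gt0 : (0 < xi)%N.
Local Notation C := R[i].
Local Notation L := 'I_(2 * N).
Local Notation gate := (op R {ffun 'I_xi + 'I_xi -> bool}).
Local Notation label := {ffun 'I_xi -> bool * bool}.
Local Notation chain := {dffun forall _ : L, label}.
Local Notation Omega := (@clifford_gates R N xi).
Local Notation mean := (unif_mean Omega).
Implicit Types (u v w : gates R N xi) (P Q : chain).

Local Notation l0 := (fun d => lreg (@even_gate N d)).
Local Notation r0 := (fun d => rreg (@even_gate N d)).
Local Notation l1 := (fun d => lreg (@odd_gate N d)).
Local Notation r1 := (fun d => rreg (@odd_gate N d)).
Local Notation act0 := (gateact (@even_gate N)).
Local Notation act1 := (gateact (@odd_gate N)).

Let l0I := layer_l_inj (@even_gate_inj N).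
Let r0I := layer_r_inj (@even_gate_inj N).
Let l1I := layer_l_inj (@odd_gate_inj N).
Let r1I := layer_r_inj (@odd_gate_inj N).

Lemma circuitE u : circuit u =
  blockop l1 r1 (fun d => u (odd_gate d)) (fun=> 1%:M) *m
  blockop l0 r0 (fun d => u (even_gate d)) (fun=> 1%:M).
Proof.
by rewrite /circuit (layerE (@odd_gate_inj N) (@odd_gateP N))
  (layerE (@even_gate_inj N) (@even_gateP N)).
Qed.

Lemma conjop_circuit u P : Omega u -> exists2 c : C, c * c^* = 1 &
  conjop (circuit u) (lpauli R P) = c *: lpauli R (act1 u (act0 u P)).
Proof.
move=> uO; rewrite circuitE conjopM.
have c0 d : clifford (u (even_gate d)) by case: (uO (even_gate d)).
have c1 d : clifford (u (odd_gate d)) by case: (uO (odd_gate d)).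
have [a a1 ->] := conjop_blockop l0I r0I (@even_gate_lr N) P c0.
have [b b1 e] := conjop_blockop l1I r1I (@odd_gate_lr N) (act0 u P) c1.
exists (a * b); last by rewrite conjopZ e scalerA.
by rewrite rmorphM mulrACA a1 b1 mulr1.
Qed.

Lemma gateact_ext (D : finType) (e : D -> 'I_(2 * N).-1) u v P :
  (forall d, u (e d) = v (e d)) -> gateact e u P = gateact e v P.
Proof.
move=> h; have E : (fun d => u (e d)) = (fun d => v (e d)) by apply/funext.
by rewrite /gateact E.
Qed.

(** The action of the second layer does not involve the gates of the first, which is the invariance
    that [mean_layer] asks for. *)
Lemma mean_mixing (Phi : chain -> R) P : finite_set Omega ->
  mean (fun u => Phi (act1 u (act0 u P))) =
  \sum_P' kernel R l0 r0 P P' * \sum_Q kernel R l1 r1 P' Q * Phi Q.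
Proof.
move=> fin.
rewrite (mean_layer xi_gt0 (@even_gate_inj N) (@even_gateP N) (@even_gate_lr N) fin
  (Psi := fun u Q => Phi (act1 u Q))).
  apply: eq_bigr => P' _; congr (_ * _).
  rewrite (mean_layer xi_gt0 (@odd_gate_inj N) (@odd_gateP N) (@odd_gate_lr N) fin
    (Psi := fun u Q => Phi Q)) //.
  apply: eq_bigr => Q _; congr (_ * _).
  by rewrite (unif_mean_const fin) //; apply: clifford_gates_neq0.
move=> u v Q uO vO v1.
have -> // : act1 (gmul u v) Q = act1 u Q.
by apply: gateact_ext => d; rewrite ffunE v1 ?mulmx1 //=; lia.
Qed.

(** A Pauli operator prepended to one first-layer gate flips the sign of exactly one of the two
    conjugates. The first layer covers every region, so distinct strings differ on one of its
    blocks. *)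
Lemma conjop_circuit_sign P Q : P != Q -> exists w, Omega w /\ exists a b : bool,
  odd (a + b) /\ forall u,
    conjop (circuit (gmul u w)) (lpauli R P) = (-1) ^+ a *: conjop (circuit u) (lpauli R P) /\
    conjop (circuit (gmul u w)) (lpauli R Q) = (-1) ^+ b *: conjop (circuit u) (lpauli R Q).
Proof.
move=> PQ.
have [d hd] : exists d, pjoin (P (l0 d)) (P (r0 d)) != pjoin (Q (l0 d)) (Q (r0 d)).
  apply/existsP; rewrite -negb_forall; apply: contraNN PQ => /forallP h; apply/eqP.
  apply: (@blockact_ext xi L 'I_N l0 r0) => [d|i /forallP ui]; first exact/eqP.
  exfalso; have h' : (i./2 < N)%N by case: (i) => k /=; lia.
  have := ui (Ordinal h'); rewrite -!(inj_eq val_inj) /=; lia.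
have [p pO] := pauli_sign hd.
(* Rescaled to determinant 1, so as to belong to [sclifford]. *)
have [V Vs VE] := sclifford_conjop (pauli_clifford R p).
pose w := extend_gates (@even_gate N) (fun d' => if d' == d then V else 1%:M).
exists w; split.
  apply: extend_gates_clifford => d'; case: eqP => // _; exact: sclifford1.
pose s (T : chain) := psympl p (pjoin (T (l0 d)) (T (r0 d))).
have E T u : conjop (circuit (gmul u w)) (lpauli R T) =
    (-1) ^+ odd (s T) *: conjop (circuit u) (lpauli R T).
  rewrite signr_odd.
  have -> : circuit (gmul u w) =
      circuit u *m blockop l0 r0 (fun d => w (even_gate d)) (fun=> 1%:M).
    have E1 : (fun d => gmul u w (odd_gate d)) = (fun d => u (odd_gate d)).
      apply/funext => d'; rewrite ffunE (extend_gates_out (@even_gateP N)) ?mulmx1 //=.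
      by lia.
    have E0 : (fun d => gmul u w (even_gate d)) =
        (fun d => u (even_gate d) *m w (even_gate d)).
      by apply/funext => d'; rewrite ffunE.
    have E2 : (fun _ : L => 1%:M : op R (region xi)) = (fun _ => 1%:M *m 1%:M).
      by apply/funext => i; rewrite mulmx1.
    rewrite !circuitE E1 E0 -mulmxA (blockopM l0I r0I (@even_gate_lr N)).
    by rewrite -E2.
  rewrite conjopM -conjopZ; congr conjop.
  rewrite /conjop (adj_blockop l0 r0) (lpauli_blockop R l0I r0I (@even_gate_lr N) T).
  rewrite !(blockopM l0I r0I (@even_gate_lr N)).
  apply: op_ext => x y; rewrite entryZ !entry_mkop mulrA; congr (_ * _); last first.
    by apply: eq_bigr => i _; rewrite mul1mx adj1 mulmx1.
  rewrite (bigD1 d) //= [in RHS](bigD1 d) //= mulrA; congr (_ * _).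
    rewrite extend_gatesE ?eqxx; last exact: (@even_gate_inj N).
    by rewrite -/(conjop _ _) VE conjop_pauli entryZ.
  apply: eq_bigr => d' /negPf dd; rewrite extend_gatesE ?dd; last exact: (@even_gate_inj N).
  by rewrite mul1mx adj1 mulmx1.
exists (odd (s P)), (odd (s Q)); split=> [|u]; last by split; apply: E.
by move: pO; rewrite !oddD !oddb.
Qed.

(** Right translation by [w] turns the mean into its opposite. Oddness of [B] in each argument
    suffices, which covers both the Hilbert-Schmidt product and the product of traces used later. *)
Lemma mean_cross (B : op R (line N xi) -> op R (line N xi) -> R) P Q :
  finite_set Omega ->
  (forall X Y, B (- X) Y = - B X Y) -> (forall X Y, B X (- Y) = - B X Y) -> P != Q ->
  mean (fun u => B (conjop (circuit u) (lpauli R P)) (conjop (circuit u) (lpauli R Q))) = 0.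
Proof.
move=> fin Bl Br /conjop_circuit_sign[w [wO [a [b [ab E]]]]].
set f := fun u => _; have := mean_gmul f wO.
suff -> : (fun u => f (gmul u w)) = (fun u => - f u).
  rewrite (unif_meanN fin) => /eqP; rewrite eq_sym -subr_eq0 opprK -mulr2n.
  by rewrite mulrn_eq0 /= => /eqP.
apply/funext => u; rewrite /f; have [-> ->] := E u.
by case: a b ab {E} => [] [] // _; rewrite ?expr0 ?expr1 ?scale1r ?scaleN1r.
Qed.

End Circuit.

(** * Pauli expansion of the second moment *)

Section Slice.
Variables (R : realType) (S E : finType).
Local Notation C := R[i].
Implicit Types (A B : op R S) (M : op R (S * E)).

(** The partial trace over [S] of [M] multiplied by [A^T] on the first factor. For a Choi operator
    [M] it is the image of [A] under the map, divided by [#|S|]. *)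
Definition slice A M : op R E :=
  mkop (fun e e' => \sum_s \sum_s' entry A s s' * entry M (s, e) (s', e')).

Definition tslice A M : op R E := slice (A^T) M.

Lemma entry_slice A M e e' : entry (slice A M) e e' =
  \sum_s \sum_s' entry A s s' * entry M (s, e) (s', e').
Proof. exact: entry_mkop. Qed.

Lemma entry_tr A s s' : entry (A^T) s s' = entry A s' s.
Proof. by rewrite /entry mxE. Qed.

Lemma sliceZ a A M : slice (a *: A) M = a *: slice A M.
Proof.
apply: op_ext => e e'; rewrite entryZ !entry_slice mulr_sumr; apply: eq_bigr => s _.
by rewrite mulr_sumr; apply: eq_bigr => s' _; rewrite entryZ mulrA.
Qed.

Lemma sliceN A M : slice (- A) M = - slice A M.
Proof. by rewrite -scaleN1r sliceZ scaleN1r. Qed.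

Lemma slice1 M : slice 1%:M M = ptrace_fst M.
Proof.
apply: op_ext => e e'; rewrite entry_slice entry_ptrace; apply: eq_bigr => s _.
rewrite (bigD1 s) //= entry1 eqxx mul1r big1 ?addr0 // => s'.
by rewrite eq_sym => /negPf ss; rewrite entry1 ss mul0r.
Qed.

Lemma fro_slice_phase a A M : a * a^* = 1 -> fro (slice (a *: A) M) = fro (slice A M).
Proof.
move=> a1; rewrite sliceZ !fro_trE adjZ -scalemxAl -scalemxAr scalerA a1 scale1r.
by [].
Qed.

End Slice.

Section Parseval.
Variables (R : realType) (S T : finType) (F : T -> op R S).
Local Notation C := R[i].
Hypothesis complete : forall a b c d, \sum_p entry (F p) a b * ((entry (F p) c d)^*)%R =
  #|S|%:R * (a == c)%:R * (b == d)%:R.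
Hypothesis Fh : forall p, (F p)^t* = F p.

Lemma parseval (x y : S -> S -> C) :
  \sum_p (\sum_s \sum_s' entry (F p) s s' * x s s') *
         (\sum_s \sum_s' entry (F p) s' s * y s s') =
  #|S|%:R * \sum_s \sum_s' x s s' * y s s'.
Proof.
have e p s s' : entry (F p) s' s = ((entry (F p) s s')^*)%R by rewrite -entry_adj Fh.
transitivity (\sum_a \sum_b \sum_c \sum_d
    (\sum_p entry (F p) a b * ((entry (F p) c d)^*)%R) * (x a b * y c d)).
  transitivity (\sum_p \sum_a \sum_b \sum_c \sum_d
      entry (F p) a b * ((entry (F p) c d)^*)%R * (x a b * y c d)).
    apply: eq_bigr => p _; rewrite mulr_suml; apply: eq_bigr => a _.
    rewrite mulr_suml; apply: eq_bigr => b _; rewrite mulr_sumr; apply: eq_bigr => c _.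
    by rewrite mulr_sumr; apply: eq_bigr => d _; rewrite (e p c d) mulrACA.
  rewrite exchange_big; apply: eq_bigr => a _; rewrite exchange_big; apply: eq_bigr => b _.
  rewrite exchange_big; apply: eq_bigr => c _; rewrite exchange_big; apply: eq_bigr => d _.
  by rewrite mulr_suml.
rewrite mulr_sumr; apply: eq_bigr => a _; rewrite mulr_sumr; apply: eq_bigr => b _.
rewrite (bigD1 a) //= (bigD1 b) //= complete !eqxx !mulr1 big1 => [|d /negPf db].
  rewrite big1 ?addr0 // => c /negPf ca; apply: big1 => d _.
  by rewrite complete [a == c]eq_sym ca mulr0 !mul0r.
by rewrite complete [b == d]eq_sym db mulr0 mul0r.
Qed.

(** Parseval's identity for the expansion in [F]; it evaluates the total Pauli weight of a
    region. *)
Lemma sum_fro_slice (E : finType) (M : op R (S * E)) :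
  \sum_p fro (slice (F p) M) = #|S|%:R * fro M.
Proof.
apply: complexI; rewrite rmorph_sum real_complexM rmorph_nat /=.
have frC (K : finType) (A : op R K) : (fro A)%:C%C =
    \sum_x \sum_y entry A x y * ((entry A x y)^*)%R.
  rewrite fro_entry rmorph_sum; apply: eq_bigr => x _.
  by rewrite rmorph_sum; apply: eq_bigr => y _; rewrite /= sqnE.
rewrite frC; under eq_bigr do rewrite frC.
rewrite exchange_big /=; under eq_bigr do rewrite exchange_big /=.
transitivity (\sum_e \sum_e' #|S|%:R * \sum_s \sum_s'
    entry M (s, e) (s', e') * ((entry M (s, e) (s', e'))^*)%R).
  apply: eq_bigr => e _; apply: eq_bigr => e' _; rewrite -parseval.
  apply: eq_bigr => p _; rewrite entry_slice; congr (_ * _).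
  rewrite rmorph_sum; apply: eq_bigr => s _; rewrite rmorph_sum; apply: eq_bigr => s' _.
  by rewrite rmorphM /= -(entry_adj (F p)) Fh.
rewrite big_pairE [in RHS]exchange_big mulr_sumr; apply: eq_bigr => e _ /=.
under [in RHS]eq_bigr do rewrite big_pairE /=.
rewrite -mulr_sumr; congr (_ * _); rewrite exchange_big; apply: eq_bigr => s _ /=.
by rewrite exchange_big.
Qed.

Lemma tr_complete a b c d : \sum_p entry ((F p)^T) a b * ((entry ((F p)^T) c d)^*)%R =
  #|S|%:R * (a == c)%:R * (b == d)%:R.
Proof. by under eq_bigr do rewrite !entry_tr; rewrite complete mulrAC. Qed.

Lemma tr_herm p : ((F p)^T)^t* = (F p)^T.
Proof. by rewrite -[in RHS]Fh map_trmx. Qed.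

End Parseval.

Lemma sum_fro_tslice (R : realType) (S T E : finType) (F : T -> op R S) (M : op R (S * E)) :
  (forall a b c d, \sum_p entry (F p) a b * ((entry (F p) c d)^*)%R =
    #|S|%:R * (a == c)%:R * (b == d)%:R) -> (forall p, (F p)^t* = F p) ->
  \sum_p fro (tslice (F p) M) = #|S|%:R * fro M.
Proof.
move=> c h; apply: (sum_fro_slice (F := fun p => (F p)^T)).
  exact: tr_complete.
exact: tr_herm.
Qed.

Section TensorSlice.
Variables (R : realType) (L : finType) (S E : L -> finType).
Local Notation C := R[i].
Variables (A : forall i, op R (S i)) (M : forall i, op R (S i * E i)).
Variable A' : op R {dffun forall i, S i}.
Hypothesis A'E : forall s s', entry A' s s' = \prod_i entry (A i) (s i) (s' i).

Lemma entry_slice_tens e e' : entry (slice A' (tens_bip M)) e e' =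
  \prod_i entry (slice (A i) (M i)) (e i) (e' i).
Proof.
under [RHS]eq_bigr do rewrite entry_slice.
rewrite -(big_dffun_distr (fun i s => \sum_s' entry (A i) s s' *
   entry (M i) (s, e i) (s', e' i))) entry_slice; apply: eq_bigr => s _.
rewrite -(big_dffun_distr (fun i s' => entry (A i) (s i) s' *
   entry (M i) (s i, e i) (s', e' i))); apply: eq_bigr => s' _.
by rewrite A'E entry_mkop -big_split.
Qed.

Lemma fro_slice_tens :
  fro (slice A' (tens_bip M)) = \prod_i fro (slice (A i) (M i)).
Proof.
under [RHS]eq_bigr do rewrite fro_entry.
rewrite -(big_dffun_distr (fun i e => \sum_e' sqn (entry (slice (A i) (M i)) e e'))).
rewrite fro_entry; apply: eq_bigr => e _.
rewrite -(big_dffun_distr (fun i e' => sqn (entry (slice (A i) (M i)) (e i) e'))).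
by apply: eq_bigr => e' _; rewrite entry_slice_tens sqn_prod.
Qed.

End TensorSlice.

Section Jmap.
Variables (R : realType) (S E K : finType).
Local Notation C := R[i].

(* The output of the map with Choi operator [M] on [conjop U] of the first
   factor of [Z]. *)
Definition jmap (U : op R S) (M : op R (S * E)) (Z : op R (S * K)) : op R (E * K) :=
  mkop (fun x y => #|S|%:R * \sum_s \sum_s' entry M (s, x.1) (s', y.1) *
    \sum_t \sum_t' entry U s t * entry Z (t, x.2) (t', y.2) * ((entry U s' t')^*)%R).

(** Expands [Z] in the operator basis [F]; completeness of [F] supplies the factor [#|S|] carried by
    [jmap]. *)
Lemma jmap_expand (T : finType) (F : T -> op R S) U M Z :
  (forall a b c d, \sum_p entry (F p) a b * ((entry (F p) c d)^*)%R =
    #|S|%:R * (a == c)%:R * (b == d)%:R) -> (forall p, (F p)^t* = F p) ->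
  jmap U M Z = \sum_p otens (slice (conjop U (F p)) M) (tslice (F p) Z).
Proof.
move=> c h; apply: op_ext => -[e k] [e' k']; rewrite entry_sum.
pose x t t' := \sum_s \sum_s' entry U s t * ((entry U s' t')^*)%R *
  entry M (s, e) (s', e').
transitivity (\sum_p (\sum_t \sum_t' entry (F p) t t' * x t t') *
    (\sum_t \sum_t' entry (F p) t' t * entry Z (t, k) (t', k'))); last first.
  apply: eq_bigr => p _; rewrite entry_otens /=; congr (_ * _); last first.
    rewrite entry_slice; apply: eq_bigr => t _; apply: eq_bigr => t' _.
    by rewrite entry_tr.
  rewrite entry_slice.
  transitivity (\sum_t \sum_t' \sum_s \sum_s' entry U s t * entry (F p) t t' *
      ((entry U s' t')^*)%R * entry M (s, e) (s', e')).
    apply: eq_bigr => t _; apply: eq_bigr => t' _; rewrite mulr_sumr.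
    apply: eq_bigr => s _; rewrite mulr_sumr; apply: eq_bigr => s' _.
    by rewrite !mulrA [entry (F p) t t' * _]mulrC.
  transitivity (\sum_s \sum_s' \sum_t \sum_t' entry U s t * entry (F p) t t' *
      ((entry U s' t')^*)%R * entry M (s, e) (s', e')).
    under eq_bigr do rewrite exchange_big /=; rewrite exchange_big /=.
    apply: eq_bigr => s _.
    under eq_bigr do rewrite exchange_big /=; rewrite exchange_big /=.
    by [].
  apply: eq_bigr => s _; apply: eq_bigr => s' _.
  rewrite /conjop entryM mulr_suml exchange_big /=.
  apply: eq_bigr => t' _; rewrite entryM !mulr_suml.
  apply: eq_bigr => t _; rewrite entry_adj; by [].
rewrite (parseval c h) entry_mkop /=; congr (_ * _).
transitivity (\sum_s \sum_s' \sum_t \sum_t' entry U s t * ((entry U s' t')^*)%R *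
  entry M (s, e) (s', e') * entry Z (t, k) (t', k')).
  apply: eq_bigr => s _; apply: eq_bigr => s' _; rewrite mulr_sumr; apply: eq_bigr => t _.
  rewrite mulr_sumr; apply: eq_bigr => t' _; ring.
transitivity (\sum_t \sum_t' \sum_s \sum_s' entry U s t * ((entry U s' t')^*)%R *
  entry M (s, e) (s', e') * entry Z (t, k) (t', k')).
  under eq_bigr do rewrite exchange_big /=; rewrite exchange_big /=.
  apply: eq_bigr => t _.
  under eq_bigr do rewrite exchange_big /=; rewrite exchange_big /=.
  by [].
apply: eq_bigr => t _; apply: eq_bigr => t' _; rewrite mulr_suml; apply: eq_bigr => s _.
by rewrite mulr_suml.
Qed.

End Jmap.

(** * Counting walls *)

Section Walls.
Variable R : comPzRingType.

(** A bit string amounts to its first bit and the positions where consecutive bits differ, from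
    which [enc] recovers it by partial exclusive-or sums. The [n] possible walls are then free and
    independent. *)
Lemma sum_walls (n : nat) (k : R) :
  \sum_(s : {ffun 'I_n.+1 -> bool})
    \prod_(d < n) (if s (widen_ord (leqnSn n) d) == s (lift ord0 d) then 1 else k) =
  2 * (1 + k) ^+ n.
Proof.
pose dec (s : {ffun 'I_n.+1 -> bool}) : bool * {ffun 'I_n -> bool} :=
  (s ord0, [ffun d : 'I_n => s (widen_ord (leqnSn n) d) (+) s (lift ord0 d)]).
pose enc (p : bool * {ffun 'I_n -> bool}) : {ffun 'I_n.+1 -> bool} :=
  [ffun i : 'I_n.+1 => p.1 (+) \big[addb/false]_(d < n | (d < i)%N) p.2 d].
have wall p (d : 'I_n) :
    enc p (widen_ord (leqnSn n) d) (+) enc p (lift ord0 d) = p.2 d.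
  have E : \big[addb/false]_(j < n | (j < bump 0 d)%N) p.2 j =
      p.2 d (+) \big[addb/false]_(j < n | (j < d)%N) p.2 j.
    rewrite (bigD1 d) /=; last by rewrite /bump.
    congr (_ (+) _); apply: eq_bigl => j; rewrite -val_eqE /= /bump; lia.
  rewrite !ffunE /= E.
  by case: (p.1) (p.2 d) (\big[_/_]_(_ < _ | _) _) => [] [] [].
have encK : cancel enc dec.
  move=> p; rewrite /dec; have -> : enc p ord0 = p.1.
    by rewrite ffunE big_pred0 ?addbF.
  rewrite [RHS]surjective_pairing; congr pair.
  by apply/ffunP => d; rewrite ffunE wall.
have decI : injective dec.
  move=> s t [e0 /ffunP e1]; apply/ffunP => -[i li].
  elim: i li => [|i IH] li.
    have -> : Ordinal li = ord0 by apply: val_inj.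
    exact: e0.
  have li' : (i < n)%N by rewrite -ltnS.
  have := e1 (Ordinal li'); rewrite !ffunE.
  have -> : widen_ord (leqnSn n) (Ordinal li') = Ordinal (ltnW li).
    exact: val_inj.
  have -> : lift ord0 (Ordinal li') = Ordinal li by apply: val_inj.
  by rewrite IH; apply: addbI.
have decK : cancel dec enc by move=> s; apply: decI; rewrite encK.
rewrite (reindex enc) /=; last by exists dec => p _; rewrite ?encK ?decK.
rewrite (eq_bigr (fun p : bool * {ffun 'I_n -> bool} =>
    \prod_(d < n) (if p.2 d then k else 1))) => [|p _]; last first.
  apply: eq_bigr => d _; rewrite -(wall p d).
  by case: (enc p _) (enc p _) => [] [].
rewrite -(pair_bigA _ (fun (_ : bool) (f : {ffun 'I_n -> bool}) =>
  \prod_(d < n) (if f d then k else 1))) /=.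
rewrite big_bool /= -mulr2n -[LHS]mulr_natl; congr (_ * _).
rewrite -(bigA_distr_bigA (fun (_ : 'I_n) (b : bool) => if b then k else 1)) /=.
under eq_bigr do rewrite big_bool.
by rewrite prodr_const card_ord addrC.
Qed.

Lemma sum_chain_walls (N : nat) (a b : 'I_N.-1 -> 'I_N) (k : R) : (0 < N)%N ->
  (forall d, a d = d :> nat) -> (forall d, b d = d.+1 :> nat) ->
  \sum_(s : {ffun 'I_N -> bool}) \prod_d (if s (a d) == s (b d) then 1 else k) =
  2 * (1 + k) ^+ N.-1.
Proof.
case: N a b => // n a b _ aE bE; rewrite -sum_walls; apply: eq_bigr => s _.
apply: eq_bigr => d _; congr (if s _ == s _ then _ else _); apply: val_inj => /=.
  by rewrite aE.
by rewrite bE.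
Qed.

End Walls.

Section ChainBound.
Variables (R : realType) (N : nat).
Local Notation L := 'I_(2 * N).
Local Notation l0 := (fun d => lreg (@even_gate N d)).
Local Notation r0 := (fun d => rreg (@even_gate N d)).
Local Notation l1 := (fun d => lreg (@odd_gate N d)).
Local Notation r1 := (fun d => rreg (@odd_gate N d)).

Lemma pair_of_proof (i : L) : (i./2 < N)%N.
Proof. by case: i => i /=; lia. Qed.

Definition pair_of (i : L) : 'I_N := Ordinal (pair_of_proof i).

Lemma pair_of_l0 d : pair_of (l0 d) = d.
Proof. by apply: val_inj => /=; lia. Qed.

Lemma pair_of_r0 d : pair_of (r0 d) = d.
Proof. by apply: val_inj => /=; lia. Qed.

Lemma uncovered_even (i : L) : uncovered l0 r0 i = false.
Proof.
apply/negP => /forallP/(_ (pair_of i)); rewrite -!(inj_eq val_inj) /=; lia.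
Qed.

Lemma big_even (S : comPzSemiRingType) (h : L -> S) :
  \prod_i h i = \prod_d (h (l0 d) * h (r0 d)).
Proof.
rewrite (big_blocks (layer_l_inj (@even_gate_inj N)) (layer_r_inj (@even_gate_inj N))
  (@even_gate_lr N)).
by rewrite [X in _ * X]big_pred0 ?mulr1 //; apply: uncovered_even.
Qed.

Lemma big_odd (S : comPzSemiRingType) (h : L -> S) :
  \prod_i h i = \prod_d (h (l1 d) * h (r1 d)) * \prod_(i | uncovered l1 r1 i) h i.
Proof.
exact: (big_blocks (layer_l_inj (@odd_gate_inj N)) (layer_r_inj (@odd_gate_inj N))
  (@odd_gate_lr N)).
Qed.

Hypothesis N_gt0 : (0 < N)%N.
Variables (D M : R) (x y : L -> R).
Hypotheses (D_gt1 : 1 < D) (xD : forall i, x i <= D) (xD' : forall i, 1 <= D * x i).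
Hypotheses (y_ge0 : forall i, 0 <= y i).
Hypotheses (xM : forall i, x i <= M) (xM' : forall i, 1 <= M * x i).

(** In the application [D] is the dimension [2 ^+ xi] of a region, and [x i], [y i] are the squared
    norms of the weighted input and Choi factors, that is, 2 to the power [- H2]. [v d] is the mean
    weight of a first-layer block over its nontrivial labels; [g d a b] is the total factor of a
    second-layer gate when each end is summed over all labels ([true]) or fixed to the identity
    ([false]). *)
Let v d := (D ^+ 2 * (x (l0 d) * x (r0 d)) - 1) / (D ^+ 4 - 1).
Let g d (a b : bool) := if a then if b then D ^+ 2 * (y (l1 d) * y (r1 d))
    else (D ^+ 2 + D ^+ 2 * (y (l1 d) * y (r1 d))) / (D ^+ 2 + 1)
  else if b then (D ^+ 2 + D ^+ 2 * (y (l1 d) * y (r1 d))) / (D ^+ 2 + 1) else 1.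
Let k := 2 * D / (D ^+ 2 + 1) * M.
Let m i := Num.max 1 (x i * y i).
Let D0 : 0 < D. Proof. exact: lt_trans D_gt1. Qed.
Let x0 i : 0 < x i. Proof. by rewrite -(pmulr_rgt0 _ D0) (lt_le_trans ltr01). Qed.

(** A first-layer block contributes [v + (1 - v)] when trivial and [v] otherwise; [s d] tells
    whether the unconditional [v] or the conditional [1 - v] is taken. Sums over nontrivial labels
    thus become unrestricted ones, and a second-layer gate sees only the bits of the two blocks it
    touches. *)
Definition chain_term (s : {ffun 'I_N -> bool}) : R :=
  (\prod_d (if s d then v d else 1 - v d)) *
  (\prod_d g d (s (pair_of (l1 d))) (s (pair_of (r1 d)))) *
  \prod_(i | uncovered l1 r1 i) (if s (pair_of i) then D * y i else 1).

Let D4 : 0 < D ^+ 4 - 1. Proof. by rewrite subr_gt0 exprn_egt1. Qed.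

(** The upper bound for [true] and the sign for [false] both come down to
    [x (l0 d) * x (r0 d) <= D ^+ 2]. *)
Let w_bound d (b : bool) : 0 <= (if b then D ^+ 2 * v d else 1 - v d) <=
  (if b then x (l0 d) * x (r0 d) else 1).
Proof.
rewrite /v; set X := x _ * x _.
have X1 : 1 <= D ^+ 2 * X.
  rewrite (_ : _ * X = (D * x (l0 d)) * (D * x (r0 d))); last by rewrite /X; ring.
  by rewrite -[leLHS]mulr1; apply: ler_pM; rewrite ?ler01 ?xD'.
have X2 : X <= D ^+ 2.
  by rewrite expr2; apply: ler_pM; rewrite ?(ltW (x0 _)) ?xD.
have D2 : 0 < D ^+ 2 by rewrite exprn_gt0.
have D41 : D ^+ 4 = D ^+ 2 * D ^+ 2 by rewrite -exprD.
case: b; apply/andP; split.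
- by rewrite mulr_ge0 ?(ltW D2) // divr_ge0 ?(ltW D4) // subr_ge0.
- rewrite mulrA ler_pdivrMr // D41; nra.
- rewrite subr_ge0 ler_pdivrMr // mul1r D41; nra.
- by rewrite lerBlDr lerDl divr_ge0 ?(ltW D4) // subr_ge0.
Qed.

Let m_ge1 i : 1 <= m i. Proof. by rewrite /m le_max lexx. Qed.
Let m_gexy i : x i * y i <= m i. Proof. by rewrite /m le_max lexx orbT. Qed.
Let m_ge0 i : 0 <= m i. Proof. exact: le_trans (m_ge1 i). Qed.

(** The first layer leaves a factor [x / D] on each region under a [true] bit, so the weights can be
    regrouped along the second-layer gates. *)
Let gx d (a b : bool) := (if a then x (l1 d) / D else 1) * (if b then x (r1 d) / D else 1)
  * g d a b.

Let g_ge0 d a b : 0 <= g d a b.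
Proof.
have yy : 0 <= y (l1 d) * y (r1 d) by rewrite mulr_ge0.
have D2 : 0 < D ^+ 2 by rewrite exprn_gt0.
have D3 : 0 <= D ^+ 2 * (y (l1 d) * y (r1 d)) by rewrite mulr_ge0 // ltW.
by case: a b => [] []; rewrite /g // divr_ge0 ?addr_ge0 // ltW.
Qed.

Let k_ge0 : 0 <= k.
Proof.
have M0 : 0 <= M by apply: le_trans (ltW (x0 (Ordinal (ltn_addr _ N_gt0)))) (xM _).
by rewrite /k !mulr_ge0 ?invr_ge0 ?addr_ge0 ?sqr_ge0 // ltW.
Qed.

Let gx_bound d a b : 0 <= gx d a b <= m (l1 d) * m (r1 d) * (if a == b then 1 else k).
Proof.
apply/andP; split.
  by rewrite /gx !mulr_ge0 //; case: ifP => // _; rewrite divr_ge0 // ltW.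
have xl := x0 (l1 d); have xr := x0 (r1 d); have yl := y_ge0 (l1 d); have yr := y_ge0 (r1 d).
(* The price of a wall. Each of the two terms is at most [M * (m i * m j)]: [x i] directly, and
   [x i * y i * y j] by inserting [1 <= M * x j]. Hence the constant takes the larger of [x] and its
   inverse, and the two terms give the 2 in [k]. *)
have mix (i j : L) : x i / D * 1 * ((D ^+ 2 + D ^+ 2 * (y i * y j)) / (D ^+ 2 + 1)) <=
    m i * m j * k.
  have -> : x i / D * 1 * ((D ^+ 2 + D ^+ 2 * (y i * y j)) / (D ^+ 2 + 1)) =
      (D / (D ^+ 2 + 1)) * (x i * (1 + y i * y j)).
    have ? : D != 0 by rewrite gt_eqF.
    have ? : D ^+ 2 + 1 != 0 by rewrite gt_eqF // ltr_wpDl ?sqr_ge0.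
    by field; apply/andP.
  have -> : m i * m j * k = (D / (D ^+ 2 + 1)) * (2 * M * (m i * m j)).
    by rewrite /k; ring.
  apply: ler_wpM2l; first by rewrite divr_ge0 ?addr_ge0 ?sqr_ge0 // ltW.
  have mm : 1 <= m i * m j by rewrite -[leLHS]mulr1; apply: ler_pM; rewrite ?ler01 ?m_ge1.
  have M0 : 0 <= M by apply: le_trans (ltW (x0 i)) (xM i).
  have h1 : x i <= M * (m i * m j).
    by apply: (le_trans (xM i)); rewrite ler_peMr.
  have h2 : y j <= M * m j.
    apply: (@le_trans _ _ (M * x j * y j)); first by rewrite ler_peMl.
    by rewrite -mulrA ler_wpM2l.
  have h3 : x i * y i * y j <= m i * (M * m j).
    by apply: ler_pM; rewrite ?mulr_ge0 ?(ltW (x0 i)) ?m_gexy.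
  rewrite mulrDr mulr1 mulrA; apply: (le_trans (lerD h1 h3)).
  by rewrite le_eqVlt; apply/orP; left; apply/eqP; ring.
case: a b => [] []; rewrite /gx /g /=.
- rewrite mulr1.
  have -> : x (l1 d) / D * (x (r1 d) / D) * (D ^+ 2 * (y (l1 d) * y (r1 d))) =
     (x (l1 d) * y (l1 d)) * (x (r1 d) * y (r1 d)).
    have ? : D != 0 by rewrite gt_eqF.
    by field.
  by apply: ler_pM; rewrite ?mulr_ge0 ?(ltW (x0 _)) ?m_gexy.
- exact: mix.
- rewrite (mulrC 1) (mulrC (y (l1 d))) (mulrC (m (l1 d))); exact: mix.
- by rewrite !mulr1 -[leLHS]mulr1; apply: ler_pM; rewrite ?ler01 ?m_ge1.
Qed.

Lemma chain_term_le (s : {ffun 'I_N -> bool}) : chain_term s <=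
  (\prod_d gx d (s (pair_of (l1 d))) (s (pair_of (r1 d)))) *
  \prod_(i | uncovered l1 r1 i) (if s (pair_of i) then x i * y i else 1).
Proof.
pose h (i : L) : R := if s (pair_of i) then D else 1.
pose h' (i : L) : R := if s (pair_of i) then x i / D else 1.
have E1 : \prod_d (if s d then v d else 1 - v d) * \prod_i h i =
    \prod_d (if s d then D ^+ 2 * v d else 1 - v d).
  rewrite big_even -big_split; apply: eq_bigr => d _ /=.
  by rewrite /h pair_of_l0 pair_of_r0; case: (s d); ring.
have h0 : 0 < \prod_i h i by apply: prodr_gt0 => i _; rewrite /h; case: ifP.
have E2 : \prod_d (if s d then v d else 1 - v d) <= \prod_i h' i.
  rewrite -(ler_pM2r h0) E1 -big_split /= big_even; apply: ler_prod => d _.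
  have := w_bound d (s d); rewrite /h /h' pair_of_l0 pair_of_r0.
  have ? : D != 0 by rewrite gt_eqF.
  by case: (s d); rewrite ?mulr1 // !divfK.
rewrite /chain_term -mulrA; apply: (le_trans (ler_wpM2r _ E2)).
  by rewrite mulr_ge0 ?prodr_ge0 // => i _; case: ifP; rewrite ?mulr_ge0 ?(ltW D0) ?y_ge0.
rewrite big_odd mulrACA -!big_split /= le_eqVlt; apply/orP; left; apply/eqP.
congr (_ * _); apply: eq_bigr => i _; rewrite /h'.
by case: ifP; rewrite ?mulr1 // mulrA divfK // gt_eqF.
Qed.

Lemma chain_term_bound (s : {ffun 'I_N -> bool}) : chain_term s <=
  (\prod_d (if s (pair_of (l1 d)) == s (pair_of (r1 d)) then 1 else k)) * \prod_i m i.
Proof.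
apply: (le_trans (chain_term_le s)); rewrite (big_odd m) mulrA -big_split /=.
apply: ler_pM; rewrite ?prodr_ge0 //.
- by move=> d _; have /andP[] := gx_bound d (s (pair_of (l1 d))) (s (pair_of (r1 d))).
- by move=> i _; case: ifP; rewrite ?mulr_ge0 ?(ltW (x0 i)) ?y_ge0.
- apply: ler_prod => d _; rewrite [(if _ then _ else _) * _]mulrC; exact: gx_bound.
- apply: ler_prod => i _; case: ifP => // _; last by rewrite ler01 m_ge1.
  by rewrite ?mulr_ge0 ?(ltW (x0 i)) ?m_gexy.
Qed.

(** The two patterns without walls are estimated without the maxima [m]: they give the leading term,
    and the 1 that the identity string will cancel. *)
Lemma chain_term_const (b : bool) :
  chain_term [ffun=> b] <= if b then \prod_i (x i * y i) else 1.
Proof.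
apply: (le_trans (chain_term_le _)).
rewrite (eq_bigr (fun d => gx d b b)) => [|d _]; last by rewrite !ffunE.
rewrite [X in _ * X](eq_bigr (fun i => if b then x i * y i else 1)) => [|i _]; last first.
  by rewrite ffunE.
case: b; last by rewrite !big1 ?mulr1 // => d _; rewrite /gx /g !mulr1.
rewrite [leRHS]big_odd le_eqVlt; apply/orP; left; apply/eqP; congr (_ * _).
apply: eq_bigr => d _; rewrite /gx /g.
have ? : D != 0 by rewrite gt_eqF.
by field.
Qed.

(** [2 * (1 + k) ^+ N.-1] sums the wall weights of all patterns; taking away the two constant ones
    leaves the [- 1]. *)
Lemma chain_bound : \sum_s chain_term s <=
  1 + \prod_i (x i * y i) + 2 * ((1 + k) ^+ N.-1 - 1) * \prod_i m i.
Proof.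
pose e (s : {ffun 'I_N -> bool}) : R :=
  \prod_d (if s (pair_of (l1 d)) == s (pair_of (r1 d)) then 1 else k).
have S : \sum_s e s = 2 * (1 + k) ^+ N.-1.
  by apply: sum_chain_walls => // d /=; lia.
have ne : [ffun=> true] != [ffun=> false] :> {ffun 'I_N -> bool}.
  by apply/eqP => /ffunP/(_ (Ordinal N_gt0)); rewrite !ffunE.
have ec (b : bool) : e [ffun=> b] = 1.
  by rewrite /e big1 // => d _; rewrite !ffunE eqxx.
rewrite (bigD1 [ffun=> true]) //= (bigD1 [ffun=> false]) 1?eq_sym //=.
set rest := \sum_(s | _) _.
have hr : rest <= (2 * ((1 + k) ^+ N.-1 - 1)) * \prod_i m i.
  have <- : \sum_(s : {ffun 'I_N -> bool} |
      (s != [ffun=> true]) && (s != [ffun=> false])) e s =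
      2 * ((1 + k) ^+ N.-1 - 1).
    move: S; rewrite (bigD1 [ffun=> true]) //= (bigD1 [ffun=> false]) 1?eq_sym //= !ec.
    by move=> S; apply: (addrI (1 + 1)); rewrite -addrA S; ring.
  by rewrite mulr_suml; apply: ler_sum => s _; apply: chain_term_bound.
rewrite addrA (addrC 1); apply: lerD hr.
by apply: lerD; [apply: (chain_term_const true) | apply: (chain_term_const false)].
Qed.

End ChainBound.

Section KernelProduct.
Variables (R : realType) (xi : nat) (L D : finType) (l r : D -> L).
Hypotheses (l_inj : injective l) (r_inj : injective r) (lr : forall d e, l d != r e).
Local Notation label := {ffun 'I_xi -> bool * bool}.
Local Notation label2 := {ffun 'I_xi + 'I_xi -> bool * bool}.
Local Notation chain := {dffun forall _ : L, label}.
Local Notation unc := (uncovered l r).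
Local Notation pid := (pid 'I_xi).

Lemma bid_join (p q : label) : (pjoin p q == bid xi) = (p == pid) && (q == pid).
Proof.
apply/eqP/andP => [e|[/eqP-> /eqP->]]; last by apply/ffunP => -[k|k]; rewrite !ffunE.
split; apply/eqP; [rewrite -(splitl_join p q) | rewrite -(splitr_join p q)];
  by rewrite e; apply/ffunP => k; rewrite !ffunE.
Qed.

(** Symmetry lets the first layer be summed over its starting string, against the input weights. *)
Lemma kernelC (P Q : chain) : kernel R l r P Q = kernel R l r Q P.
Proof.
rewrite /kernel; congr (_ * _); apply: eq_bigr => i _; last by rewrite eq_sym.
by rewrite /gate_kernel; do 2!case: eqP => _ //=; rewrite mul0r.
Qed.

Lemma kernel_prod (t : L -> label -> R) (P : chain) : (forall i, t i pid = 1) ->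
  \sum_(Q : chain) kernel R l r P Q * \prod_i t i (Q i) =
  (\prod_d (if pjoin (P (l d)) (P (r d)) == bid xi then 1 else
      ((\sum_p t (l d) p) * (\sum_p t (r d) p) - 1) / (#|label2|.-1)%:R)) *
  \prod_(i | unc i) t i (P i).
Proof.
move=> t1.
transitivity (\sum_(Q : chain) kernel R l r P Q *
    ((\prod_d (t (l d) (Q (l d)) * t (r d) (Q (r d)))) * \prod_(i | unc i) t i (Q i))).
  apply: eq_bigr => Q _; congr (_ * _).
  exact: (big_blocks l_inj r_inj lr (fun i => t i (Q i))).
rewrite (sum_kernel l_inj r_inj lr P (fun d p q => t (l d) p * t (r d) q) t).
congr (_ * _); apply: eq_bigr => d _.
rewrite (sum_gate_kernel (fun g => t (l d) (splitl g) * t (r d) (splitr g))).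
have idE : t (l d) (splitl (bid xi)) * t (r d) (splitr (bid xi)) = 1.
  have -> : bid xi = pjoin pid pid by apply/eqP; rewrite eq_sym bid_join !eqxx.
  by rewrite splitl_join splitr_join !t1 mulr1.
rewrite idE; case: ifP => // _; congr (_ / _).
have := sum_pjoin (fun g : label2 => t (l d) (splitl g) * t (r d) (splitr g)).
rewrite (bigD1 (bid xi)) //= idE => e.
apply: (addrI 1); rewrite -e addrC subrK big_distrlr /=.
by apply: eq_bigr => p _; apply: eq_bigr => q _; rewrite splitl_join splitr_join.
Qed.

End KernelProduct.

Section KernelTotal.
Variables (R : realType) (N xi : nat).
Hypotheses (N_gt0 : (0 < N)%N) (xi_gt0 : (0 < xi)%N).
Local Notation L := 'I_(2 * N).
Local Notation label := {ffun 'I_xi -> bool * bool}.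
Local Notation label2 := {ffun 'I_xi + 'I_xi -> bool * bool}.
Local Notation chain := {dffun forall _ : L, label}.
Local Notation pid := (pid 'I_xi).
Local Notation l0 := (fun d => lreg (@even_gate N d)).
Local Notation r0 := (fun d => rreg (@even_gate N d)).
Local Notation l1 := (fun d => lreg (@odd_gate N d)).
Local Notation r1 := (fun d => rreg (@odd_gate N d)).
Local Notation D := (2 ^+ xi : R).

Lemma card_label : #|label|%:R = D ^+ 2.
Proof.
by rewrite card_ffun card_prod card_bool card_ord natrX natrM -expr2 -!exprM mulnC.
Qed.

Lemma card_label2 : (#|label2|.-1)%:R = D ^+ 4 - 1.
Proof.
rewrite card_ffun card_prod card_bool card_sum card_ord -subn1 natrB ?expn_gt0 //.
rewrite natrX natrM -expr2 -!exprM; congr (_ ^+ _ - _); lia.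
Qed.

Variables (tM tZ : L -> label -> R) (x y : L -> R).
Hypotheses (tM1 : forall i, tM i pid = 1) (tZ1 : forall i, tZ i pid = 1).
Hypotheses (tMD : forall i, \sum_p tM i p = D * y i)
  (tZD : forall i, \sum_p tZ i p = D * x i).

(** The input and output sums are both pushed onto the string [P'] between the layers. There every
    first-layer block gives 1 or [v], and the splitting behind [chain_term] makes the sum over [P']
    factor along the second layer. *)
Lemma kernel_total :
  \sum_(P : chain) (\prod_i tZ i (P i)) *
    \sum_P' kernel R l0 r0 P P' * \sum_Q kernel R l1 r1 P' Q * \prod_i tM i (Q i) =
  \sum_s chain_term D x y s.
Proof.
have l0I := layer_l_inj (@even_gate_inj N); have r0I := layer_r_inj (@even_gate_inj N).
have l1I := layer_l_inj (@odd_gate_inj N); have r1I := layer_r_inj (@odd_gate_inj N).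
pose v d := (D ^+ 2 * (x (l0 d) * x (r0 d)) - 1) / (D ^+ 4 - 1).
pose b d := (D ^+ 2 * (y (l1 d) * y (r1 d)) - 1) / (D ^+ 4 - 1).
pose G1 (d : 'I_N.-1) (p q : label) := if pjoin p q == bid xi then 1 else b d.
transitivity (\sum_(P' : chain)
    (\prod_d (if pjoin (P' (l0 d)) (P' (r0 d)) == bid xi then 1 else v d)) *
    ((\prod_d G1 d (P' (l1 d)) (P' (r1 d))) *
     \prod_(i | uncovered l1 r1 i) tM i (P' i))).
  under eq_bigr do rewrite mulr_sumr.
  rewrite exchange_big /=; apply: eq_bigr => P' _.
  rewrite (kernel_prod l1I r1I (@odd_gate_lr N) P' tM1).
  under eq_bigr do rewrite mulrA [_ * kernel _ _ _ _ _]mulrC kernelC.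
  rewrite -mulr_suml (kernel_prod l0I r0I (@even_gate_lr N) P' tZ1).
  rewrite [X in _ * X * _]big_pred0 ?mulr1; last exact: uncovered_even.
  congr (_ * (_ * _)); apply: eq_bigr => d _; rewrite /G1 card_label2.
    by rewrite !tZD /v; case: ifP => // _; congr ((_ - 1) / _); ring.
  by rewrite !tMD /b; case: ifP => // _; congr ((_ - 1) / _); ring.
pose site (s : {ffun 'I_N -> bool}) (i : L) (p : label) : R :=
  if s (pair_of i) then 1 else (p == pid)%:R.
transitivity (\sum_(s : {ffun 'I_N -> bool}) (\prod_d (if s d then v d else 1 - v d)) *
   \sum_(P' : chain) (\prod_i site s i (P' i)) *
    ((\prod_d G1 d (P' (l1 d)) (P' (r1 d))) *
     \prod_(i | uncovered l1 r1 i) tM i (P' i))).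
  under [RHS]eq_bigr do rewrite mulr_sumr.
  rewrite [RHS]exchange_big /=; apply: eq_bigr => P' _.
  under [RHS]eq_bigr do rewrite mulrA; rewrite -mulr_suml; congr (_ * _).
  (* A trivial block has factor [v + (1 - v)], any other block [v + 0]. *)
  transitivity (\prod_(d < N) \sum_(a : bool) (if a then v d else 1 - v d) *
      (if a then 1 else (P' (l0 d) == pid)%:R * (P' (r0 d) == pid)%:R)).
    apply: eq_bigr => d _; rewrite big_bool bid_join mulr1.
    by case: eqP => _; case: eqP => _; rewrite /= ?(mulr1, mulr0, mul0r, addr0) // addrC subrK.
  rewrite bigA_distr_bigA; apply: eq_bigr => s _ /=.
  rewrite big_split /=; congr (_ * _); rewrite big_even; apply: eq_bigr => d _.
  by rewrite /site pair_of_l0 pair_of_r0; case: ifP; rewrite ?mulr1.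
apply: eq_bigr => s _; rewrite /chain_term -mulrA; congr (_ * _).
pose F d p q := site s (l1 d) p * site s (r1 d) q * G1 d p q.
pose G i p := site s i p * tM i p.
transitivity (\sum_(P' : chain) ((\prod_d F d (P' (l1 d)) (P' (r1 d))) *
    \prod_(i | uncovered l1 r1 i) G i (P' i))).
  apply: eq_bigr => P' _; rewrite (big_odd (fun i => site s i (P' i))) mulrACA.
  by rewrite -!big_split.
rewrite (sum_blocks l1I r1I (@odd_gate_lr N)).
have D0 : 0 < D by rewrite exprn_gt0.
have D1 : 1 < D by rewrite exprn_egt1 // ?ltr1n // -lt0n.
have D40 : D ^+ 4 - 1 != 0 by rewrite gt_eqF // subr_gt0 exprn_egt1.
have D20 : D ^+ 2 + 1 != 0 by rewrite gt_eqF // ltr_wpDl ?sqr_ge0.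
have cA (c : R) : \sum_(p : label) c = D ^+ 2 * c.
  by rewrite sumr_const -card_label mulr_natl.
have cN (c : R) : \sum_(p : label | p != pid) c = (D ^+ 2 - 1) * c.
  by apply: (addrI c); have := cA c; rewrite (bigD1 pid) //= => ->; ring.
have q1 c : \sum_(p : label) (if p == pid then 1 else c) = 1 + (D ^+ 2 - 1) * c.
  rewrite (bigD1 pid) //= eqxx -cN; congr (_ + _).
  by apply: eq_bigr => p /negPf->.
have delta1 (f : label -> R) : \sum_p (p == pid)%:R * f p = f pid.
  rewrite (bigD1 pid) //= eqxx mul1r big1 ?addr0 // => p /negPf->.
  by rewrite mul0r.
congr (_ * _); last first.
  apply: eq_bigr => i _; rewrite /G /site; case: ifP => _.
    by under eq_bigr do rewrite mul1r; rewrite tMD.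
  by rewrite delta1 tM1.
apply: eq_bigr => d _; rewrite /F /site /G1.
have mixE : 1 + (D ^+ 2 - 1) * b d =
    (D ^+ 2 + D ^+ 2 * (y (l1 d) * y (r1 d))) / (D ^+ 2 + 1).
  rewrite /b (_ : D ^+ 4 - 1 = (D ^+ 2 - 1) * (D ^+ 2 + 1)); last by ring.
  have ? : D ^+ 2 - 1 != 0 by rewrite gt_eqF // subr_gt0 exprn_egt1.
  by field; apply/andP.
case: (s (pair_of (l1 d))); case: (s (pair_of (r1 d))).
- transitivity (\sum_(p : label) if p == pid then 1 + (D ^+ 2 - 1) * b d else D ^+ 2 * b d).
    apply: eq_bigr => p _; under eq_bigr do rewrite !mul1r bid_join.
    case: eqP => _ /=; first exact: q1.
    exact: cA.
  rewrite (bigD1 pid) //= eqxx (eq_bigr (fun=> D ^+ 2 * b d)) => [|p /negPf-> //].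
  rewrite cN.
  rewrite /b; field; exact: D40.
- transitivity (\sum_(p : label) if p == pid then 1 else b d); last by rewrite q1.
  apply: eq_bigr => p _; under eq_bigr do rewrite mul1r bid_join.
  by rewrite delta1 eqxx andbT.
- rewrite exchange_big /=.
  transitivity (\sum_(p : label) if p == pid then 1 else b d); last by rewrite q1.
  apply: eq_bigr => p _; under eq_bigr do rewrite mulr1 bid_join.
  by rewrite delta1 eqxx.
- under eq_bigr do under eq_bigr do rewrite -mulrA.
  under eq_bigr do rewrite -mulr_sumr delta1.
  by rewrite delta1 bid_join !eqxx.
Qed.

End KernelTotal.

(** * The mean squared Hilbert-Schmidt error *)

Section SecondMoment.
Variables (R : realType) (N xi : nat).
Hypotheses (N_gt0 : (0 < N)%N) (xi_gt0 : (0 < xi)%N).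
Local Notation C := R[i].
Local Notation L := 'I_(2 * N).
Local Notation label := {ffun 'I_xi -> bool * bool}.
Local Notation chain := {dffun forall _ : L, label}.
Local Notation Omega := (@clifford_gates R N xi).
Local Notation mean := (unif_mean Omega).
Local Notation pid := (pid 'I_xi).
Local Notation act0 := (gateact (@even_gate N)).
Local Notation act1 := (gateact (@odd_gate N)).

Definition lpid : chain := [ffun=> pid].

Lemma lpidE i : lpid i = pid. Proof. by rewrite ffunE. Qed.

Lemma lpauli_id : lpauli R lpid = 1%:M.
Proof.
apply: op_ext => s s'; rewrite entry_mkop entry1.
under eq_bigr do rewrite lpidE pauli_id entry1.
have [->|ne] := eqVneq s s'; first by rewrite big1 // => i _; rewrite eqxx.
have [i si] : exists i, s i != s' i.
  apply/existsP; rewrite -negb_forall; apply: contraNN ne => /forallP e.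
  by apply/eqP/(@dffun_ext _ (fun=> region xi)) => i; apply/eqP.
by rewrite (bigD1 i) //= (negPf si) mul0r.
Qed.

Lemma lpauli_herm (P : chain) : (lpauli R P)^t* = lpauli R P.
Proof.
apply: op_ext => s s'; rewrite entry_adj !entry_mkop rmorph_prod.
by apply: eq_bigr => i _ /=; rewrite -entry_adj pauli_herm.
Qed.

Lemma card_line : #|line N xi|%:R = \prod_(i : L) (#|region xi|%:R : C).
Proof.
rewrite -natr_prod; congr (_%:R); rewrite /line card_dep_ffun foldrE big_map.
by rewrite big_enum.
Qed.

Lemma lpauli_complete a b c d :
  \sum_(P : chain) entry (lpauli R P) a b * ((entry (lpauli R P) c d)^*)%R =
  #|line N xi|%:R * (a == c)%:R * (b == d)%:R.
Proof.
have E (s t : line N xi) : \prod_i ((s i == t i)%:R : C) = (s == t)%:R.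
  rewrite -entry1 -lpauli_id entry_mkop; apply: eq_bigr => i _.
  by rewrite lpidE pauli_id entry1.
transitivity (\sum_(P : chain) \prod_i (entry (pauli_string R (P i)) (a i) (b i) *
    ((entry (pauli_string R (P i)) (c i) (d i))^*)%R)).
  by apply: eq_bigr => P _; rewrite !entry_mkop rmorph_prod -big_split.
rewrite (big_dffun_distr (fun i (p : label) => entry (pauli_string R p) (a i) (b i) *
    ((entry (pauli_string R p) (c i) (d i))^*)%R)).
under eq_bigr do rewrite pauli_complete.
by rewrite !big_split /= !E card_line.
Qed.

Lemma gateact_id (D : finType) (e : D -> 'I_(2 * N).-1) u :
  injective e -> (forall d d', lreg (e d) != rreg (e d')) -> Omega u ->
  gateact e u lpid = lpid.
Proof.
move=> eI lr uO; apply: (@blockact_ext xi L D (fun d => lreg (e d)) (fun d => rreg (e d))).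
  move=> d; rewrite /gateact blockact_join //; try exact: layer_l_inj; try exact: layer_r_inj.
  have -> : pjoin (lpid (lreg (e d))) (lpid (rreg (e d))) = bid xi.
    by apply/eqP; rewrite bid_join !lpidE !eqxx.
  by apply: pact_pid; case: (uO (e d)).
by move=> i ui; rewrite /gateact blockact_unc.
Qed.

Lemma circuit_unitary u : Omega u -> conjop (circuit u) 1%:M = 1%:M.
Proof.
move=> uO; have one (D : finType) (e : D -> 'I_(2 * N).-1) :
    injective e -> (forall d d', lreg (e d) != rreg (e d')) ->
    blockop (fun d => lreg (e d)) (fun d => rreg (e d)) (fun=> 1%:M) (fun=> 1%:M) =
    1%:M :> op R (line N xi).
  move=> eI lr; rewrite -lpauli_id.
  rewrite (lpauli_blockop R (layer_l_inj eI) (layer_r_inj eI) lr lpid).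
  apply: op_ext => s s'; rewrite !entry_mkop; congr (_ * _); apply: eq_bigr => d _.
    rewrite (_ : pjoin _ _ = bid xi) ?pauli_id //.
    by apply/eqP; rewrite bid_join !lpidE !eqxx.
  by rewrite lpidE pauli_id.
have unit (D : finType) (e : D -> 'I_(2 * N).-1) :
    injective e -> (forall d d', lreg (e d) != rreg (e d')) ->
    conjop (blockop (fun d => lreg (e d)) (fun d => rreg (e d)) (fun d => u (e d))
      (fun=> 1%:M) : op R (line N xi)) 1%:M = 1%:M.
  move=> eI lr; rewrite /conjop mulmx1 adj_blockop.
  rewrite (blockopM (layer_l_inj eI) (layer_r_inj eI) lr) -(one D e eI lr).
  apply: op_ext => s s'; rewrite !entry_mkop; congr (_ * _); apply: eq_bigr => d _.
    by rewrite sclifford_unitary.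
  by rewrite mul1mx adj1.
rewrite circuitE conjopM (unit _ _ (@even_gate_inj N) (@even_gate_lr N)).
exact: (unit _ _ (@odd_gate_inj N) (@odd_gate_lr N)).
Qed.

Variables (E K : L -> finType).
Variables (M : forall i, op R (region xi * E i)) (Z : forall i, op R (region xi * K i)).
Hypotheses (M1 : forall i, fro (ptrace_fst (M i)) = 1)
  (Z1 : forall i, fro (ptrace_fst (Z i)) = 1).

Let tM i p := fro (slice (pauli_string R (p : label)) (M i)).
Let tZ i p := fro (tslice (pauli_string R (p : label)) (Z i)).
Let M' := tens_bip M.
Let Z' := tens_bip Z.

Definition tens_dec u : op R ({dffun forall i, E i} * {dffun forall i, K i}) :=
  jmap (circuit u) M' Z' - otens (ptrace_fst M') (ptrace_fst Z').

Lemma fro_slice_lpauli (P : chain) : fro (slice (lpauli R P) M') = \prod_i tM i (P i).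
Proof. by apply: fro_slice_tens => s s'; rewrite entry_mkop. Qed.

Lemma fro_tslice_lpauli (P : chain) : fro (tslice (lpauli R P) Z') = \prod_i tZ i (P i).
Proof.
apply: (@fro_slice_tens _ _ _ _ (fun i => (pauli_string R (P i))^T)) => s s'.
by rewrite entry_tr entry_mkop; apply: eq_bigr => i _; rewrite entry_tr.
Qed.

(** The identity string contributes exactly the product of marginals that is subtracted. *)
Lemma tens_decE u : Omega u -> tens_dec u = \sum_(P : chain | P != lpid)
  otens (slice (conjop (circuit u) (lpauli R P)) M') (tslice (lpauli R P) Z').
Proof.
move=> uO; rewrite /tens_dec (jmap_expand _ _ _ lpauli_complete lpauli_herm).
rewrite (bigD1 lpid) //= lpauli_id circuit_unitary // slice1 /tslice trmx1 slice1.
by rewrite addrC addrK.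
Qed.

(** No estimate yet: cross terms between distinct strings average to zero, diagonal ones follow the
    two kernels, and the missing identity string has weight 1. *)
Lemma mean_fro_dec : finite_set Omega ->
  mean (fun u => fro (tens_dec u)) =
  \sum_s chain_term (2 ^+ xi) (fun i => fro (Z i)) (fun i => fro (M i)) s - 1.
Proof.
move=> fin; have ne := @clifford_gates_neq0 R N xi.
have tM1 i : tM i pid = 1 by rewrite /tM pauli_id slice1.
have tZ1 i : tZ i pid = 1 by rewrite /tZ pauli_id /tslice trmx1 slice1.
have cardE : #|{ffun 'I_xi -> bool}|%:R = 2 ^+ xi :> R.
  by rewrite card_ffun card_bool card_ord natrX.
have tMD i : \sum_p tM i p = 2 ^+ xi * fro (M i).
  by rewrite -cardE (sum_fro_slice (@pauli_complete R 'I_xi) (@pauli_herm R 'I_xi)).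
have tZD i : \sum_p tZ i p = 2 ^+ xi * fro (Z i).
  by rewrite -cardE (sum_fro_tslice _ (@pauli_complete R 'I_xi) (@pauli_herm R 'I_xi)).
pose A u P := slice (conjop (circuit u) (lpauli R P)) M'.
pose B P := tslice (lpauli R P) Z'.
pose Phi (Q : chain) := \prod_i tM i (Q i).
have AE u P : Omega u -> fro (A u P) = Phi (act1 u (act0 u P)).
  move=> uO; have [c c1 e] := conjop_circuit P uO.
  by rewrite /A e fro_slice_phase // fro_slice_lpauli.
rewrite -(kernel_total N_gt0 xi_gt0 tM1 tZ1 tMD tZD) (bigD1 lpid) //=.
rewrite -(mean_mixing xi_gt0 Phi lpid fin).
have -> : mean (fun u => Phi (act1 u (act0 u lpid))) = 1.
  rewrite -[RHS](unif_mean_const fin ne); apply: (eq_unif_mean fin) => u uO.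
  rewrite (gateact_id (@even_gate_inj N) (@even_gate_lr N) uO).
  rewrite (gateact_id (@odd_gate_inj N) (@odd_gate_lr N) uO).
  by rewrite /Phi big1 // => i _; rewrite lpidE.
rewrite mulr1 [\prod_i _]big1 => [|i _]; last by rewrite lpidE.
rewrite [RHS]addrC addKr.
transitivity (mean (fun u => \sum_(P : chain | P != lpid) \sum_(Q : chain | Q != lpid)
   complex.Re (\tr (otens (A u P) (B P) *m (otens (A u Q) (B Q))^t*)))).
  apply: (eq_unif_mean fin) => u uO; rewrite tens_decE // fro_trE.
  rewrite mulmx_suml mxtrace_sum Re_sum; apply: eq_bigr => P _.
  have -> : (\sum_(Q : chain | Q != lpid) otens (A u Q) (B Q))^t* =
      \sum_(Q : chain | Q != lpid) (otens (A u Q) (B Q))^t*.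
    by apply: (big_morph (fun X => X^t*)) => [X Y|]; rewrite ?adjD // trmx0 map_mx0.
  by rewrite mulmx_sumr mxtrace_sum Re_sum.
rewrite (unif_mean_sum fin); apply: eq_bigr => P P1.
rewrite -(mean_mixing xi_gt0 Phi P fin) (unif_mean_sum fin) (bigD1 P) //= [X in _ + X]big1.
  rewrite addr0 -(unif_meanZ fin); apply: (eq_unif_mean fin) => u uO.
  by rewrite -fro_trE fro_otens AE // mulrC /B fro_tslice_lpauli.
move=> Q /andP[_ QP]; rewrite eq_sym in QP.
pose Bf (X Y : op R (line N xi)) :=
  complex.Re (\tr (otens (slice X M') (B P) *m (otens (slice Y M') (B Q))^t*)).
have oN (I1 I2 : finType) (X : op R I1) (Y : op R I2) : otens (- X) Y = - otens X Y.
  by apply: op_ext => s t; rewrite entryN !entry_otens entryN mulNr.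
have Bl X Y : Bf (- X) Y = - Bf X Y.
  by rewrite /Bf sliceN oN mulNmx raddfN ReN.
have Br X Y : Bf X (- Y) = - Bf X Y.
  by rewrite /Bf sliceN oN adjN mulmxN raddfN ReN.
exact: (mean_cross xi_gt0 fin Bl Br QP).
Qed.

End SecondMoment.

(** * The decoupling error *)

Section ChoiMap.
Variable R : realType.
Local Notation C := R[i].

Lemma entry_choi (I J : finType) (f : {linear op R I -> op R J}) a a' b b' :
  entry (choi f) (a, b) (a', b') =
  #|I|%:R^-1 * entry (f (delta_mx (enum_rank a) (enum_rank a'))) b b'.
Proof.
rewrite entry_mkop /=.
have -> : mkop (fun c c' => entry (max_entangled R I *m (max_entangled R I)^t*)
    (a, c) (a', c')) = #|I|%:R^-1 *: (delta_mx (enum_rank a) (enum_rank a') : op R I).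
  apply: op_ext => c c'; rewrite entry_mkop entryZ /entry !mxE.
  rewrite big_ord1 !mxE !enum_rankK /= rmorphM rmorph_nat /=.
  have -> : ((sqrtC #|I|%:R)^-1)^* = (sqrtC #|I|%:R)^-1 :> C.
    by apply/CrealP; rewrite rpredV ger0_real // sqrtC_ge0 ler0n.
  rewrite mulrACA -invfM -expr2 sqrtCK -natrM mulnb.
  by rewrite !(inj_eq enum_rank_inj) (eq_sym a) (eq_sym a').
by rewrite linearZ entryZ.
Qed.

Lemma sum_delta (I : finType) (F : I -> C) a : \sum_z (a == z)%:R * F z = F a.
Proof.
rewrite (bigD1 a) //= eqxx mul1r big1 ?addr0 // => z.
by rewrite eq_sym => /negPf->; rewrite mul0r.
Qed.

Lemma entry_sandwich (I J : finType) (X : op R (I * J)) (B D : op R J) a b a' b' :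
  entry (otens 1%:M B *m X *m otens 1%:M D) (a, b) (a', b') =
  \sum_c \sum_c' entry B b c * entry X (a, c) (a', c') * entry D c' b'.
Proof.
rewrite entryM big_pairE exchange_big [RHS]exchange_big; apply: eq_bigr => c' _ /=.
transitivity (\sum_z (a' == z)%:R *
    (entry (otens 1%:M B *m X) (a, b) (z, c') * entry D c' b')).
  by apply: eq_bigr => z _; rewrite entry_otens entry1 /= eq_sym mulrCA.
rewrite (sum_delta (fun z => _ * _)) entryM big_pairE exchange_big mulr_suml.
apply: eq_bigr => c _ /=; congr (_ * _).
transitivity (\sum_z (a == z)%:R * (entry B b c * entry X (z, c) (a', c'))).
  by apply: eq_bigr => z _; rewrite entry_otens entry1 /= mulrA.
by rewrite (sum_delta (fun z => _ * _)).
Qed.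

Lemma entry_sandwich_l (I J : finType) (X : op R (I * J)) (B D : op R I) a b a' b' :
  entry (otens B 1%:M *m X *m otens D 1%:M) (a, b) (a', b') =
  \sum_c \sum_c' entry B a c * entry X (c, b) (c', b') * entry D c' a'.
Proof.
rewrite entryM big_pairE [RHS]exchange_big; apply: eq_bigr => c' _ /=.
transitivity (\sum_z (b' == z)%:R *
    (entry (otens B 1%:M *m X) (a, b) (c', z) * entry D c' a')).
  by apply: eq_bigr => z _; rewrite entry_otens entry1 /= [b' == z]eq_sym mulrA mulrC.
rewrite (sum_delta (fun z => _ * _)) entryM big_pairE mulr_suml.
apply: eq_bigr => c _ /=; congr (_ * _).
transitivity (\sum_z (b == z)%:R * (entry B a c * entry X (c, z) (c', b'))).
  by apply: eq_bigr => z _; rewrite entry_otens entry1 /= mulrAC mulrC.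
by rewrite (sum_delta (fun z => _ * _)).
Qed.

(** The normalizations of the regional Choi states multiply to the inverse dimension of the line,
    cancelling the factor in [jmap]. *)
Lemma decoupling_errorE (N xi : nat) (K E : 'I_(2 * N) -> finType)
    (rho : forall i, op R (region xi * K i))
    (T : forall i, {linear op R (region xi) -> op R (E i)}) (U : op R (line N xi)) :
  decoupling_error rho T U =
  trace_norm (jmap U (tens_bip (fun i => choi (T i))) (tens_bip rho) -
    otens (ptrace_fst (tens_bip (fun i => choi (T i)))) (ptrace_fst (tens_bip rho))).
Proof.
suff E0 : map_fst (tens_map T)
    (conjop (otens U (1%:M : op R {dffun forall i, K i})) (tens_bip rho)) =
    jmap U (tens_bip (fun i => choi (T i))) (tens_bip rho).
  by rewrite /decoupling_error /= E0.
apply: op_ext => -[e k] [e' k']; rewrite !entry_mkop /= mulr_sumr.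
apply: eq_bigr => s _; rewrite mulr_sumr; apply: eq_bigr => s' _.
rewrite !entry_mkop /= [RHS]mulrA mulrC; congr (_ * _).
  under [in RHS]eq_bigr do rewrite entry_choi.
  rewrite big_split /= mulrA prodfV -card_line mulfV ?mul1r //.
  by rewrite pnatr_eq0 -lt0n; apply/card_gt0P; exists s.
rewrite /conjop adj_otens adj1 entry_sandwich_l; apply: eq_bigr => t _.
by apply: eq_bigr => t' _; rewrite entry_adj.
Qed.

End ChoiMap.

Section TensorFamilies.
Variables (R : realType) (L : finType).
Local Notation C := R[i].

Definition otens_fam (E : L -> finType) (g : forall i, op R (E i)) :
    op R {dffun forall i, E i} :=
  mkop (fun e e' : {dffun forall i, E i} => \prod_i entry (g i) (e i) (e' i)).

Lemma adj_otens_fam (E : L -> finType) (g : forall i, op R (E i)) :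
  (otens_fam g)^t* = otens_fam (fun i => (g i)^t*).
Proof.
apply: op_ext => e e'; rewrite entry_adj !entry_mkop rmorph_prod.
by apply: eq_bigr => i _; rewrite entry_adj.
Qed.

Lemma otens_famM (E : L -> finType) (g h : forall i, op R (E i)) :
  otens_fam g *m otens_fam h = otens_fam (fun i => g i *m h i).
Proof.
apply: op_ext => e e'; rewrite entryM entry_mkop.
under [RHS]eq_bigr do rewrite entryM.
rewrite -(big_dffun_distr (fun i c => entry (g i) (e i) c * entry (h i) c (e' i))).
by apply: eq_bigr => c _; rewrite !entry_mkop big_split.
Qed.

Lemma fro_otens_fam (E : L -> finType) (g : forall i, op R (E i)) :
  fro (otens_fam g) = \prod_i fro (g i).
Proof.
under [RHS]eq_bigr do rewrite fro_entry.
rewrite -(big_dffun_distr (fun i e => \sum_e' sqn (entry (g i) e e'))).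
rewrite fro_entry; apply: eq_bigr => e _.
rewrite -(big_dffun_distr (fun i e' => sqn (entry (g i) (e i) e'))).
by apply: eq_bigr => e' _; rewrite entry_mkop sqn_prod.
Qed.

Variables (A B : L -> finType).

Lemma tens_bip_sandwich (X : forall i, op R (A i * B i)) (g h : forall i, op R (B i)) :
  tens_bip (fun i => otens 1%:M (g i) *m X i *m otens 1%:M (h i)) =
  otens 1%:M (otens_fam g) *m tens_bip X *m otens 1%:M (otens_fam h).
Proof.
apply: op_ext => -[a b] [a' b']; rewrite entry_sandwich entry_mkop /=.
under [LHS]eq_bigr do rewrite entry_sandwich.
rewrite -(big_dffun_distr (fun i c => \sum_c' entry (g i) (b i) c *
  entry (X i) (a i, c) (a' i, c') * entry (h i) c' (b' i))); apply: eq_bigr => c _.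
rewrite -(big_dffun_distr (fun i c' => entry (g i) (b i) (c i) *
  entry (X i) (a i, c i) (a' i, c') * entry (h i) c' (b' i))); apply: eq_bigr => c' _.
by rewrite !big_split /= !entry_mkop.
Qed.

Lemma psd_tens_bip (X : forall i, op R (A i * B i)) :
  (forall i, psd (X i)) -> psd (tens_bip X).
Proof.
move=> Xp.
pose F i := projT1 (cid (psd_entry_factor (Xp i))).
have FE i x y : entry (X i) x y = \sum_k F i x k * ((F i y k)^*)%R.
  exact: (projT2 (cid (psd_entry_factor (Xp i)))).
pose T i : finType := (A i * B i)%type.
apply: (@psd_entry R ({dffun forall i, A i} * {dffun forall i, B i})%type
  {dffun forall i, T i} (fun x k => \prod_i F i (x.1 i, x.2 i) (k i))) => x y.
rewrite entry_mkop; under [LHS]eq_bigr do rewrite FE.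
rewrite -(big_dffun_distr (fun i (k : T i) => F i (x.1 i, x.2 i) k *
  ((F i (y.1 i, y.2 i) k)^*)%R)); apply: eq_bigr => k _.
by rewrite big_split rmorph_prod.
Qed.

Lemma tr_tens_bip (X : forall i, op R (A i * B i)) :
  \tr (tens_bip X) = \prod_i \tr (X i).
Proof.
under [RHS]eq_bigr do rewrite tr_entry big_pairE.
rewrite -(big_dffun_distr (fun i a => \sum_b entry (X i) (a, b) (a, b))).
rewrite tr_entry big_pairE; apply: eq_bigr => a _.
rewrite -(big_dffun_distr (fun i b => entry (X i) (a i, b) (a i, b))).
by apply: eq_bigr => b _; rewrite entry_mkop.
Qed.

End TensorFamilies.

Section StateBound.
Variables (R : realType) (N xi : nat).
Hypotheses (N_gt0 : (0 < N)%N) (xi_gt0 : (0 < xi)%N).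
Local Notation C := R[i].
Local Notation L := 'I_(2 * N).
Local Notation Omega := (@clifford_gates R N xi).
Local Notation mean := (unif_mean Omega).
Hypothesis fin : finite_set Omega.
Variables (E K : L -> finType).
Implicit Types (M : forall i, op R (region xi * E i)) (Z : forall i, op R (region xi * K i)).
Implicit Types (W : gates R N xi -> op R ({dffun forall i, E i} * {dffun forall i, K i})).

Lemma slice_sandwich (S J : finType) (A : op R S) (X : op R (S * J)) (g h : op R J) :
  slice A (otens 1%:M g *m X *m otens 1%:M h) = g *m slice A X *m h.
Proof.
apply: op_ext => b b'; rewrite entry_slice entryM.
transitivity (\sum_c' \sum_c \sum_s \sum_s' entry g b c *
    (entry A s s' * entry X (s, c) (s', c')) * entry h c' b').
  transitivity (\sum_s \sum_s' \sum_c' \sum_c entry g b c *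
      (entry A s s' * entry X (s, c) (s', c')) * entry h c' b').
    apply: eq_bigr => s _; apply: eq_bigr => s' _; rewrite entry_sandwich exchange_big mulr_sumr.
    apply: eq_bigr => c' _ /=; rewrite mulr_sumr; apply: eq_bigr => c _.
    by rewrite !mulrA [entry A s s' * _]mulrC.
  under eq_bigr do rewrite exchange_big /=; rewrite exchange_big /=.
  apply: eq_bigr => c' _.
  by under eq_bigr do rewrite exchange_big /=; rewrite exchange_big /=.
apply: eq_bigr => c' _; rewrite entryM mulr_suml; apply: eq_bigr => c _.
rewrite entry_slice mulr_sumr mulr_suml; apply: eq_bigr => s _.
by rewrite mulr_sumr mulr_suml.
Qed.

(** The weights act on [E] and [K] only, hence pass through the slicing over the line in every Pauli
    term. *)
Lemma tens_dec_sandwich M Z (g : forall i, op R (E i)) (h : forall i, op R (K i)) u :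
  tens_dec (fun i => otens 1%:M (g i) *m M i *m otens 1%:M (g i))
    (fun i => otens 1%:M (h i) *m Z i *m otens 1%:M (h i)) u =
  otens (otens_fam g) (otens_fam h) *m tens_dec M Z u *m
  otens (otens_fam g) (otens_fam h).
Proof.
rewrite /tens_dec !tens_bip_sandwich !ptrace_otens1.
rewrite mulmxBr mulmxBl !otensM; congr (_ - _).
rewrite !(jmap_expand _ _ _ (@lpauli_complete R N xi) (@lpauli_herm R N xi)).
rewrite mulmx_sumr mulmx_suml; apply: eq_bigr => P _.
by rewrite /tslice !slice_sandwich !otensM.
Qed.

Lemma powR_sum (I : finType) (f : I -> R) : \prod_i 2 `^ (f i) = 2 `^ (\sum_i f i).
Proof.
have h r s : 2 `^ (r + s) = 2 `^ r * 2 `^ s :> R by rewrite powRD // pnatr_eq0 implybT.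
by rewrite (big_morph _ h (powRr0 2)).
Qed.

Lemma conditional_choice (T : L -> finType) (X : forall i, op R (region xi * T i)) :
  (forall i, state (X i)) -> exists (Y : forall i, op R (region xi * T i))
    (g : forall i, op R (T i)),
  [/\ X = (fun i => otens 1%:M (g i) *m Y i *m otens 1%:M (g i)),
      forall i, (g i)^t* = g i /\ fro (g i *m g i) = 1,
      forall i, fro (ptrace_fst (Y i)) = 1,
      forall i, fro (Y i) = 2 `^ (- H2 (X i)) &
      forall i, 1 <= 2 ^+ xi * fro (Y i) /\ fro (Y i) <= 2 ^+ xi].
Proof.
move=> Xs; have cardE : #|region xi|%:R = 2 ^+ xi :> R.
  by rewrite card_ffun card_bool card_ord natrX.
pose Y i := projT1 (cid (state_conditional (Xs i))).
pose g i := projT1 (cid (projT2 (cid (state_conditional (Xs i))))).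
have H i : [/\ X i = otens 1%:M (g i) *m Y i *m otens 1%:M (g i), psd (Y i),
    (g i)^t* = g i /\ fro (g i *m g i) = 1, ptrace_fst (Y i) = g i *m g i &
    fro (Y i) = 2 `^ (- H2 (X i))].
  exact: (projT2 (cid (projT2 (cid (state_conditional (Xs i)))))).
exists Y, g; split.
- by apply: functional_extensionality_dep => i; case: (H i).
- by move=> i; case: (H i).
- by move=> i; case: (H i) => _ _ [_ h] -> _.
- by move=> i; case: (H i).
- move=> i; case: (H i) => _ Yp [_ h] pE _.
  have := fro_ptrace_le (Y i); have := fro_le_ptrace Yp.
  by rewrite pE h mulr1 cardE.
Qed.

Lemma mean_contraction_bound M Z W :
  (forall i, state (M i)) -> (forall i, state (Z i)) -> (forall u, contraction (W u)) ->
  mean (fun u => complex.Re (\tr (W u *m tens_dec M Z u))) <=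
  entropy_bound xi (fun i => H2 (M i)) (fun i => H2 (Z i)).
Proof.
move=> Ms Zs Wc; have ne := @clifford_gates_neq0 R N xi.
have [Mt [g [ME gh M1 yE _]]] := conditional_choice Ms.
have [Zt [h [ZE hh Z1 xE xD]]] := conditional_choice Zs.
pose G := otens (otens_fam g) (otens_fam h).
have Gh : G^t* = G.
  rewrite /G adj_otens !adj_otens_fam; congr (otens (otens_fam _) (otens_fam _)).
    by apply: functional_extensionality_dep => i; case: (gh i).
  by apply: functional_extensionality_dep => i; case: (hh i).
have GG : fro (G *m G) = 1.
  rewrite /G otensM !otens_famM fro_otens !fro_otens_fam !big1 ?mulr1 // => i _.
    by case: (hh i).
  by case: (gh i).
apply: (@le_trans _ _ (mean (fun u => Num.sqrt (fro (tens_dec Mt Zt u))))).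
  apply: (le_unif_mean fin) => u uO; rewrite ME ZE tens_dec_sandwich.
  apply: (le_trans (contraction_weighted _ (Wc u) Gh)).
  by rewrite GG sqrtr1 mul1r.
apply: (@le_trans _ _ (Num.sqrt (mean (fun u => fro (tens_dec Mt Zt u))))).
  apply: (le_trans (ler_norm _)); rewrite -sqrtr_sqr ler_wsqrtr //.
  apply: (le_trans (unif_mean_sqr fin ne _)); apply: (le_unif_mean fin) => u uO.
  by rewrite sqr_sqrtr ?fro_ge0.
rewrite /entropy_bound ler_wsqrtr // (mean_fro_dec N_gt0 xi_gt0 M1 Z1 fin).
(* [m] dominates both the squared norms and their inverses, as the chain bound demands. *)
pose m : R := \big[Num.max/0]_i Num.max (2 `^ (- H2 (Z i))) (2 `^ (H2 (Z i))).
have mle i : Num.max (2 `^ (- H2 (Z i))) (2 `^ (H2 (Z i))) <= m.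
  exact: le_bigmax.
have xM i : fro (Zt i) <= m by rewrite xE; apply: le_trans (mle i); rewrite le_max lexx.
have xM' i : 1 <= m * fro (Zt i).
  have p0 : 0 < 2 `^ (- H2 (Z i)) :> R by rewrite powR_gt0.
  rewrite xE -[leLHS](@powRr0 R 2) -(subrr (H2 (Z i))) powRD ?pnatr_eq0 ?implybT //.
  by rewrite ler_pM2r //; apply: le_trans (mle i); rewrite le_max lexx orbT.
have D1 : 1 < 2 ^+ xi :> R by rewrite exprn_egt1 ?ltr1n // -lt0n.
have cb := chain_bound N_gt0 D1 (fun i => (xD i).2) (fun i => (xD i).1)
  (fun i => fro_ge0 (Mt i)) xM xM'.
apply: (le_trans (lerB cb (lexx 1))).
rewrite addrAC [1 + _]addrC addrK; apply: lerD.
  under eq_bigr do rewrite xE yE.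
  by rewrite big_split /= !powR_sum -powRD ?pnatr_eq0 ?implybT // !sumrN addrC.
rewrite le_eqVlt; apply/orP; left; apply/eqP; congr (_ * _).
  by rewrite /decoupling_cst -/m (exprS (2 : R) xi) (mulnC 2 xi) (exprM (2 : R) xi 2).
apply: eq_bigr => i _; rewrite xE yE -powRD ?pnatr_eq0 ?implybT //.
by rewrite [_ + _]addrC.
Qed.

(** A Gram index of [X] together with one of [Y] labels an amplitude [B]; the factor [sqrtC #|S|%:R]
    shares the normalization of [jmap] between the two sides. *)
Lemma psd_jmap (S I J : finType) (U : op R S) (X : op R (S * I)) (Y : op R (S * J)) :
  psd X -> psd Y -> psd (jmap U X Y).
Proof.
move=> /psd_entry_factor[F XE] /psd_entry_factor[G YE].
pose B (x : (I * J)%type) (k : (S * I) * (S * J)) : C := sqrtC #|S|%:R *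
  ((\sum_s F (s, x.1) k.1 * \sum_t entry U s t * G (t, x.2) k.2)).
apply: (psd_entry (B := B)) => x y; rewrite entry_mkop big_pairE.
transitivity (\sum_k \sum_l #|S|%:R * \sum_s \sum_s' \sum_t \sum_t'
    (F (s, x.1) k * ((F (s', y.1) k)^*)%R) *
    (entry U s t * (G (t, x.2) l * ((G (t', y.2) l)^*)%R) * ((entry U s' t')^*)%R)).
  transitivity (#|S|%:R * \sum_s \sum_s' \sum_k \sum_l \sum_t \sum_t'
    (F (s, x.1) k * ((F (s', y.1) k)^*)%R) *
    (entry U s t * (G (t, x.2) l * ((G (t', y.2) l)^*)%R) * ((entry U s' t')^*)%R)).
    congr (_ * _); apply: eq_bigr => s _; apply: eq_bigr => s' _.
    rewrite XE mulr_suml; apply: eq_bigr => k _.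
    transitivity (F (s, x.1) k * ((F (s', y.1) k)^*)%R * \sum_l \sum_t \sum_t'
      (entry U s t * (G (t, x.2) l * ((G (t', y.2) l)^*)%R) * ((entry U s' t')^*)%R)).
      congr (_ * _).
      transitivity (\sum_t \sum_t' \sum_l
        (entry U s t * (G (t, x.2) l * ((G (t', y.2) l)^*)%R) * ((entry U s' t')^*)%R)).
        apply: eq_bigr => t _; apply: eq_bigr => t' _.
        by rewrite YE mulr_sumr mulr_suml.
      by under eq_bigr do rewrite exchange_big /=; rewrite exchange_big /=.
    rewrite mulr_sumr; apply: eq_bigr => l _; rewrite mulr_sumr; apply: eq_bigr => t _.
    by rewrite mulr_sumr.
  rewrite [RHS](eq_bigr (fun k => #|S|%:R * \sum_l \sum_s \sum_s' \sum_t \sum_t'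
    (F (s, x.1) k * ((F (s', y.1) k)^*)%R) *
    (entry U s t * (G (t, x.2) l * ((G (t', y.2) l)^*)%R) * ((entry U s' t')^*)%R)));
    last by move=> k _; rewrite mulr_sumr.
  rewrite -mulr_sumr; congr (_ * _).
  under eq_bigr do rewrite exchange_big /=.
  rewrite exchange_big /=; apply: eq_bigr => k _.
  under eq_bigr do rewrite exchange_big /=.
  by rewrite exchange_big.
apply: eq_bigr => k _; apply: eq_bigr => l _.
have sq : sqrtC #|S|%:R * ((sqrtC #|S|%:R)^*) = #|S|%:R :> C.
  have -> : (sqrtC #|S|%:R)^* = sqrtC #|S|%:R :> C.
    by apply/CrealP; rewrite ger0_real // sqrtC_ge0 ler0n.
  by rewrite -expr2 sqrtCK.
rewrite /B rmorphM /= mulrACA sq; congr (_ * _).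
rewrite rmorph_sum big_distrlr /=; apply: eq_bigr => s _; apply: eq_bigr => s' _.
rewrite rmorphM rmorph_sum /= mulrACA big_distrlr mulr_sumr; apply: eq_bigr => t _ /=.
rewrite mulr_sumr; apply: eq_bigr => t' _; rewrite rmorphM /=; congr (_ * _).
by rewrite mulrA -[LHS]mulrA; congr (_ * _); apply: mulrC.
Qed.

Lemma tr_jmap (u : gates R N xi) M Z : \tr (jmap (circuit u) (tens_bip M) (tens_bip Z)) =
  \sum_P \tr (slice (conjop (circuit u) (lpauli R P)) (tens_bip M)) *
    \tr (tslice (lpauli R P) (tens_bip Z)).
Proof.
rewrite (jmap_expand _ _ _ (@lpauli_complete R N xi) (@lpauli_herm R N xi)) mxtrace_sum.
by apply: eq_bigr => P _; rewrite tr_otens.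
Qed.

(** A single output may have a different trace, since the map need not preserve traces; on average
    all strings but the identity drop out. *)
Lemma mean_tr_jmap M Z : mean (fun u => complex.Re (\tr (jmap (circuit u) (tens_bip M)
    (tens_bip Z)))) = complex.Re (\tr (tens_bip M) * \tr (tens_bip Z)).
Proof.
have ne := @clifford_gates_neq0 R N xi.
transitivity (mean (fun u => \sum_P complex.Re
    (\tr (slice (conjop (circuit u) (lpauli R P)) (tens_bip M)) *
    \tr (tslice (lpauli R P) (tens_bip Z))))).
  by apply: (eq_unif_mean fin) => u _; rewrite tr_jmap Re_sum.
rewrite (unif_mean_sum fin) (bigD1 (lpid N xi)) //= big1 ?addr0 => [|P P1].
  rewrite -[RHS](unif_mean_const fin ne); apply: (eq_unif_mean fin) => u uO.
  by rewrite lpauli_id circuit_unitary // /tslice trmx1 !slice1 !tr_ptrace.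
(* The vanishing is read off from [mean_cross] with the identity string in the second place, which
   contributes only the nonzero constant [c]. *)
pose Bf (X Y : op R (line N xi)) : R := complex.Re (\tr (slice X (tens_bip M)) *
  \tr (tslice (lpauli R P) (tens_bip Z))) * complex.Re (\tr Y).
have Bl X Y : Bf (- X) Y = - Bf X Y.
  by rewrite /Bf sliceN raddfN mulNr ReN mulNr.
have Br X Y : Bf X (- Y) = - Bf X Y.
  by rewrite /Bf raddfN ReN mulrN.
have := mean_cross xi_gt0 fin Bl Br P1.
set c := complex.Re (\tr (1%:M : op R (line N xi))).
have c0 : c != 0.
  rewrite /c mxtrace1 -(rmorph_nat (real_complex R)) /= pnatr_eq0 -lt0n.
  by apply/card_gt0P; exists [ffun=> [ffun=> true]].
set f := fun u => complex.Re _; move=> h; apply: (mulfI c0); rewrite mulr0 -[RHS]h.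
rewrite -(unif_meanZ fin); apply: (eq_unif_mean fin) => u uO.
by rewrite /Bf lpauli_id circuit_unitary // mulrC.
Qed.

End StateBound.

(** * Smoothing *)

Section Hybrid.
Variable R : realType.
Local Notation C := R[i].

Lemma contractionN n (W : 'M[C]_n) : contraction W -> contraction (- W).
Proof. by move=> [l r]; split=> m B; rewrite ?mulNmx ?mulmxN froN. Qed.

Lemma Re_prod_ge0 (I : finType) (F : I -> C) : (forall i, 0 <= F i) ->
  complex.Re (\prod_i F i) = \prod_i complex.Re (F i).
Proof.
move=> F0; rewrite (eq_bigr (fun i => (complex.Re (F i))%:C%C)) => [|i _].
  by rewrite -(rmorph_prod (real_complex R)).
exact: ge0_ReE.
Qed.

(** A trace distance bound carried by explicit positive parts, which can be put into one tensor slot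
    while all slots stay positive. *)
Definition psd_close n (eps : R) (x y : 'M[C]_n) : Prop := exists P Q : 'M[C]_n,
  [/\ psd P, psd Q, x - y = P - Q & complex.Re (\tr P) + complex.Re (\tr Q) <= eps].

Lemma psd_closexx n (x : 'M[C]_n) : psd_close 0 x x.
Proof.
exists 0, 0; split; rewrite ?subrr //; last by rewrite mxtrace0 addr0.
  by move=> v; rewrite mulmx0 mul0mx mxE.
by move=> v; rewrite mulmx0 mul0mx mxE.
Qed.

Section Replace.
Variables (n : nat) (I J : 'I_n -> finType).

Definition replace_at (h : forall i, op R (I i * J i)) k (a : op R (I k * J k)) :
    forall i, op R (I i * J i) :=
  @eqtype.dfwith _ (fun i => op R (I i * J i)) h k a.

(** Telescoping over [h j], which takes [g] below [j] and [f] from [j] on. In each step the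
    difference splits into positive [P] and [Q]; the other slots have trace 1, so the step costs at
    most [tr P + tr Q]. *)
Lemma hybrid (Phi : (forall i, op R (I i * J i)) -> R)
    (f g : forall i, op R (I i * J i)) (eps : R) :
  (forall h k (a b : op R (I k * J k)),
     Phi (replace_at h (a - b)) = Phi (replace_at h a) - Phi (replace_at h b)) ->
  (forall h, (forall i, psd (h i)) -> `|Phi h| <= \prod_i complex.Re (\tr (h i))) ->
  (forall i, state (f i)) -> (forall i, state (g i)) ->
  (forall i, psd_close eps (f i) (g i)) -> `|Phi f - Phi g| <= n%:R * eps.
Proof.
move=> lin bnd fs gs close.
pose h (j : nat) (i : 'I_n) := if (i < j)%N then g i else f i.
have h0 : h 0 = f by apply: functional_extensionality_dep.
have hn : h n = g by apply: functional_extensionality_dep => i; rewrite /h ltn_ord.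
have hs j i : state (h j i) by rewrite /h; case: ifP.
have step (j : 'I_n) : `|Phi (h j) - Phi (h j.+1)| <= eps.
  have [P [Q [Pp Qp e le]]] := close j.
  have E1 : h j = replace_at (h j) (f j).
    apply: functional_extensionality_dep => i; rewrite /replace_at; case: eqtype.dfwithP => //.
    by rewrite /h ltnn.
  have E2 : h j.+1 = replace_at (h j) (g j).
    apply: functional_extensionality_dep => i; rewrite /replace_at; case: eqtype.dfwithP => [|k jk].
      by rewrite /h ltnSn.
    by rewrite /h ltnS leq_eqVlt eq_sym (inj_eq val_inj) (negPf jk).
  have B (X : op R (I j * J j)) : psd X -> `|Phi (replace_at (h j) X)| <= complex.Re (\tr X).
    move=> Xp; apply: (le_trans (bnd _ _)).
      by move=> i; rewrite /replace_at; case: eqtype.dfwithP => // k _; case: (hs j k).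
    rewrite /replace_at (bigD1 j) //= dfwith_in big1 ?mulr1 // => k kj.
    by rewrite dfwith_out 1?eq_sym //; case: (hs j k) => _ ->.
  rewrite E2 [in X in X - _]E1 -lin e lin; apply: le_trans le.
  by apply: (le_trans (ler_normB _ _)); apply: lerD; apply: B.
suff H j : (j <= n)%N -> `|Phi (h 0) - Phi (h j)| <= j%:R * eps.
  by rewrite -h0 -hn; apply: H.
elim: j => [_|j IH jn]; first by rewrite subrr normr0 mul0r.
rewrite -(subrK (Phi (h j)) (Phi (h 0))) -addrA; apply: (le_trans (ler_normD _ _)).
rewrite -natr1 mulrDl mul1r; apply: lerD; first exact/IH/ltnW.
exact: (step (Ordinal jn)).
Qed.

End Replace.

End Hybrid.

Section Smoothing.
Variables (R : realType) (N xi : nat).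
Hypotheses (N_gt0 : (0 < N)%N) (xi_gt0 : (0 < xi)%N).
Local Notation C := R[i].
Local Notation L := 'I_(2 * N).
Local Notation Omega := (@clifford_gates R N xi).
Local Notation mean := (unif_mean Omega).
Hypothesis fin : finite_set Omega.
Variables (E K : L -> finType).
Local Notation opE := (op R (line N xi * {dffun forall i, E i})).
Local Notation opK := (op R (line N xi * {dffun forall i, K i})).
Local Notation opEK := (op R ({dffun forall i, E i} * {dffun forall i, K i})).
Variable W : gates R N xi -> opEK.
Hypothesis Wc : forall u, contraction (W u).

Lemma tens_bip_dfwith (A B : L -> finType) (h : forall i, op R (A i * B i)) k
    (a b : op R (A k * B k)) :
  tens_bip (replace_at h (a - b)) = tens_bip (replace_at h a) - tens_bip (replace_at h b).
Proof.
apply: op_ext => x y; rewrite entryD entryN.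
have eq_c c : entry (tens_bip (replace_at h c)) x y =
    entry c (x.1 k, x.2 k) (y.1 k, y.2 k) *
    \prod_(i | i != k) entry (h i) (x.1 i, x.2 i) (y.1 i, y.2 i).
  rewrite entry_mkop (bigD1 k) //= /replace_at dfwith_in; congr (_ * _).
  by apply: eq_bigr => i ik; rewrite dfwith_out 1?eq_sym.
by rewrite !eq_c entryD entryN mulrBl.
Qed.

Section Form.
Variable F : gates R N xi -> opE -> opK -> opEK.
Hypotheses (Fl : forall u X Y Z, F u (X - Y) Z = F u X Z - F u Y Z)
  (Fr : forall u X Y Z, F u X (Y - Z) = F u X Y - F u X Z)
  (Fp : forall u X Y, psd X -> psd Y -> psd (F u X Y)).
Hypothesis Ft : forall (M : forall i, op R (region xi * E i))
  (Z : forall i, op R (region xi * K i)),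
  mean (fun u => complex.Re (\tr (F u (tens_bip M) (tens_bip Z)))) =
  complex.Re (\tr (tens_bip M) * \tr (tens_bip Z)).

(** Both halves of the decoupling error are of this kind: the output of the circuit, and the product
    of marginals, which is constant in [u]. The trace condition [Ft] is asked in the mean, which is
    what the output satisfies. *)
Definition mean_form (M : forall i, op R (region xi * E i))
    (Z : forall i, op R (region xi * K i)) : R :=
  mean (fun u => complex.Re (\tr (W u *m F u (tens_bip M) (tens_bip Z)))).

(** For each [u] the contraction leaves at most the trace of a positive operator; the mean trace is
    then known from [Ft]. *)
Lemma mean_form_bound M Z : (forall i, psd (M i)) -> (forall i, psd (Z i)) ->
  `|mean_form M Z| <= (\prod_i complex.Re (\tr (M i))) * \prod_i complex.Re (\tr (Z i)).
Proof.
move=> Mp Zp.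
have Mt : psd (tens_bip M) by apply: psd_tens_bip.
have Zt : psd (tens_bip Z) by apply: psd_tens_bip.
have -> : (\prod_i complex.Re (\tr (M i))) * \prod_i complex.Re (\tr (Z i)) =
    mean (fun u => complex.Re (\tr (F u (tens_bip M) (tens_bip Z)))).
  rewrite Ft -!Re_prod_ge0; try by move=> i; apply: psd_tr.
  have -> : \tr (tens_bip M) = (complex.Re (\tr (tens_bip M)))%:C%C.
    exact/ge0_ReE/psd_tr.
  by rewrite ReZ !tr_tens_bip.
rewrite ler_norml -(unif_meanN fin); apply/andP; split; apply: (le_unif_mean fin) => u uO.
  rewrite lerNl -ReN -raddfN -mulNmx.
  by apply: contraction_psd; [apply: contractionN | apply: Fp].
by apply: contraction_psd => //; apply: Fp.
Qed.

Lemma mean_form_close M M' Z Z' (eM eZ : R) :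
  (forall i, state (M i)) -> (forall i, state (M' i)) ->
  (forall i, state (Z i)) -> (forall i, state (Z' i)) ->
  (forall i, psd_close eM (M i) (M' i)) -> (forall i, psd_close eZ (Z i) (Z' i)) ->
  `|mean_form M Z - mean_form M' Z'| <= (2 * N)%:R * eM + (2 * N)%:R * eZ.
Proof.
move=> Ms Ms' Zs Zs' cM cZ.
have st (T : L -> finType) (X : forall i, op R (region xi * T i)) :
    (forall i, state (X i)) ->
    (forall i, psd (X i)) /\ \prod_i complex.Re (\tr (X i)) = 1.
  move=> Xs; split=> [i|]; first by case: (Xs i).
  by rewrite big1 // => i _; case: (Xs i) => _ ->.
have [Zp Z1] := st _ _ Zs; have [Mp' M1'] := st _ _ Ms'.
rewrite -(subrK (mean_form M' Z) (mean_form M Z)) -addrA.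
apply: (le_trans (ler_normD _ _)); apply: lerD.
  apply: (hybrid (Phi := fun X => mean_form X Z)) => // [h k a b|h hp].
    rewrite /mean_form -(unif_meanN fin) -(unif_meanD fin).
    apply: (eq_unif_mean fin) => u uO.
    by rewrite tens_bip_dfwith Fl mulmxBr mxtraceD raddfN ReB.
  by apply: (le_trans (mean_form_bound hp Zp)); rewrite Z1 mulr1.
apply: (hybrid (Phi := fun X => mean_form M' X)) => // [h k a b|h hp].
  rewrite /mean_form -(unif_meanN fin) -(unif_meanD fin).
  apply: (eq_unif_mean fin) => u uO.
  by rewrite tens_bip_dfwith Fr mulmxBr mxtraceD raddfN ReB.
by apply: (le_trans (mean_form_bound Mp' hp)); rewrite M1' mul1r.
Qed.

End Form.

Lemma jmapBl (S I J : finType) (U : op R S) (X Y : op R (S * I)) (Z : op R (S * J)) :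
  jmap U (X - Y) Z = jmap U X Z - jmap U Y Z.
Proof.
apply: op_ext => x y; rewrite entryD entryN !entry_mkop -mulrBr -sumrB; congr (_ * _).
apply: eq_bigr => s _; rewrite -sumrB; apply: eq_bigr => s' _.
by rewrite entryD entryN mulrBl.
Qed.

Lemma jmapBr (S I J : finType) (U : op R S) (X : op R (S * I)) (Y Z : op R (S * J)) :
  jmap U X (Y - Z) = jmap U X Y - jmap U X Z.
Proof.
apply: op_ext => x y; rewrite entryD entryN !entry_mkop -mulrBr -sumrB; congr (_ * _).
apply: eq_bigr => s _; rewrite -sumrB; apply: eq_bigr => s' _.
rewrite -mulrBr; congr (_ * _); rewrite -sumrB; apply: eq_bigr => t _.
rewrite -sumrB; apply: eq_bigr => t' _.
by rewrite entryD entryN mulrBr mulrBl.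
Qed.

Lemma ptraceB (I J : finType) (X Y : op R (I * J)) :
  ptrace_fst (X - Y) = ptrace_fst X - ptrace_fst Y.
Proof.
apply: op_ext => x y; rewrite entryD entryN !entry_ptrace -sumrB.
by apply: eq_bigr => a _; rewrite entryD entryN.
Qed.

Lemma otensBl (I J : finType) (X Y : op R I) (Z : op R J) :
  otens (X - Y) Z = otens X Z - otens Y Z.
Proof.
by apply: op_ext => x y; rewrite entryD entryN !entry_otens entryD entryN mulrBl.
Qed.

Lemma otensBr (I J : finType) (X : op R I) (Y Z : op R J) :
  otens X (Y - Z) = otens X Y - otens X Z.
Proof.
by apply: op_ext => x y; rewrite entryD entryN !entry_otens entryD entryN mulrBr.
Qed.

(** The leading 2 counts the forms [F1] and [F2], smoothed separately because each preserves
    positivity while their difference need not. *)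
Lemma smoothed_bound (M M' : forall i, op R (region xi * E i))
    (Z Z' : forall i, op R (region xi * K i)) (eM eZ : R) :
  (forall i, state (M i)) -> (forall i, state (M' i)) ->
  (forall i, state (Z i)) -> (forall i, state (Z' i)) ->
  (forall i, psd_close eM (M i) (M' i)) -> (forall i, psd_close eZ (Z i) (Z' i)) ->
  mean (fun u => complex.Re (\tr (W u *m tens_dec M Z u))) <=
  2 * ((2 * N)%:R * eM + (2 * N)%:R * eZ) +
  entropy_bound xi (fun i => H2 (M' i)) (fun i => H2 (Z' i)).
Proof.
move=> Ms Ms' Zs Zs' cM cZ; have ne := @clifford_gates_neq0 R N xi.
pose F1 (u : gates R N xi) (X : opE) (Y : opK) : opEK := jmap (circuit u) X Y.
pose F2 (u : gates R N xi) (X : opE) (Y : opK) : opEK :=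
  otens (ptrace_fst X) (ptrace_fst Y).
have c1 : `|mean_form F1 M Z - mean_form F1 M' Z'| <= (2 * N)%:R * eM + (2 * N)%:R * eZ.
  apply: mean_form_close => //.
  - by move=> u X Y T; apply: jmapBl.
  - by move=> u X Y T; apply: jmapBr.
  - by move=> u X Y; apply: psd_jmap.
  - by move=> X Y; apply: mean_tr_jmap.
have c2 : `|mean_form F2 M Z - mean_form F2 M' Z'| <= (2 * N)%:R * eM + (2 * N)%:R * eZ.
  apply: mean_form_close => //.
  - by move=> u X Y T; rewrite /F2 ptraceB otensBl.
  - by move=> u X Y T; rewrite /F2 ptraceB otensBr.
  - by move=> u X Y Xp Yp; apply: psd_otens; apply: psd_ptrace.
  - by move=> X Y; rewrite /F2 (unif_mean_const fin ne) tr_otens !tr_ptrace.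
have dE X Y : mean (fun u => complex.Re (\tr (W u *m tens_dec X Y u))) =
    mean_form F1 X Y - mean_form F2 X Y.
  rewrite /mean_form -(unif_meanN fin) -(unif_meanD fin).
  apply: (eq_unif_mean fin) => u uO.
  by rewrite /tens_dec mulmxBr mxtraceD raddfN ReB.
have b := mean_contraction_bound N_gt0 xi_gt0 fin Ms' Zs' Wc.
rewrite dE in b; rewrite dE.
move: c1 c2 b; rewrite !ler_norml => /andP[_ a1] /andP[a2 _] b.
move: a1 a2 b; move: (mean_form _ _ _) (mean_form _ _ _) (mean_form _ _ _) (mean_form _ _ _).
move=> x y z t a1 a2 b; lra.
Qed.

End Smoothing.

(** * Approaching the suprema in the smooth entropies *)

Section Limit.
Variable R : realType.

Lemma two_powRD (r s : R) : 2 `^ (r + s) = 2 `^ r * 2 `^ s.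
Proof. by rewrite powRD // pnatr_eq0 implybT. Qed.

Lemma two_powR_gt0 (r : R) : 0 < 2 `^ r :> R.
Proof. by rewrite powR_gt0. Qed.

Lemma log2K (r : R) : log2 (2 `^ r) = r.
Proof. by rewrite /log2 ln_powR mulfK // gt_eqF // ln_gt0 // ltr1n. Qed.

Lemma H2_le (I J : finType) (s : op R (I * J)) : state s -> H2 s <= log2 #|I|%:R.
Proof.
move=> ss; have [rt [g [_ _ [_ g1] pt f]]] := state_conditional ss.
have := fro_ptrace_le rt; rewrite pt g1 f powRN.
rewrite ler_pdivlMr ?two_powR_gt0 // mul1r => le.
rewrite -(log2K (H2 s)) /log2 ler_pM2r ?invr_gt0 ?ln_gt0 ?ltr1n //.
by rewrite ler_ln ?posrE ?two_powR_gt0 // (lt_le_trans (two_powR_gt0 _) le).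
Qed.

Variables N xi : nat.
Implicit Types g h : 'I_(2 * N) -> R.

Lemma entropy_bound_ge0 g h : 0 <= entropy_bound xi g h.
Proof. exact: sqrtr_ge0. Qed.

(** [entropy_bound] need not be monotone in [h], whose powers of both signs enter the constant;
    hence [h'] is confined from both sides. Each of the [2 * N] regions loses one factor [q] through
    [g] and one through [h], which makes the exponent [4 * N]. *)
Lemma entropy_bound_le g h g' h' (t q : R) : 0 <= t -> q = 2 `^ t ->
  (forall i, g i - t <= g' i) -> (forall i, h i - t <= h' i <= h i) ->
  entropy_bound xi g' h' <= Num.sqrt (
    q ^+ (4 * N) * 2 `^ (- (\sum_i g i) - \sum_i h i) +
    2 * ((1 + q * (2 ^+ xi.+1 / (2 ^+ (2 * xi) + 1) *
        \big[Num.max/0]_i Num.max (2 `^ (- h i)) (2 `^ h i))) ^+ N.-1 - 1) *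
    (q ^+ (4 * N) * \prod_i Num.max 1 (2 `^ (- g i - h i)))).
Proof.
move=> t0 qt gg hh.
have q1 : 1 <= q by rewrite qt -[leLHS](powRr0 2) ler_powR // ler1n.
have q0 : 0 < q := lt_le_trans ltr01 q1.
have mono := @ler_powR R 2 (ler1n _ 2).
have gh i : 2 `^ (- g' i - h' i) <= q ^+ 2 * 2 `^ (- g i - h i).
  rewrite expr2 qt -!two_powRD mono //; have := gg i; have /andP[] := hh i; lra.
have k0 : 0 <= 2 ^+ xi.+1 / (2 ^+ (2 * xi) + 1) :> R.
  by rewrite divr_ge0 ?exprn_ge0 // addr_ge0 ?exprn_ge0.
have M0 f : 0 <= \big[Num.max/0]_(i < 2 * N) Num.max (2 `^ (- f i)) (2 `^ f i) :> R.
  exact: bigmax_ge_id.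
have qE : q ^+ (4 * N) = \prod_(i < 2 * N) q ^+ 2.
  by rewrite big_const_ord iter_mulr_1 -exprM; congr (_ ^+ _); lia.
apply: ler_wsqrtr; apply: lerD.
  rewrite -!sumrN -!big_split /= -!powR_sum qE -big_split /=.
  by apply: ler_prod => i _; rewrite powR_ge0 gh.
rewrite /decoupling_cst; apply: ler_pM.
- by rewrite mulr_ge0 // subr_ge0 exprn_ege1 // lerDl mulr_ge0.
- by apply: prodr_ge0 => i _; rewrite le_max ler01.
- rewrite ler_wpM2l // lerB // lerXn2r ?nnegrE ?addr_ge0 ?mulr_ge0 ?(ltW q0) //.
  rewrite lerD2l mulrCA ler_wpM2l //; apply: bigmax_le.
    by rewrite mulr_ge0 // ltW.
  move=> i _; have m := le_bigmax 0 (fun i => Num.max (2 `^ (- h i)) (2 `^ h i)) i.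
  apply: le_trans (ler_wpM2l (ltW q0) m); have /andP[h1 h2] := hh i.
  rewrite maxr_pMr ?(ltW q0) // qt -!two_powRD.
  by rewrite ge_max !le_max; apply/andP; split; apply/orP;
    [left | right]; apply: mono; lra.
- rewrite qE -big_split /=; apply: ler_prod => i _.
  rewrite le_max ler01 /= maxr_pMr ?exprn_ge0 ?(ltW q0) //.
  by rewrite ge_max !le_max mulr1 exprn_ege1 // gh orbT.
Qed.

(* The upper estimate of [entropy_bound_le] is a polynomial in [2 `^ t], hence
   continuous at [t = 0]. *)
Lemma entropy_bound_lim (x : R) g h :
  (forall t, 0 < t -> exists g' h', [/\ forall i, g i - t <= g' i,
     forall i, h i - t <= h' i <= h i & x <= entropy_bound xi g' h']) ->
  x <= entropy_bound xi g h.
Proof.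
move=> H; have [x0|x0] := leP x 0; first exact: le_trans x0 (entropy_bound_ge0 _ _).
rewrite -(ger0_norm (ltW x0)) -sqrtr_sqr; apply: ler_wsqrtr; apply/ler_addgt0Pr => e e0.
rewrite /decoupling_cst.
set A := 2 `^ (- _ - _); set B := \prod_i _; set m := _ / _ * _.
pose p : {poly R} := 'X ^+ (4 * N) * A%:P +
  2%:P * ((1 + 'X * m%:P) ^+ N.-1 - 1) * ('X ^+ (4 * N) * B%:P).
have pE q : p.[q] = q ^+ (4 * N) * A +
    2 * ((1 + q * m) ^+ N.-1 - 1) * (q ^+ (4 * N) * B).
  by rewrite /p !hornerE.
(* At 1 the polynomial takes the value under the root of [entropy_bound]; [1 + d / 2] is a point
   above 1 in the ball that continuity provides. *)
have /cvgrPdist_lt /(_ e e0) /nbhs_ballP[d /= d0 near1] := @continuous_horner R p 1.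
have q1 : 1 < 1 + d / 2 by rewrite ltrDl divr_gt0.
have := near1 (1 + d / 2); rewrite /ball /= opprD addrA subrr sub0r normrN.
rewrite gtr0_norm ?divr_gt0 // ltr_pdivrMr // mulr_natr mulr2n ltrDl => /(_ d0) lt.
pose t := log2 (1 + d / 2).
have t0 : 0 < t by rewrite divr_gt0 // ln_gt0 // ltr1n.
have qt : 1 + d / 2 = 2 `^ t by rewrite powR_log2 // (lt_trans ltr01).
have [g' [h' [gg hh le]]] := H t t0.
have := le_trans le (entropy_bound_le (ltW t0) qt gg hh); rewrite -/A -/B -/m -pE => le1.
have p0 : 0 <= p.[1 + d / 2] by rewrite ltW // -sqrtr_gt0 (lt_le_trans x0).
have le2 : x ^+ 2 <= p.[1 + d / 2].
  by rewrite -(sqr_sqrtr p0) lerXn2r // nnegrE ltW // (lt_le_trans x0).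
move: lt; rewrite ltr_norml => /andP[lt _].
have := pE 1; rewrite expr1n !mul1r => <-; move: lt le2; rewrite /=; lra.
Qed.

End Limit.

Section Decoupling.
Variable R : realType.

(** The supremum is only approached, hence the margin [t]; [H2_le] bounds the set and [rho] itself
    makes it nonempty. Fuchs-van de Graaf turns [delta] into [2 * delta]. *)
Lemma smooth_choice (I J : finType) (rho : op R (I * J)) (delta t : R) :
  state rho -> 0 <= delta -> 0 < t -> exists s : op R (I * J),
  [/\ state s, psd_close (2 * delta) rho s &
      H2_smooth delta rho - t <= H2 s <= H2_smooth delta rho].
Proof.
move=> rs d0 t0; have [rp r1] := rs.
have ub : has_ubound [set H2 s | s in state_ball delta rho].
  by exists (log2 #|I|%:R) => _ [s [ss _] <-]; apply: H2_le.
have hs : has_sup [set H2 s | s in state_ball delta rho].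
  by split=> //; exists (H2 rho), rho => //; split=> //; rewrite purified_distancexx.
have [_ [s [[sp s1] sd] <-] lt] := sup_adherent t0 hs.
exists s; split=> //; last first.
  by rewrite (ltW lt) /=; apply: (ub_le_sup ub); exists s.
have [P [Q [Pp Qp e le]]] := fuchs_van_de_graaf sp s1 rp r1.
exists Q, P; split=> //; first by rewrite -opprB e opprB.
by rewrite addrC (le_trans le) // ler_wpM2l.
Qed.

Lemma decoupling_bound (N xi : nat) (K E : 'I_(2 * N) -> finType)
    (rho : forall i, op R (region xi * K i))
    (T : forall i, {linear op R (region xi) -> op R (E i)})
    (g h : 'I_(2 * N) -> R) (eM eZ : R) :
  (0 < N)%N -> (0 < xi)%N -> 0 <= eM -> 0 <= eZ ->
  (forall i, state (rho i)) -> (forall i, state (choi (T i))) ->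
  (forall t i, 0 < t -> exists s, [/\ state s, psd_close eM (choi (T i)) s &
     g i - t <= H2 s]) ->
  (forall t i, 0 < t -> exists s, [/\ state s, psd_close eZ (rho i) s &
     h i - t <= H2 s <= h i]) ->
  ensemble_mean (decoupling_error rho T) <=
  2 * ((2 * N)%:R * eM + (2 * N)%:R * eZ) + entropy_bound xi g h.
Proof.
move=> N0 xi0 eM0 eZ0 rs Ts Mc Zc; rewrite /ensemble_mean.
have [fin|inf] := pselect (finite_set (@clifford_gates R N xi)); last first.
  rewrite (unif_mean_infinite _ inf) addr_ge0 ?entropy_bound_ge0 //.
  by rewrite mulr_ge0 // addr_ge0 // mulr_ge0.
pose D u := tens_dec (fun i => choi (T i)) rho u.
(* One contraction per choice of gates, adapted to the unsmoothed error and kept while the states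
   are replaced. *)
have /choice[W WP] : forall u, exists W, contraction W /\
    trace_norm (D u) = complex.Re (\tr (W *m D u)).
  by move=> u; have [W Wc e] := trace_norm_contraction (D u); exists W.
rewrite (eq_unif_mean fin (g := fun u => complex.Re (\tr (W u *m D u)))); last first.
  by move=> u _; rewrite decoupling_errorE -(WP u).2.
rewrite -lerBlDl; apply: entropy_bound_lim => t t0.
have [M' M'P] := fin_all_exists (fun i => Mc t i t0).
have [Z' Z'P] := fin_all_exists (fun i => Zc t i t0).
exists (fun i => H2 (M' i)), (fun i => H2 (Z' i)); split.
- by move=> i; case: (M'P i).
- by move=> i; case: (Z'P i).
rewrite lerBlDl; apply: (smoothed_bound N0 xi0 fin (fun u => (WP u).1)) => //.
- by move=> i; case: (M'P i).
- by move=> i; case: (Z'P i).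
- by move=> i; case: (M'P i).
- by move=> i; case: (Z'P i).
Qed.

End Decoupling.

Theorem theorem3 (R : realType) (n N xi : nat) (eps : R)
    (N_gt0 : (0 < N)%N) (xi_gt0 : (0 < xi)%N) (eps_gt0 : 0 < eps)
    (n_eq : n = (2 * N * xi)%N) (xi_eq : xi%:R = log2 (n%:R / eps))
    (Rf E : 'I_(2 * N) -> finType)
    (rho : forall i, op R (region xi * Rf i))
    (rho_state : forall i, state (rho i))
    (T : forall i, {linear op R (region xi) -> op R (E i)})
    (T_cp : forall i, completely_positive (T i))
    (tau_state : forall i, state (choi (T i)))
    (delta : R) (delta_gt0 : 0 < delta) (delta_lt1 : delta < 1) :
  let tau i := choi (T i) in
  ensemble_mean (decoupling_error rho T) <=
    16 * N%:R * delta +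
    entropy_bound xi (fun i => H2_smooth delta (tau i))
                     (fun i => H2_smooth delta (rho i))
  /\
  ensemble_mean (decoupling_error rho T) <=
    8 * N%:R * delta +
    entropy_bound xi (fun i => H2_smooth delta (tau i))
                     (fun i => H2 (rho i)).
Proof.
have d0 := ltW delta_gt0; have d20 : 0 <= 2 * delta by rewrite mulr_ge0.
(* Per smoothed family: [2 * N] factors, trace distance [2 * delta] for each, and 2 for the two
   halves of the error. *)
have c1 : 16 * N%:R * delta = 2 * ((2 * N)%:R * (2 * delta) + (2 * N)%:R * (2 * delta)).
  by rewrite natrM; ring.
have c2 : 8 * N%:R * delta = 2 * ((2 * N)%:R * (2 * delta) + (2 * N)%:R * 0).
  by rewrite natrM; ring.
have tauc t i : 0 < t -> exists s, [/\ state s, psd_close (2 * delta) (choi (T i)) s &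
    H2_smooth delta (choi (T i)) - t <= H2 s].
  by move=> t0; have [s [? ? /andP[? _]]] := smooth_choice (tau_state i) d0 t0; exists s.
split; [rewrite c1 | rewrite c2]; apply: decoupling_bound => // t i t0.
  exact: smooth_choice.
(* The unsmoothed input states stay in place, at distance 0. *)
exists (rho i); split=> //; first exact: psd_closexx.
by rewrite lexx andbT lerBlDr lerDl ltW.
Qed.
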